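(* Let $1<p<\infty$, $\alpha>0$ and $b\geq0$. The following statements are equivalent: (i) $\dot{H}^{\alpha+1/p}_p(\mathbb{T})\hookrightarrow\mathrm{Lip}^{(\alpha,-b)}_{\infty,\infty}(\mathbb{T})$; (ii) there is a constant $C>0$ such that for all $f\in\dot{B}^{1/p}_{p,1}(\mathbb{T})$ and all $t\in(0,1)$, $$\omega_\alpha(f,t)_{\infty;\mathbb{T}}\leq C\int_0^{t(1-\log t)^{b/\alpha}}u^{-1/p}\omega_{\alpha+1/p}(f,u)_{p;\mathbb{T}}\frac{du}u;$$ (iii) as $\alpha_0\to\alpha-$, $\dot{H}^{\alpha+1/p}_p(\mathbb{T})\hookrightarrow\dot{\mathcal{C}}^{\alpha_0}(\mathbb{T})$ with norm $\mathcal{O}((\alpha-\alpha_0)^{-b})$; i.e., there exist $\bar\alpha\in(0,\alpha)$ and $C>0$ such that for all $\alpha_0\in(\bar\alpha,\alpha)$ and all $f\in\dot{H}^{\alpha+1/p}_p(\mathbb{T})$, $$\sup_{0<t<1}t^{-\alpha_0}\omega_\alpha(f,t)_{\infty;\mathbb{T}}\leq C(\alpha-\alpha_0)^{-b}\|f\|_{\dot{H}^{\alpha+1/p}_p(\mathbb{T})};$$ (iv) $b\geq1/p'$, where $\frac1p+\frac1{p'}=1$.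
   Context: $\mathbb{T}=[0,2\pi]$ is the one-dimensional torus; functions are $2\pi$-periodic. $X\hookrightarrow Y$ means $X\subset Y$ with continuous natural embedding (with respect to the (semi)norms given below). Fractional modulus of smoothness ($s>0$): $\Delta_h^sf(x)=\sum_{j=0}^\infty(-1)^j\binom sjf(x+(s-j)h)$, $\binom sj=\frac{s(s-1)\cdots(s-j+1)}{j!}$, $\binom s0=1$, and $\omega_s(f,t)_{p;\mathbb{T}}=\sup_{|h|\le t}\|\Delta_h^sf\|_{L_p(\mathbb{T})}$. Fractional Sobolev space $\dot{H}^s_p(\mathbb{T})$ ($s>0$): all periodic $f$ with $\|f\|_{\dot{H}^s_p(\mathbb{T})}=\sup_{|\zeta|=1}\|D^s_\zeta f\|_{L_p(\mathbb{T})}<\infty$, where $D^s_\zeta f$ is the directional derivative of order $s$, with Fourier coefficients $(in\zeta)^s\widehat f(n)$, $n\in\mathbb{Z}$ ($\zeta=\pm1$). Logarithmic Lipschitz space $\mathrm{Lip}^{(s,-b)}_{\infty,\infty}(\mathbb{T})$: all $f\in L_\infty(\mathbb{T})$ with $\|f\|=\sup_{0<t<1}t^{-s}(1-\log t)^{-b}\omega_s(f,t)_{\infty;\mathbb{T}}<\infty$. Besov space $\dot{B}^s_{p,q}(\mathbb{T})$: all $f\in L_p(\mathbb{T})$ with $\big(\int_0^\infty(t^{-s}\omega_k(f,t)_{p;\mathbb{T}})^q\frac{dt}t\big)^{1/q}<\infty$ (supremum if $q=\infty$), where $k>s$ is any fixed (possibly fractional) order; different $k$ give equivalent seminorms. $\dot{\mathcal{C}}^s(\mathbb{T}):=\dot{B}^s_{\infty,\infty}(\mathbb{T})$.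 *)

(* Defs.v *)
From HB Require Import structures.
From mathcomp Require Import all_boot all_order all_algebra.
From mathcomp Require Import all_classical all_reals all_analysis.
From mathcomp Require Import complex.

Set Implicit Arguments.
Unset Strict Implicit.
Unset Printing Implicit Defensive.
Import Order.TTheory GRing.Theory Num.Theory.
Import numFieldNormedType.Exports.
Local Open Scope classical_set_scope.
Local Open Scope ring_scope.

(* Functions on the torus are complex-valued Borel functions on the line with
   period 2 pi; elements of L_p are handled through representatives, and every
   quantity below is invariant under changes on null sets. *)

Section Torus.
Context {R : realType}.
Implicit Types (f g : R -> R[i]) (p q : \bar R) (s t h x b k : R).

Local Notation mu := (@lebesgue_measure R).
Local Notation Re := (@complex.Re R).
Local Notation Im := (@complex.Im R).

Definition torus : set R := `[0, 2 * pi]%classic.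

Definition periodic f := forall x, f (x + 2 * pi) = f x.

Definition cmeasurable f :=
  measurable_fun setT (Re \o f) /\ measurable_fun setT (Im \o f).

Definition normT p f : \bar R :=
  'N[mu]_p[(fun x => (Normc.normc (f x))%:E) \_ torus]%E.

Definition LpT p : set (R -> R[i]) :=
  [set f | [/\ periodic f, cmeasurable f & (normT p f < +oo)%E]].

Definition integralT f : R[i] :=
  Complex (\int[mu]_(x in torus) Re (f x)) (\int[mu]_(x in torus) Im (f x)).

Definition expi x : R[i] := Complex (cos x) (sin x).

Definition fourier f (n : int) : R[i] :=
  Complex (2 * pi)^-1 0 * integralT (fun x => f x * expi (- (n%:~R * x))).

(* (i y)^s = |y|^s e^(i s (pi / 2) sgn y), the principal branch; it vanishes
   at y = 0 when s > 0. *)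
Definition ipow (y s : R) : R[i] :=
  Complex (`|y| `^ s) 0 * expi (s * (pi / 2) * Num.sg y).

Definition is_fracderiv s (zeta : R) f g :=
  LpT 1%E g /\ forall n : int, fourier g n = ipow (n%:~R * zeta) s * fourier f n.

(* The L_p norm of D^s_zeta f: this derivative is unique almost everywhere, so
   the infimum is over at most one value, and is +oo without a derivative. *)
Definition fracderiv_norm s p zeta f : \bar R :=
  ereal_inf [set normT p g | g in [set g | is_fracderiv s zeta f g]].

Definition sobolev_norm s p f : \bar R :=
  ereal_sup [set fracderiv_norm s p zeta f | zeta in [set zeta : R | `|zeta| = 1]].

(* L_1 is only required for the Fourier coefficients of f to make sense. *)
Definition sobolev s p : set (R -> R[i]) :=
  [set f | LpT 1%E f /\ (sobolev_norm s p f < +oo)%E].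

Definition gbinom s (j : nat) : R := (\prod_(i < j) (s - i%:R)) / (j`!)%:R.

(* For f in L_1 (in particular in any L_p) the series converges absolutely for
   almost every x. *)
Definition fracdiff s h f x : R[i] :=
  let term (F : R[i] -> R) (j : nat) : R :=
    (-1) ^+ j * gbinom s j * F (f (x + (s - j%:R) * h)) in
  Complex (limn (series (term Re))) (limn (series (term Im))).

Definition modulus s p f t : \bar R :=
  ereal_sup [set normT p (fracdiff s h f) | h in [set h : R | `|h| <= t]].

Definition lip_norm s b f : \bar R :=
  ereal_sup [set ((t `^ (- s) * (1 - ln t) `^ (- b))%:E * modulus s +oo%E f t)%E
            | t in `]0, 1[%classic].

(* Lip^(s,-b)_(oo,oo) *)
Definition lip s b : set (R -> R[i]) :=
  [set f | LpT +oo%E f /\ (lip_norm s b f < +oo)%E].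

Definition besov_norm k s p q f : \bar R :=
  match q with
  | r%:E => ((\int[mu]_(t in `]0%R, +oo[)
      (((t `^ (- s))%:E * modulus k p f t) `^ r * (t^-1)%:E)) `^ r^-1)%E
  | _ => ereal_sup [set ((t `^ (- s))%:E * modulus k p f t)%E
                   | t in `]0, +oo[%classic]
  end.

Definition besov k s p q : set (R -> R[i]) :=
  [set f | LpT p f /\ (besov_norm k s p q f < +oo)%E].

Definition embedded (X Y : set (R -> R[i])) (nX nY : (R -> R[i]) -> \bar R) :=
  X `<=` Y /\
  exists C : R, 0 < C /\ forall f, X f -> (nY f <= C%:E * nX f)%E.

End Torus.

(* Main.v *)
(* Write s = alpha + 1/p and q = p'.

   Sufficiency of b >= 1/q.  A function f is split at a frequency 2^k0 into a low
   frequency part and sharp dyadic blocks.  Each of them is the convolution of a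
   fractional derivative D^s f (for (i)) or of a fractional difference of order s
   of f (for (ii)) with an explicit kernel, so that Hoelder's inequality reduces
   everything to L_q norms of trigonometric kernels; these are estimated by Abel
   summation, which gives pointwise bounds by powers of min(2^k, 1/|sin (z/2)|).
   The blocks contribute a geometric series, while the difference of order alpha
   of the low frequency part is controlled by a kernel of size |z|^(-1/q), whose
   L_q norm is of order k0^(1/q): with 2^-k0 of the order of t this is the
   logarithmic factor (1 - log t)^(1/q).  For (ii) the splitting is done at
   U = t (1 - log t)^(b/alpha) and the blocks are summed by the monotonicity of
   the modulus of smoothness.

   From (i) to (iii): t^e (1 - log t)^b is at most a multiple of e^(-b).

   Necessity.  For f = sum_(1 <= n < 2^m) n^(-1-alpha) e^(inx) the norm of D^s f
   in L_p is at most of order m^(1/p), whereas the modulus of order alpha is at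
   least of order t^alpha m for t <= 2^-m, since at one point all the terms of the
   difference have the same phase.  Taking t = 2^-m and alpha - alpha0 = 1/m in
   (iii), or t = 2^(-2m) in (ii), yields m <= C m^(b + 1/p) for all large m. *)

Require Import Defs.
From HB Require Import structures.
From mathcomp Require Import all_boot all_order all_algebra.
From mathcomp Require Import all_classical all_reals all_analysis.
From mathcomp Require Import measurable_realfun ess_sup_inf.
From mathcomp Require Import complex.
From mathcomp Require Import ring lra zify.
Import Order.TTheory GRing.Theory Num.Theory.
Import numFieldNormedType.Exports.
Local Open Scope classical_set_scope.
Local Open Scope ring_scope.

Set Implicit Arguments.
Unset Strict Implicit.
Unset Printing Implicit Defensive.

(** * Integrals over a period *)

Section PeriodicIntegrals.
Context {R : realType}.
Local Notation mu := (@lebesgue_measure R).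
Local Notation torus := (@torus R).

(** Real and imaginary parts are treated separately, and the Fourier coefficients of a real function
    are its integrals against [cos (n * y + t)], with [n] a natural number and [t] a free phase.
    Fractional derivatives and differences then act on each frequency by an amplitude and a shift of
    the phase. Inverting a derivative gives the amplitude n^(-s); inverting a difference of step v
    gives n^(-s) times a power of (n v / 2) / sin (n v / 2), which increases with n: hence a
    summation by parts for products of a decreasing and an increasing sequence. Three obstacles
    shape the rest. The series of a difference of an integrable function converges only almost
    everywhere; its multiplier is computed on cosines and carried over by dominated convergence.
    Sharp dyadic blocks of an integrable function need not converge to it; their sum is identified
    by the uniqueness of Fourier coefficients. The modulus of smoothness is not shown to be
    measurable in its argument, so its integrals are only compared with dyadic step functions. *)

Lemma lebesgue_measureD (a : R) (A : set R) : measurable A ->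
  pushforward mu (fun x : R => (x + a : measurableTypeR R)) A = mu A.
Proof.
move=> mA; apply/esym/lebesgue_measure_unique => //=; first exact: measurable_funD.
move=> ? _ [[u v]] _ <-.
rewrite /pushforward (_ : _ @^-1` _ = `]u - a, v - a]%classic).
  by rewrite !lebesgue_measure_itv/= !lte_fin ltrD2r -!EFinB; congr (if _ then _ else _); congr (_%:E); ring.
by apply/seteqP; split => x/=; rewrite !in_itv/= ltrBlDr lerBrDr.
Qed.

Lemma ge0_integral_translate (a u v : R) (f : R -> \bar R) :
  measurable_fun setT f -> (forall x, 0 <= f x)%E ->
  (\int[mu]_(x in `[u, v[) f (x + a)%R = \int[mu]_(x in `[(u + a)%R, (v + a)%R[) f x)%E.
Proof.
move=> mf f0.
pose phi (x : R) : measurableTypeR R := x + a.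
have mphi : measurable_fun setT phi by exact: measurable_funD.
have -> : `[u, v[%classic = phi @^-1` `[u + a, v + a[.
  by apply/seteqP; split => x/=; rewrite !in_itv/= lerD2r ltrD2r.
transitivity (\int[pushforward mu phi]_(x in `[(u + a)%R, (v + a)%R[) f x)%E.
  by rewrite ge0_integral_pushforward//=; exact: measurable_funS mf.
by apply: eq_measure_integral => //= A mA _; exact: lebesgue_measureD.
Qed.

Lemma periodic_int (T : Type) (f : R -> T) (w : R) (z : int) x :
  (forall x, f (x + w) = f x) -> f (x + z%:~R * w) = f x.
Proof.
move=> pf.
have Hn n y : f (y + n%:R * w) = f y.
  elim: n => [|n IH] ; first by rewrite mul0r addr0.
  by rewrite -IH -(pf (y + n%:R * w)); congr f; rewrite -natr1; ring.
case: z => n; first exact: Hn.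
by rewrite -(Hn n.+1 (x + _)); congr f; rewrite NegzE mulrNz mulNr subrK.
Qed.

Let I (f : R -> \bar R) a := (\int[mu]_(x in `[a, (a + 2 * pi)%R[) f x)%E.

(** An integer multiple of the period brings [a] into [0, 2 pi); the two windows then share a middle
    piece, and the remaining pieces are translates of each other. Half-open intervals keep the
    pieces disjoint. *)
Lemma ge0_integral_period (f : R -> \bar R) a :
  measurable_fun setT f -> (forall x, 0 <= f x)%E ->
  (forall x, f (x + 2 * pi) = f x) -> I f a = I f 0.
Proof.
move=> mf f0 pf.
have p0 : 0 < 2 * pi :> R by rewrite mulr_gt0 ?pi_gt0.
have itvU (u v w : R) : u <= v -> v <= w ->
  (\int[mu]_(x in `[u, w[) f x =
   \int[mu]_(x in `[u, v[) f x + \int[mu]_(x in `[v, w[) f x)%E.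
  move=> uv vw; rewrite -ge0_integral_setU//=.
  - congr integral; apply/seteqP; split => x/=; rewrite !in_itv/=.
      by move=> /andP[-> ->]; rewrite andbT; case: (ltP x v) => xv; [left|right].
    by case=> /andP[h1 h2]; rewrite ?h1 ?h2 ?andbT/= ?(le_trans uv) ?(lt_le_trans h2).
  - exact: measurable_funTS.
  - apply/disj_setPS => x [] /=; rewrite !in_itv/= => /andP[_ h1] /andP[h2 _].
    by rewrite leNgt h1 in h2.
have stepI b c : b <= c -> c <= b + 2 * pi -> I f b = I f c.
  move=> bc cb; rewrite /I (itvU b c)// (itvU c (b + 2 * pi) (c + 2 * pi))//; last first.
    by rewrite lerD2r.
  rewrite -(ge0_integral_translate _ b c mf f0) addeC; congr (_ + _)%E.
  by apply: eq_integral => x _; rewrite pf.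
pose z := Num.floor (a / (2 * pi)).
have /andP[za az] : z%:~R <= a / (2 * pi) < (z + 1)%:~R by exact: floor_itv.
rewrite ler_pdivlMr// in za; rewrite ltr_pdivrMr// intrD mulrDl mul1r in az.
transitivity (I f (a - z%:~R * (2 * pi))).
  rewrite {1}/I (_ : a = a - z%:~R * (2 * pi) + z%:~R * (2 * pi)); last by rewrite subrK.
  rewrite (addrAC _ _ (2 * pi)) -ge0_integral_translate// addrK.
  by apply: eq_integral => x _; rewrite periodic_int.
by symmetry; apply: stepI; lra.
Qed.

Lemma torus_co (f : R -> \bar R) : measurable_fun setT f ->
   (\int[mu]_(x in torus) f x = I f 0)%E.
Proof.
move=> mf; rewrite /I add0r integral_itv_bndo_bndc//; exact: measurable_funTS.
Qed.

Lemma ge0_torus_translate (f : R -> \bar R) a :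
  measurable_fun setT f -> (forall x, 0 <= f x)%E ->
  (forall x, f (x + 2 * pi) = f x) ->
  (\int[mu]_(x in torus) f (x + a)%R = \int[mu]_(x in torus) f x)%E.
Proof.
move=> mf f0 pf; have mfa : measurable_fun setT (fun x : R => f (x + a)).
  by apply: measurableT_comp => //; exact: measurable_funD.
rewrite !torus_co// -(ge0_integral_period a mf f0 pf) /I ge0_integral_translate//.
by rewrite !add0r (addrC a).
Qed.


Lemma measurable_translate d (T : measurableType d) (F : R -> T) a :
  measurable_fun setT F -> measurable_fun setT (fun x : R => F (x + a)).
Proof. by move=> mF; apply: measurableT_comp => //; exact: measurable_funD. Qed.

(** Measurability is required on the whole line, and not only on the torus, so that the class is
    stable under the translations occurring in differences. *)
Definition perL1 (F : R -> R) := [/\ measurable_fun setT F,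
  (forall x, F (x + 2 * pi) = F x) & mu.-integrable torus (EFin \o F)].

Lemma measurable_torus : measurable torus.
Proof. exact: measurable_itv. Qed.
Hint Resolve measurable_torus : core.

Lemma lebesgue_measure_torus : mu torus = (2 * pi)%:E.
Proof.
by rewrite /Defs.torus lebesgue_measure_itv/= lte_fin mulr_gt0 ?pi_gt0//= sube0.
Qed.

Lemma torus_lty : (mu torus < +oo)%E.
Proof. by rewrite lebesgue_measure_torus ltry. Qed.

Lemma Rintegral_torus_cst (c : R) : \int[mu]_(x in torus) c = 2 * pi * c.
Proof.
rewrite Rintegral_cst//.
rewrite mulrC; congr (_ * _).
exact: (congr1 fine lebesgue_measure_torus).
Qed.

Lemma perL1_translate F a : perL1 F -> perL1 (fun x => F (x + a)).
Proof.
move=> [mF pF /integrableP[_ iF]]; split; first exact: measurable_translate.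
  by move=> x; rewrite addrAC.
apply/integrableP; split.
  by apply/measurable_EFinP/measurable_funTS; exact: measurable_translate.
rewrite (ge0_torus_translate (f := fun x => `|(F x)%:E|%E))//.
- by apply: measurableT_comp => //; exact/measurable_EFinP.
- by move=> x; rewrite pF.
Qed.


Lemma Rintegral_torus_translate F a : perL1 F ->
  \int[mu]_(x in torus) F (x + a) = \int[mu]_(x in torus) F x.
Proof.
move=> [mF pF iF]; rewrite /Rintegral; congr fine.
rewrite integralE [RHS]integralE.
have mE : measurable_fun setT (EFin \o F) by exact/measurable_EFinP.
congr (_ - _)%E.
- rewrite -[RHS](@ge0_torus_translate (funepos (EFin \o F)) a)//; last 2 first.
  + apply: measurable_funepos; exact: mE.
  + by move=> x; rewrite !funeposE /= pF.
  + by apply: eq_integral => x _; rewrite !funeposE.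
- rewrite -[RHS](@ge0_torus_translate (funeneg (EFin \o F)) a)//; last 2 first.
  + apply: measurable_funeneg; exact: mE.
  + by move=> x; rewrite !funenegE /= pF.
  + by apply: eq_integral => x _; rewrite !funenegE.
Qed.

Lemma perL1D F G : perL1 F -> perL1 G -> perL1 (fun x => F x + G x).
Proof.
move=> [mF pF iF] [mG pG iG]; split; first exact: measurable_funD.
  by move=> x; rewrite pF pG.
by apply: eq_integrable (integrableD _ iF iG) => // x _; rewrite /= EFinD.
Qed.

Lemma perL1Mb F (G : R -> R) (M : R) : perL1 F -> measurable_fun setT G ->
  (forall x, G (x + 2 * pi) = G x) -> (forall x, `|G x| <= M) ->
  perL1 (fun x => F x * G x).
Proof.
move=> [mF pF iF] mG pG bG; split; first exact: measurable_funM.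
  by move=> x; rewrite pF pG.
apply: eq_integrable (@integrableMl _ _ _ mu torus measurable_torus _ G iF _ _) => //.
- exact: measurable_funTS.
- exists M; split; first exact: num_real.
  by move=> y My x _ /=; apply: le_trans (bG x) (ltW My).
Qed.

Lemma perL1_cst (c : R) : perL1 (cst c).
Proof.
split => //; apply: (@measurable_bounded_integrable _ _ _ mu) => //.
- exact: torus_lty.
- by exists `|c|; split; [exact: num_real|move=> y /ltW cy x _].
Qed.

Lemma perL1_bounded (G : R -> R) (M : R) : measurable_fun setT G ->
  (forall x, G (x + 2 * pi) = G x) -> (forall x, `|G x| <= M) -> perL1 G.
Proof.
move=> mG pG bG; have := perL1Mb (perL1_cst 1) mG pG bG.
by under eq_fun do rewrite mul1r.
Qed.

Lemma perL1Z c F : perL1 F -> perL1 (fun x => c * F x).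
Proof.
move=> pF; have := perL1Mb pF (@measurable_cst _ _ _ _ setT c) (fun=> erefl) (fun=> lexx `|c|).
by under eq_fun do rewrite mulrC.
Qed.

Lemma perL1N F : perL1 F -> perL1 (fun x => - F x).
Proof.
by move=> /(perL1Z (-1)); under eq_fun do rewrite mulN1r.
Qed.

Lemma perL1B F G : perL1 F -> perL1 G -> perL1 (fun x => F x - G x).
Proof. by move=> pF /perL1N; exact: perL1D. Qed.

Lemma perL1_sum (J : Type) (s : seq J) (P : pred J) (F : J -> R -> R) :
  (forall i, perL1 (F i)) -> perL1 (fun x => \sum_(i <- s | P i) F i x).
Proof.
move=> pF; elim: s => [|i s IH].
  by under eq_fun do rewrite big_nil; exact: perL1_cst.
rewrite (_ : (fun _ => _) = fun x => if P i then F i x + \sum_(i <- s | P i) F i x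
    else \sum_(i <- s | P i) F i x); last by apply/funext => x; rewrite big_cons.
by case: (P i) => //; exact: perL1D.
Qed.

Lemma perL1_integrable F : perL1 F -> mu.-integrable torus (EFin \o F).
Proof. by case. Qed.

Definition tint (F : R -> R) := \int[mu]_(x in torus) F x.

Lemma eq_tint F G : F =1 G -> tint F = tint G.
Proof. by move=> /funext ->. Qed.

Lemma tint_cst c : tint (cst c) = 2 * pi * c.
Proof. exact: Rintegral_torus_cst. Qed.

Lemma tintD F G : perL1 F -> perL1 G ->
  tint (fun x => F x + G x) = tint F + tint G.
Proof. by move=> [_ _ ?] [_ _ ?]; rewrite /tint RintegralD. Qed.

Lemma tintB F G : perL1 F -> perL1 G ->
  tint (fun x => F x - G x) = tint F - tint G.
Proof. by move=> [_ _ ?] [_ _ ?]; rewrite /tint RintegralB. Qed.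

Lemma tintZ c F : perL1 F -> tint (fun x => c * F x) = c * tint F.
Proof. by move=> [_ _ ?]; rewrite /tint RintegralZl. Qed.

Lemma tint_sum (J : Type) (s : seq J) (P : pred J) (F : J -> R -> R) :
  (forall i, perL1 (F i)) ->
  tint (fun x => \sum_(i <- s | P i) F i x) = \sum_(i <- s | P i) tint (F i).
Proof.
move=> pF; elim: s => [|i s IH].
  rewrite big_nil (@eq_tint _ (cst 0)) ?tint_cst ?mulr0// => x.
  by rewrite big_nil.
rewrite big_cons; under eq_tint do rewrite big_cons; case: ifP => // _.
by rewrite tintD// ?IH//; exact: perL1_sum.
Qed.

Lemma tint_translate F a : perL1 F -> tint (fun x => F (x + a)) = tint F.
Proof. exact: Rintegral_torus_translate. Qed.

Lemma perL1_norm F : perL1 F -> perL1 (fun x => `|F x|).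
Proof.
move=> [mF pF iF]; split; last exact: integrable_norm.
- exact: measurableT_comp.
- by move=> x; rewrite pF.
Qed.

Lemma cosD2pin (x : R) (n : nat) : cos (x + n%:R * (2 * pi)) = cos x.
Proof.
elim: n => [|n IH]; first by rewrite mul0r addr0.
by rewrite -natr1 mulrDl mul1r addrA (mulr_natl pi 2) cosD2pi -(mulr_natl pi 2) IH.
Qed.

Lemma measurable_cosl (k t : R) : measurable_fun setT (fun x => cos (k * x + t)).
Proof.
apply: continuous_measurable_fun => x.
apply: continuous_comp; last exact: continuous_cos.
by apply: continuousD; [apply: continuousM; [exact: cst_continuous|]|exact: cst_continuous].
Qed.

Lemma cosl_periodic (n : nat) (t x : R) : cos (n%:R * (x + 2 * pi) + t) = cos (n%:R * x + t).
Proof. by rewrite mulrDr addrAC cosD2pin. Qed.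

Lemma perL1Mcos F (n : nat) t : perL1 F -> perL1 (fun x => F x * cos (n%:R * x + t)).
Proof.
move=> pF; apply: (@perL1Mb _ _ 1) => //.
- exact: measurable_cosl.
- by move=> x; exact: cosl_periodic.
- by move=> x; exact: cos_max.
Qed.

Lemma perL1_cos (n : nat) t : perL1 (fun x => cos (n%:R * x + t)).
Proof.
apply: (@perL1_bounded _ 1); [exact: measurable_cosl| |].
- by move=> x; exact: cosl_periodic.
- by move=> x; exact: cos_max.
Qed.

(* Translation by half a period changes the sign. *)
Lemma tint_cos0 (n : nat) t : (0 < n)%N -> tint (fun x => cos (n%:R * x + t)) = 0.
Proof.
move=> n0; have := tint_translate (pi / n%:R) (perL1_cos n t).
under eq_tint => x.
  rewrite mulrDr mulrCA mulfV ?pnatr_eq0 -?lt0n// mulr1 addrAC cosDpi -mulN1r.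
  over.
by rewrite tintZ; [lra|exact: perL1_cos].
Qed.

Lemma tint_coscos (n m : nat) s t : (0 < n)%N ->
  tint (fun x => cos (n%:R * x + s) * cos (m%:R * x + t)) =
  if n == m then pi * cos (s - t) else 0.
Proof.
move=> n0.
have E x : cos (n%:R * x + s) * cos (m%:R * x + t) =
    2^-1 * cos ((n + m)%:R * x + (s + t)) +
    2^-1 * (if (m <= n)%N then cos ((n - m)%:R * x + (s - t))
            else cos ((m - n)%:R * x + (t - s))).
  (* Frequencies are natural numbers, so the difference of two of them is taken in the order that
     makes it nonnegative; the cosine being even, nothing is lost. *)
  have -> : (if (m <= n)%N then cos ((n - m)%:R * x + (s - t))
            else cos ((m - n)%:R * x + (t - s))) =
            cos ((n%:R * x + s) - (m%:R * x + t)).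
    case: leqP => mn; first by rewrite natrB//; congr cos; ring.
    by rewrite -cosN natrB ?(ltnW mn)//; congr cos; ring.
  rewrite natrD (_ : _ * x + (s + t) = (n%:R * x + s) + (m%:R * x + t)); last by ring.
  by move: (_ + s) (_ + t) => u v; rewrite cosD cosB; field.
under eq_tint do rewrite E.
have p2 : perL1 (fun x => if (m <= n)%N then cos ((n - m)%:R * x + (s - t))
            else cos ((m - n)%:R * x + (t - s))).
  by case: leqP => _; exact: perL1_cos.
rewrite tintD; [|by apply: perL1Z; exact: perL1_cos|exact: perL1Z].
rewrite !tintZ//; last exact: perL1_cos.
rewrite tint_cos0 ?addn_gt0 ?n0// mulr0 add0r; case: eqP => [<-|/eqP nm].
  rewrite leqnn subnn (@eq_tint _ (cst (cos (s - t)))).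
    by rewrite tint_cst; field.
  by move=> x; rewrite mul0r add0r.
case: leqP => mn; rewrite tint_cos0 ?mulr0// subn_gt0//.
by rewrite ltn_neqAle eq_sym nm.
Qed.

End PeriodicIntegrals.
#[global] Hint Resolve measurable_torus : core.

(** * Binomial series *)

Section RealSeries.
Context {R : realType}.
Implicit Types (a b : R ^nat).

Definition ser a : R := limn (series a).
Definition summ a := cvgn (series (fun n => `|a n|)).

Lemma summ_cvg a : summ a -> series a @ \oo --> ser a.
Proof. exact: normed_cvg. Qed.

Lemma summ_bounded a S : (forall n, \sum_(0 <= k < n) `|a k| <= S) -> summ a.
Proof.
move=> aS; apply: nondecreasing_is_cvgn.
  by apply/nondecreasing_seqP => n; rewrite /series/= big_nat_recr//= lerDl.
by exists S => _ [n _ <-]; exact: aS.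
Qed.

Lemma summ_le a b : (forall n, `|a n| <= b n) -> cvgn (series b) -> summ a.
Proof.
move=> ab; apply: series_le_cvg => // n.
by apply: le_trans (ab n).
Qed.

Lemma summ_leM a b M : (forall n, `|a n| <= M * `|b n|) -> summ b -> summ a.
Proof.
move=> ab sb; apply: (@summ_le _ (fun n => M * `|b n|)) => //.
exact: is_cvg_seriesZ sb.
Qed.

Lemma summM_bounded a b M : (forall n, `|b n| <= M) -> summ a ->
  summ (fun n => a n * b n).
Proof.
by move=> bM; apply: (@summ_leM _ _ M) => n; rewrite normrM mulrC ler_wpM2r.
Qed.

Lemma serD a b : summ a -> summ b -> ser (fun n => a n + b n) = ser a + ser b.
Proof. by move=> /summ_cvg ca /summ_cvg cb; apply: lim_seriesD; apply: cvgP; eassumption. Qed.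

Lemma serB a b : summ a -> summ b -> ser (fun n => a n - b n) = ser a - ser b.
Proof. by move=> /summ_cvg ca /summ_cvg cb; apply: lim_seriesB; apply: cvgP; eassumption. Qed.

Lemma serZ k a : summ a -> ser (fun n => k * a n) = k * ser a.
Proof. by move=> /summ_cvg ca; apply: (@lim_seriesZ R a k); apply: cvgP; eassumption. Qed.

Lemma summD a b : summ a -> summ b -> summ (fun n => a n + b n).
Proof.
move=> sa sb; apply: (@summ_le _ (fun n => `|a n| + `|b n|)).
  by move=> n; exact: ler_normD.
exact: is_cvg_seriesD.
Qed.

Lemma summZ k a : summ a -> summ (fun n => k * a n).
Proof. by apply: summ_leM => n; rewrite normrM. Qed.

Lemma summB a b : summ a -> summ b -> summ (fun n => a n - b n).
Proof.
move=> sa sb; have := summD sa (@summZ (-1) b sb).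
by under eq_fun do rewrite mulN1r.
Qed.

Lemma ser_norm a b : (forall n, `|a n| <= b n) -> cvgn (series b) -> `|ser a| <= ser b.
Proof.
move=> ab cb; have sa := summ_le ab cb.
by apply: le_trans (lim_series_norm sa) _; apply: lim_series_le.
Qed.

Lemma ser_normM a b M : (forall n, `|a n| <= M * `|b n|) -> summ b ->
  `|ser a| <= M * ser (fun n => `|b n|).
Proof.
move=> ab sb; rewrite -serZ; last first.
  by move: sb; rewrite /summ; under [in X in _ -> X]eq_fun do rewrite normr_id.
by apply: ser_norm => //; exact: is_cvg_seriesZ.
Qed.

Lemma eq_ser a b : a =1 b -> ser a = ser b.
Proof. by move=> /funext ->. Qed.

Lemma seriesS a n : series a n.+1 = a 0%N + series (fun k => a k.+1) n.
Proof. by rewrite /series/= big_nat_recl. Qed.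


Lemma cvg_seriesS a l : series a @ \oo --> l ->
  series (fun k => a k.+1) @ \oo --> l - a 0%N.
Proof.
move=> al; rewrite (_ : series _ = fun n => series a n.+1 - a 0%N); last first.
  by apply/funext => n; rewrite seriesS addrAC subrr add0r.
apply: cvgB; last exact: cvg_cst.
by rewrite (cvg_shiftS (series a)).
Qed.

Lemma summS a : summ a -> summ (fun n => a n.+1).
Proof. by move=> sa; apply: cvgP (cvg_seriesS (a := fun n => `|a n|) sa). Qed.

Lemma serS a : summ a -> ser a = a 0%N + ser (fun n => a n.+1).
Proof.
move=> /summ_cvg /cvg_seriesS /cvg_lim; rewrite /ser => -> //.
by rewrite addrC subrK.
Qed.

Lemma summ_shift1 a : summ (fun n => a n.+1) -> summ a.
Proof.
move=> sa; apply: (@summ_bounded _ (`|a 0%N| + limn (series (fun n => `|a n.+1|)))) => n.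
case: n => [|n]; first by rewrite big_nil addr_ge0//; apply: limr_ge => //; near=> n; exact: sumr_ge0.
rewrite big_nat_recl// lerD2l; apply: (nondecreasing_cvgn_le _ sa n).
by apply/nondecreasing_seqP => m; rewrite /series/= big_nat_recr//= lerDl.
Unshelve. all: by end_near. Qed.

Lemma summ_shift a m : summ (fun n => a (m + n)%N) -> summ a.
Proof.
elim: m a => [//|m IH] a sa; apply: IH; apply: summ_shift1.
by under eq_fun do rewrite -addSnnS.
Qed.

End RealSeries.

(** * The coefficients of fractional differences *)

Section Binomial.
Context {R : realType}.
Implicit Types (s w x y : R) (j n : nat).

(** Coefficient of x^j in the expansion of (1 - x)^s. *)
Definition bc s j : R := (-1) ^+ j * gbinom s j.

Lemma gbinom0 s : gbinom s 0 = 1.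
Proof. by rewrite /gbinom big_ord0 fact0 divr1. Qed.

Lemma gbinomS s j : gbinom s j.+1 = gbinom s j * (s - j%:R) / j.+1%:R.
Proof.
rewrite /gbinom big_ord_recr/= factS natrM invfM.
by rewrite -!mulrA; congr (_ * _); rewrite [LHS]mulrA [RHS]mulrC.
Qed.

Lemma gbinomS1 s j : j.+1%:R * gbinom s j.+1 = s * gbinom (s - 1) j.
Proof.
rewrite /gbinom big_ord_recl/= subr0 factS natrM invfM.
rewrite (_ : \prod_(i < j) (s - (bump 0 i)%:R) = \prod_(i < j) (s - 1 - i%:R)); last first.
  by apply: eq_bigr => i _; rewrite /bump/= natrD opprD addrA.
by field; rewrite addrC natr1 !pnatr_eq0 -!lt0n fact_gt0.
Qed.

Lemma gbinom_pascal s j : gbinom s j.+1 = gbinom (s - 1) j.+1 + gbinom (s - 1) j.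
Proof.
apply: (@mulfI _ j.+1%:R); first by rewrite pnatr_eq0.
rewrite mulrDr gbinomS1 (gbinomS (s - 1)).
by field; rewrite addrC natr1 pnatr_eq0.
Qed.

Lemma bc0 s : bc s 0 = 1.
Proof. by rewrite /bc gbinom0 mulr1 expr0. Qed.

Lemma bcS s j : bc s j.+1 = bc s j * ((j%:R - s) / j.+1%:R).
Proof. by rewrite /bc exprS gbinomS; field; rewrite addrC natr1 pnatr_eq0. Qed.

Lemma bcS1 s j : j.+1%:R * bc s j.+1 = - s * bc (s - 1) j.
Proof. by rewrite /bc exprS mulrCA gbinomS1; ring. Qed.

Lemma bc_pascal s j : bc s j.+1 = bc (s - 1) j.+1 - bc (s - 1) j.
Proof. by rewrite /bc gbinom_pascal exprS; ring. Qed.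

Lemma bc_sum s n : \sum_(0 <= j < n.+1) bc s j = bc (s - 1) n.
Proof.
elim: n => [|n IH]; first by rewrite big_nat1 !bc0.
by rewrite big_nat_recr//= IH bc_pascal addrC subrK.
Qed.

Lemma bc_norm s : 0 < s -> forall m j, s <= m%:R ->
  `|bc (s - 1) (m + j)| <= `|bc (s - 1) m|.
Proof.
move=> s0 m + sm; elim=> [|j IH]; first by rewrite addn0.
rewrite addnS bcS normrM; apply: le_trans IH; rewrite ler_piMr//.
have j0 : 0 < (m + j).+1%:R :> R by rewrite ltr0n.
have mj : m%:R <= (m + j)%:R :> R by rewrite ler_nat leq_addr.
rewrite ger0_norm; last by rewrite divr_ge0 ?(ltW j0)//; lra.
by rewrite ler_pdivrMr// mul1r -natr1; lra.
Qed.

Lemma bc_sign s m j : s <= m%:R -> 0 <= bc s (m + j) * Num.sg (bc s m).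
Proof.
move=> sm; elim: j => [|j IH]; first by rewrite addn0 mulrC -normrEsg.
rewrite addnS bcS mulrAC mulr_ge0// divr_ge0// subr_ge0.
by apply: le_trans sm _; rewrite ler_nat leq_addr.
Qed.

(** From an index [m.+1 >= s] on the coefficients keep their sign, so a sum of their absolute values
    is, up to sign, a difference of two partial sums. By [bc_sum] these are coefficients of order
    [s - 1], which are bounded by [bc_norm]. *)
Lemma bc_summ s : 0 < s -> summ (bc s).
Proof.
move=> s0.
have [m sm] : exists m, s <= m.+1%:R.
  exists (Num.truncn s); exact/ltW/truncnS_gt.
pose S : R := \sum_(0 <= j < m.+1) `|bc s j| + `|bc (s - 1) m.+1| + `|bc (s - 1) m|.
have S0 : 0 <= S by rewrite !addr_ge0// sumr_ge0.
apply: (@summ_bounded _ _ S) => n.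
have H j : \sum_(0 <= k < m.+1 + j) `|bc s k| =
    \sum_(0 <= j < m.+1) `|bc s j| + 
    (\sum_(m.+1 <= k < m.+1 + j) bc s k) * Num.sg (bc s m.+1).
  rewrite (big_cat_nat (n := m.+1))//= ?leq_addr//; congr (_ + _).
  rewrite big_distrl/= !big_nat; apply: eq_bigr => k /andP[mk _].
  have := bc_sign (k - m.+1) sm; rewrite subnKC// => h.
  (* When [s] is a natural number the coefficients vanish from here on, and so does the sign: both
     sides are 0. *)
  have [bm|bm] := eqVneq (bc s m.+1) 0.
    suff -> : bc s k = 0 by rewrite normr0 mul0r.
    rewrite -(subnKC mk); elim: (k - m.+1)%N => [|i IH]; first by rewrite addn0.
    by rewrite addnS bcS IH mul0r.
  rewrite -[RHS]ger0_norm// [RHS]normrM (_ : `|Num.sg (bc s m.+1)| = 1) ?mulr1//.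
  by rewrite normr_sg bm.
have H2 j : \sum_(0 <= k < m.+1 + j) `|bc s k| <= S.
  rewrite H /S -addrA lerD2l.
  have -> : \sum_(m.+1 <= k < m.+1 + j) bc s k =
     \sum_(0 <= k < m.+1 + j) bc s k - \sum_(0 <= k < m.+1) bc s k.
    by rewrite [X in X - _](big_cat_nat (n := m.+1))//= ?leq_addr// addrAC subrr add0r.
  rewrite bc_sum; case: j => [|j].
    by rewrite addn0 bc_sum subrr mul0r addr_ge0.
  rewrite addnS bc_sum (le_trans (ler_norm _))// normrM.
  have sg1 : `|Num.sg (bc s m.+1)| <= 1 by rewrite normr_sg; case: (_ == _).
  apply: le_trans (ler_piMr _ sg1) _ => //.
  by apply: le_trans (ler_normB _ _) _; rewrite lerD2r; exact: bc_norm.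
apply: le_trans (H2 n).
by rewrite [leRHS](big_cat_nat (n := n))//= ?leq_addl// lerDl sumr_ge0.
Qed.

(* If the limit [l] of the partial sums [bc (s - 1) n] were nonzero, then
   [n * bc s n] would stay away from 0, contradicting the divergence of the
   harmonic series. *)
Lemma ser_bc s : 0 < s -> ser (bc s) = 0.
Proof.
move=> s0; have sb := bc_summ s0.
have cb : bc (s - 1) @ \oo --> ser (bc s).
  rewrite (_ : bc (s - 1) = fun n => series (bc s) n.+1); last first.
    by apply/funext => n; rewrite /series/= bc_sum.
  by rewrite (cvg_shiftS (series (bc s))); exact: summ_cvg.
apply/eqP/negP => /negP l0.
have [m sm] : exists m, s <= m.+1%:R.
  exists (Num.truncn s); exact/ltW/truncnS_gt.
have lb n : (m.+1 <= n)%N -> `|ser (bc s)| <= `|bc (s - 1) n|.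
  move=> mn; have cn := @cvg_norm _ _ _ _ eventually_filter _ _ cb.
  apply: (cvgr_to_le cn); near=> k.
  have nk : (n <= k)%N by near: k; exact: nbhs_infty_ge.
  rewrite -(subnKC nk); apply: bc_norm => //.
  by apply: le_trans sm _; rewrite ler_nat.
apply: (@dvg_harmonic R).
have : summ (@harmonic R).
  apply: (@summ_shift _ _ m.+1).
  have sb1 : summ (fun n => bc s (m.+1 + n).+1).
    elim: m.+1 => [|k IH]; first exact: summS.
    by have := summS IH; under eq_fun do rewrite addnS -addSn.
  apply: (summ_leM (M := (s * `|ser (bc s)|)^-1)) sb1 => n.
  have n0 : 0 < (m.+1 + n).+1%:R :> R by rewrite ltr0n.
  rewrite /harmonic/= ger0_norm ?invr_ge0//.
  rewrite -(ler_pM2l n0) mulfV ?gt_eqF// mulrCA -{1}(ger0_norm (ltW n0)) -normrM bcS1.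
  rewrite normrM normrN (gtr0_norm s0) ler_pdivlMl ?mulr_gt0 ?normr_gt0// mulr1.
  by rewrite ler_pM2l//; apply: lb; rewrite leq_addr.
rewrite /summ (_ : (fun n => `|harmonic n|) = harmonic)//.
by apply/funext => n; rewrite ger0_norm// invr_ge0.
Unshelve. all: by end_near. Qed.

(** For [s <= 1] the coefficients of positive index alternate in sign, starting with a nonnegative
    one; each odd term together with the next even one is nonnegative, so the partial sums never
    fall below the initial 1. *)
Lemma sum_gbinom_ge1 s n : 0 < s -> s <= 1 -> 1 <= \sum_(0 <= j < n.+1) gbinom s j.
Proof.
move=> s0 s1.
have H k : 1 <= \sum_(0 <= j < k.*2.+1) gbinom s j /\ 0 <= gbinom s k.*2.+1.
  elim: k => [|k [IH1 IH2]].
    by rewrite big_nat1 gbinom0 gbinomS gbinom0 subr0 mul1r divr1 (ltW s0).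
  have k0 : 0 <= k.*2%:R :> R by rewrite ler0n.
  split.
    rewrite doubleS big_nat_recr//= big_nat_recr//= -addrA.
    apply: le_trans IH1 _; rewrite lerDl.
    suff -> : gbinom s k.*2.+1 + gbinom s k.*2.+2 =
        gbinom s k.*2.+1 * ((s + 1) / k.*2.+2%:R).
      by rewrite mulr_ge0// divr_ge0//; lra.
    rewrite (gbinomS _ k.*2.+1) -(natr1 k.*2); field.
    by rewrite -natrD pnatr_eq0.
  rewrite doubleS gbinomS gbinomS mulr_ge0 ?invr_ge0//.
  rewrite mulrAC mulr_ge0 ?invr_ge0// -mulrA mulr_ge0//.
  by rewrite -mulrNN mulr_ge0//; rewrite -natr1 -?natr1; lra.
have [m [->|->]] : exists m, n = m.*2 \/ n = m.*2.+1.
  exists n./2; rewrite -{1 3}(odd_double_half n); case: (odd n); [right|left] => //.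
  exact: (H m).1.
rewrite big_nat_recr//=; apply: le_trans (H m).1 _; rewrite lerDl; exact: (H m).2.
Qed.

Lemma gbinom_summ s : 0 < s -> summ (gbinom s).
Proof.
move=> s0; apply: (summ_leM (M := 1)) (bc_summ s0) => n.
by rewrite mul1r /bc normrMsign.
Qed.

(* The value is 1, but only its positivity matters below. *)
Definition fdc s := ser (gbinom s) / 2 `^ s.

Lemma ser_gbinomS s : 0 < s -> ser (gbinom (s + 1)) = 2 * ser (gbinom s).
Proof.
move=> s0; have s1 : 0 < s + 1 by lra.
rewrite serS; last exact: gbinom_summ.
rewrite (@eq_ser _ _ (fun n => gbinom s n.+1 + gbinom s n)); last first.
  by move=> n; rewrite gbinom_pascal addrK.
have sg := gbinom_summ s0; rewrite serD//; last exact: summS.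
by rewrite [in RHS]serS// !gbinom0 (serS sg) gbinom0; ring.
Qed.

Lemma fdcS s : 0 < s -> fdc (s + 1) = fdc s.
Proof.
move=> s0; rewrite /fdc ser_gbinomS// powRD ?powRr1//; last by rewrite (_ : 2 == 0 = false) ?implybT// pnatr_eq0.
by rewrite [2 `^ s * 2]mulrC -mulf_div mulfV ?mul1r.
Qed.

(** Since [fdc] has period 1 in [s], it suffices to consider [0 < s <= 1], where the partial sums
    are at least 1. *)
Lemma fdc_gt0 s : 0 < s -> 0 < fdc s.
Proof.
move=> s0.
have base t : 0 < t -> t <= 1 -> 0 < fdc t.
  move=> t0 t1; rewrite divr_gt0 ?powR_gt0//.
  have := summ_cvg (gbinom_summ t0) => ct.
  apply: (@lt_le_trans _ _ 1) => //; apply: (cvgr_to_ge ct); near=> n.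
  have n0 : (0 < n)%N by near: n; exact: nbhs_infty_gt.
  by rewrite -(prednK n0); exact: sum_gbinom_ge1.
have H n : forall t, 0 < t -> t <= n.+1%:R -> 0 < fdc t.
  elim: n => [|n IH] t t0 tn; first exact: base.
  have [t1|t1] := leP t 1; first exact: base.
  rewrite -(subrK 1 t) fdcS; last by lra.
  by apply: IH; [lra|rewrite lerBlDr natr1].
by apply: (H (Num.truncn s)) => //; exact/ltW/truncnS_gt.
Unshelve. all: by end_near. Qed.

End Binomial.

(** * The Fourier multiplier of a fractional difference *)

Section Multiplier.
Context {R : realType}.
Implicit Types (s w x y : R) (j n : nat).
Local Opaque bc.

Lemma mvt_between (f df : R -> R) x y : (forall z : R, is_derive z 1 f (df z)) ->
  exists2 c, `|c - x| <= `|y - x| & f y - f x = df c * (y - x).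
Proof.
move=> fd.
have fc (a b : R) : {within `[a, b], continuous f}.
  by apply: derivable_within_continuous => z _; exact: (@ex_derive _ _ _ _ _ _ _ (fd z)).
have [xy|yx] := leP x y.
  have [c + cE] := MVT_segment xy (fun z _ => fd z) (fc x y).
  rewrite in_itv/= => /andP[xc cy]; exists c => //.
  by rewrite !ger0_norm ?subr_ge0// lerD2r.
have [c + cE] := MVT_segment (ltW yx) (fun z _ => fd z) (fc y x).
rewrite in_itv/= => /andP[yc cx]; exists c; last by rewrite -opprB cE; ring.
rewrite (distrC c) (distrC y) !ger0_norm ?subr_ge0//; last exact: ltW.
by rewrite lerD2l lerN2.
Qed.

Lemma sin_lip x y : `|sin y - sin x| <= `|y - x|.
Proof.
have [c _ ->] := @mvt_between sin cos x y (@is_derive_sin R).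
by rewrite normrM ler_piMl// cos_max.
Qed.

Lemma cos_quad x y : `|cos y - cos x + (y - x) * sin x| <= (y - x) ^+ 2.
Proof.
have [c cx ->] := @mvt_between cos (fun z => - sin z) x y (@is_derive_cos R).
rewrite (_ : _ + _ = (sin x - sin c) * (y - x)); last by ring.
rewrite normrM -real_normK ?num_real// expr2 ler_wpM2r//.
by apply: le_trans (sin_lip _ _) _; rewrite distrC.
Qed.

(** A quadratic remainder passes through an absolutely convergent series: this is how series are
    differentiated term by term below. *)
Lemma is_derive_quad (F : R -> R) x a K :
  (forall y, `|F y - F x - a * (y - x)| <= K * (y - x) ^+ 2) ->
  is_derive x 1 F a.
Proof.
move=> FK; apply/is_derive1_caratheodory.
exists (fun z => if z == x then a else (F z - F x) / (z - x)); split; last by rewrite eqxx.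
  move=> z; case: eqP => [->|/eqP zx]; first by rewrite !subrr mulr0.
  by rewrite divfK// subr_eq0.
have Kz z : `|(if z == x then a else (F z - F x) / (z - x)) - a| <= K * `|z - x|.
  case: eqP => [->|/eqP zx]; first by rewrite !subrr !normr0 mulr0.
  have z0 : 0 < `|z - x| by rewrite normr_gt0 subr_eq0.
  rewrite -(ler_pM2r z0) -normrM mulrBl divfK ?subr_eq0//.
  by apply: le_trans (FK z) _; rewrite -mulrA -expr2 real_normK ?num_real.
apply/cvgrPdist_le => e e0; rewrite /= eqxx.
near=> z; rewrite distrC; apply: le_trans (Kz z) _.
have zK : `|x - z| <= e / (`|K| + 1).
  by near: z; apply: cvgr_dist_le => //; rewrite divr_gt0// ltr_wpDl.
rewrite distrC in zK; apply: le_trans (_ : (`|K| + 1) * `|z - x| <= _).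
  by rewrite ler_wpM2r//; apply: le_trans (ler_norm K) _; rewrite lerDl.
by rewrite mulrC -ler_pdivlMr// ltr_wpDl.
Unshelve. all: by end_near. Qed.

(** Real part of e^(iw) (e^(ix/2) - e^(-ix/2))^s: centring the shifts at [s / 2] makes the base
    equal to 2 i sin (x / 2). *)
Definition binom_cos s w x : R := ser (fun j => bc s j * cos (w + (s / 2 - j%:R) * x)).

Lemma summ_bccos s (h : nat -> R) : 0 < s -> summ (fun j => bc s j * cos (h j)).
Proof. by move=> s0; apply: (summM_bounded (M := 1)); [move=> n; exact: cos_max|exact: bc_summ]. Qed.

Lemma binom_cosS s w x : 0 < s -> binom_cos (s + 1) w x = 2 * sin (x / 2) * binom_cos s (w + pi / 2) x.
Proof.
move=> s0; rewrite /binom_cos serS; last by apply: summ_bccos; lra.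
rewrite (@eq_ser _ (fun n => bc (s + 1) n.+1 * _) (fun n =>
   bc s n.+1 * cos (w + ((s + 1) / 2 - n.+1%:R) * x) -
   bc s n * cos (w + ((s + 1) / 2 - n.+1%:R) * x))); last first.
  by move=> n; rewrite bc_pascal addrK mulrBl.
have sA : summ (fun n => bc s n * cos (w + ((s + 1) / 2 - n%:R) * x)).
  exact: (@summ_bccos s (fun n => w + ((s + 1) / 2 - n%:R) * x)).
rewrite serB; last 2 first.
- exact: (summS sA).
- exact: (@summ_bccos s (fun n => w + ((s + 1) / 2 - n.+1%:R) * x)).
rewrite addrA {1}bc0 -{1}(bc0 s) -(serS sA) -serB//; last first.
  exact: (@summ_bccos s (fun n => w + ((s + 1) / 2 - n.+1%:R) * x)).
rewrite -serZ; last by apply: (@summ_bccos s (fun j => w + pi / 2 + (s / 2 - j%:R) * x)).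
apply: eq_ser => n; rewrite -mulrBr mulrCA; congr (_ * _).
rewrite (_ : w + ((s + 1) / 2 - n%:R) * x = (w + (s / 2 - n%:R) * x) + x / 2); last by field.
rewrite (_ : w + ((s + 1) / 2 - n.+1%:R) * x = (w + (s / 2 - n%:R) * x) - x / 2); last by rewrite -natr1; field.
rewrite (addrAC w (pi / 2)) cosDpihalf; move: (w + _) (x / 2) => u v.
by rewrite cosD cosB; ring.
Qed.

Lemma bcSS s j : j.+2%:R * j.+1%:R * bc s j.+2 = s * (s - 1) * bc (s - 1 - 1) j.
Proof. by rewrite -mulrA mulrCA bcS1 mulrCA bcS1; ring. Qed.

(** Two factors of size [j] lower the order of the coefficients by 2 ([bcSS]), and order [s - 2] is
    still positive. *)
Lemma summ_bc2 s : 2 < s -> summ (fun j => bc s j * (s / 2 - j%:R) ^+ 2).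
Proof.
move=> s2.
have s1 : summ (fun j => bc s j * j%:R ^+ 2).
  apply: (@summ_shift _ _ 2).
  apply: (summ_leM (b := bc (s - 1 - 1)) (M := 2 * (s * (s - 1)))); last by apply: bc_summ; lra.
  move=> n; rewrite !add2n.
  have ss : 0 <= s * (s - 1) by rewrite mulr_ge0//; lra.
  have E : s * (s - 1) * `|bc (s - 1 - 1) n| = n.+2%:R * n.+1%:R * `|bc s n.+2|.
    by rewrite -{1}(ger0_norm ss) -normrM -bcSS normrM ger0_norm// mulr_ge0.
  rewrite -(mulrA 2) E normrM (ger0_norm (sqr_ge0 _)) -subr_ge0.
  rewrite (_ : _ - _ = `|bc s n.+2| * n.+2%:R * n%:R); first by rewrite !mulr_ge0.
  by rewrite -(natr1 n.+1) -(natr1 n); ring.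
apply: (@summ_le _ _ (fun n => 2 * (s / 2) ^+ 2 * `|bc s n| + 2 * `|bc s n * n%:R ^+ 2|)) => [n|].
  move: (bc s n) (s / 2) n%:R => c u v.
  rewrite normrM [in leRHS]normrM !(ger0_norm (sqr_ge0 _)).
  rewrite [leRHS](_ : _ = `|c| * (2 * u ^+ 2 + 2 * v ^+ 2)); last by ring.
  rewrite ler_wpM2l// -subr_ge0 (_ : _ - _ = (u + v) ^+ 2) ?sqr_ge0//; by ring.
apply: is_cvg_seriesD; apply: is_cvg_seriesZ; [apply: bc_summ; lra|exact: s1].
Qed.

Lemma summ_bc1 s : 2 < s -> summ (fun j => bc s j * (s / 2 - j%:R)).
Proof.
move=> s2; apply: (@summ_le _ _ (fun n => `|bc s n| + `|bc s n * (s / 2 - n%:R) ^+ 2|)) => [n|].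
  move: (bc s n) (s / 2 - n%:R) => c v.
  rewrite (normrM c v) (normrM c (v ^+ 2)) (ger0_norm (sqr_ge0 v)).
  rewrite -[X in X + _ * _]mulr1 -mulrDr ler_wpM2l// ler_norml.
  by apply/andP; split; nra.
apply: is_cvg_seriesD; [apply: bc_summ; lra|exact: summ_bc2].
Qed.

(** The cosines are expanded to second order, the remainders being controlled by [summ_bc2]. Through
    [bcS1] and Pascal's rule the termwise derivative becomes a series of order [s - 1], the same
    that occurs in [binom_cosS]. *)
Lemma is_derive_binom_cos s w x : 2 < s ->
  is_derive x 1 (binom_cos s w) (s * cos (x / 2) * binom_cos (s - 1) (w + pi / 2) x).
Proof.
move=> s2.
have sD : summ (fun j => bc s j * (s / 2 - j%:R) * cos (w + pi / 2 + (s / 2 - j%:R) * x)).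
  apply: (summM_bounded (M := 1)); [move=> n; exact: cos_max|exact: summ_bc1].
have -> : s * cos (x / 2) * binom_cos (s - 1) (w + pi / 2) x =
    ser (fun j => bc s j * (s / 2 - j%:R) * cos (w + pi / 2 + (s / 2 - j%:R) * x)).
  have s1 : 0 < s - 1 by lra.
  pose A n := bc (s - 1) n * cos (w + pi / 2 + (s / 2 - n%:R) * x).
  pose B n := bc (s - 1) n * cos (w + pi / 2 + (s / 2 - n.+1%:R) * x).
  have sA : summ A by exact: (@summ_bccos (s - 1) (fun n => w + pi / 2 + (s / 2 - n%:R) * x)).
  have sB : summ B by exact: (@summ_bccos (s - 1) (fun n => w + pi / 2 + (s / 2 - n.+1%:R) * x)).
  have E0 : bc s 0 * (s / 2 - 0%:R) * cos (w + pi / 2 + (s / 2 - 0%:R) * x) = s / 2 * A 0%N.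
    by rewrite /A !bc0 subr0; ring.
  have E1 n : bc s n.+1 * (s / 2 - n.+1%:R) * cos (w + pi / 2 + (s / 2 - n.+1%:R) * x) =
      s / 2 * (A n.+1 + B n).
    rewrite /A /B -mulrDl mulrA; congr (_ * _).
    by rewrite mulrBr [bc s n.+1 * n.+1%:R]mulrC bcS1 bc_pascal; field.
  rewrite (serS sD) E0 (eq_ser E1) serZ; last by apply: summD => //; exact: summS.
  rewrite serD//; last exact: summS.
  rewrite -mulrDr addrA -(serS sA).
  rewrite -serD// /binom_cos -[in LHS]serZ; last by apply: (@summ_bccos (s - 1) (fun j => w + pi / 2 + ((s - 1) / 2 - j%:R) * x)).
  rewrite -[in RHS]serZ; last exact: summD.
  apply: eq_ser => n; rewrite -mulrDr mulrCA [RHS]mulrCA; congr (_ * _).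
  rewrite (_ : _ + (s / 2 - n%:R) * x = (w + pi / 2 + ((s - 1) / 2 - n%:R) * x) + x / 2); last by field.
  rewrite (_ : _ + (s / 2 - n.+1%:R) * x = (w + pi / 2 + ((s - 1) / 2 - n%:R) * x) - x / 2); last by rewrite -natr1; field.
  by move: (w + _ + _) (x / 2) => u v; rewrite cosD cosB; field.
have s0 : 0 < s by lra.
apply: (@is_derive_quad _ _ _ (ser (fun j => `|bc s j * (s / 2 - j%:R) ^+ 2|))) => y.
have sy : summ (fun j => bc s j * cos (w + (s / 2 - j%:R) * y)) by exact: (@summ_bccos s (fun j => w + (s / 2 - j%:R) * y)).
have sx : summ (fun j => bc s j * cos (w + (s / 2 - j%:R) * x)) by exact: (@summ_bccos s (fun j => w + (s / 2 - j%:R) * x)).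
rewrite /binom_cos -serB// (mulrC _ (y - x)) -serZ// -serB; [|exact: summB|exact: summZ].
rewrite [leRHS]mulrC; apply: (@ser_normM _ _ (fun j => bc s j * (s / 2 - j%:R) ^+ 2)); last exact: summ_bc2.
move=> n; rewrite (addrAC w (pi / 2)) cosDpihalf.
set u := w + _ * y; set v := w + _ * x.
rewrite (_ : _ - _ = bc s n * (cos u - cos v + (u - v) * sin v)); last by rewrite /u /v; ring.
rewrite (normrM (bc s n)) (normrM (bc s n) (_ ^+ 2)) mulrCA ler_wpM2l//.
apply: le_trans (cos_quad v u) _.
rewrite (ger0_norm (sqr_ge0 _)) -exprMn le_eqVlt; apply/orP; left; apply/eqP.
by congr (_ ^+ 2); rewrite /u /v; ring.
Qed.

Lemma cosBnpi (w : R) n : cos (w - n%:R * pi) = (-1) ^+ n * cos w.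
Proof.
elim: n => [|n IH]; first by rewrite mul0r subr0 mul1r.
rewrite exprS -mulrA -IH -(subrK pi (w - n%:R * pi)) cosDpi mulN1r opprK.
by rewrite -natr1; congr cos; ring.
Qed.

Lemma binom_cos_pi s w : 0 < s -> binom_cos s w pi = fdc s * cos (w + s * pi / 2) * 2 `^ s.
Proof.
move=> s0; have p0 : 0 < 2 `^ s :> R by rewrite powR_gt0.
rewrite (_ : _ * _ * _ = cos (w + s * pi / 2) * ser (gbinom s)); last first.
  by rewrite /fdc mulrAC divfK ?gt_eqF// mulrC.
rewrite -serZ; last exact: gbinom_summ.
apply: eq_ser => n; rewrite (_ : w + _ = w + s * pi / 2 - n%:R * pi); last by field.
Transparent bc.
by rewrite cosBnpi /bc mulrACA -exprD addnn -mul2n exprM sqrrN expr1n expr1n mul1r mulrC.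
Qed.

(** For orders above 2 the quotient of [binom_cos] by the power of [2 * sin (x / 2)] has zero
    derivative on (0, 2 pi), so it equals its value at [pi], where the signs of the coefficients
    cancel and [fdc] appears. Two descents by 1 in the order reach every positive order. At [x = 0]
    the claim is [ser_bc]. *)
Lemma binom_cosE s w x : 0 < s -> 0 <= x < 2 * pi ->
  binom_cos s w x = fdc s * cos (w + s * pi / 2) * (2 * sin (x / 2)) `^ s.
Proof.
move=> s0 /andP[]; rewrite le_eqVlt => /predU1P[<- _|x0 x2].
  rewrite mul0r sin0 mulr0 powR0 ?gt_eqF// mulr0 /binom_cos.
  rewrite (@eq_ser _ _ (fun j => cos w * bc s j)); last by move=> j; rewrite mulr0 addr0 mulrC.
  by rewrite serZ ?ser_bc ?mulr0//; exact: bc_summ.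
have sin0 y : 0 < y < 2 * pi -> 0 < 2 * sin (y / 2).
  by move=> /andP[y0 y2]; rewrite mulr_gt0// sin_gt0_pi//; apply/andP; split; lra.
(* Up to a shift of the phase, both sides at order [t + 1] are those at order [t] times the positive
   number [2 * sin (x / 2)], which is cancelled. *)
have step (t v : R) : 0 < t -> (forall v, binom_cos (t + 1) v x = fdc (t + 1) *
    cos (v + (t + 1) * pi / 2) * (2 * sin (x / 2)) `^ (t + 1)) ->
    binom_cos t v x = fdc t * cos (v + t * pi / 2) * (2 * sin (x / 2)) `^ t.
  move=> t0 /(_ (v - pi / 2)); rewrite binom_cosS// subrK fdcS//.
  have xs : 0 < 2 * sin (x / 2) by rewrite sin0// x0.
  rewrite -(mulr_powRB1 (p := t + 1)) ?ltW//; last by lra.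
  rewrite addrK mulrCA => /(mulfI _) ->; last by rewrite gt_eqF.
  by congr (_ * cos _ * _); field.
have big (t v : R) : 2 < t -> binom_cos t v x = fdc t * cos (v + t * pi / 2) * (2 * sin (x / 2)) `^ t.
  move=> t2; have t0 : 0 < t by lra.
  pose H y := binom_cos t v y * (2 * sin (y / 2)) `^ (- t).
  have dH (y : R) : 0 < y < 2 * pi -> is_derive y 1 H 0.
    move=> y02; have sy := sin0 _ y02.
    have d1 : is_derive y 1 (fun z : R => 2 * sin (z / 2)) (cos (y / 2)).
      apply: (@is_derive_quad _ _ _ 1) => z.
      have := cos_quad (y / 2 - pi / 2) (z / 2 - pi / 2).
      rewrite sinBpihalf !cosBpihalf => h.
      rewrite (_ : _ - _ = 2 * (sin (z / 2) - sin (y / 2) +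
        (z / 2 - pi / 2 - (y / 2 - pi / 2)) * - cos (y / 2))); last by field.
      rewrite normrM ger0_norm//; have := sqr_ge0 (z - y); move: h.
      by rewrite (_ : (_ - (y / 2 - pi / 2)) ^+ 2 = (z - y) ^+ 2 / 4); [lra|field].
    have d2 := @is_derive1_comp R (fun z => z `^ (- t)) (fun z => 2 * sin (z / 2)) _ _ _ (is_derive1_powR (- t) sy) d1.
    have d3 := is_deriveM (is_derive_binom_cos v y t2) d2.
    apply: is_derive_eq d3 _; rewrite /= /GRing.scale/=.
    rewrite -{1}(subrK 1 t) binom_cosS; last by lra.
    have -> : (2 * sin (y / 2)) `^ (- t) = 2 * sin (y / 2) * (2 * sin (y / 2)) `^ (- t - 1).
      rewrite -{2}(powRr1 (ltW sy)) -powRD; first by congr powR; ring.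
      by apply/implyP => _; rewrite gt_eqF.
    by ring.
  have pi0 := pi_gt0 R.
  have const (a b : R) : 0 < a -> a <= b -> b < 2 * pi -> H a = H b.
    move=> a0 ab b2.
    have inn z : z \in `[a, b] -> 0 < z < 2 * pi.
      rewrite in_itv/= => /andP[az zb]; rewrite (lt_le_trans a0 az)/=.
      exact: le_lt_trans b2.
    have [||c _] := @MVT_segment _ H (fun=> 0) a b ab.
    - by move=> z zab; apply/dH/inn/subset_itv_oo_cc.
    - by apply: derivable_within_continuous => z /inn/dH dz; exact: (@ex_derive _ _ _ _ _ _ _ dz).
    by rewrite mul0r => /eqP; rewrite subr_eq0 => /eqP ->.
  have HE : H x = H pi.
    have [xp|px] := leP x pi; first by apply: const => //; lra.
    by rewrite (const pi x)// ltW.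
  have xs : 0 < 2 * sin (x / 2) by rewrite sin0// x0.
  move: HE; rewrite /H binom_cos_pi// sin_pihalf mulr1 !powRN mulfK ?gt_eqF ?powR_gt0// => <-.
  by rewrite divfK// gt_eqF// powR_gt0.
by apply: (step) => // v; apply: (step) => [|u]; [lra|apply: big; lra].
Qed.

End Multiplier.

(** * Uniqueness of Fourier coefficients *)

Section PowerThreshold.
Context {R : realType}.
Implicit Types w x : R.

Lemma bernoulli_ge x k : 0 <= x -> 1 + k%:R * x <= (1 + x) ^+ k.
Proof.
move=> x0; elim: k => [|k IH]; first by rewrite mul0r addr0.
rewrite exprS; apply: le_trans (_ : (1 + x) * (1 + k%:R * x) <= _).
  rewrite -natr1; have h : 0 <= k%:R * x * x by rewrite !mulr_ge0//.
  nra.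
by rewrite ler_wpM2l//; lra.
Qed.

Lemma bernoulli_le x k : 0 <= x <= 1 -> 1 - k%:R * x <= (1 - x) ^+ k.
Proof.
move=> /andP[x0 x1]; elim: k => [|k IH]; first by rewrite mul0r subr0.
rewrite exprS; apply: le_trans (_ : (1 - x) * (1 - k%:R * x) <= _).
  rewrite -natr1; have h : 0 <= k%:R * x * x by rewrite !mulr_ge0//.
  nra.
by rewrite ler_wpM2l//; lra.
Qed.

(** The polynomials of Brosowski and Deutsch from the proof of the Stone-Weierstrass theorem: on
    [0, 1] they converge to 0 below 1/2 and to 1 above it. *)
Definition thr w m : R := 1 - (1 - w ^+ m) ^+ (2 ^ m).

Lemma thr_bounds w m : 0 <= w <= 1 -> 0 <= thr w m <= 1.
Proof.
move=> /andP[w0 w1].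
have wm : 0 <= w ^+ m <= 1 by rewrite exprn_ge0//= exprn_ile1.
have : 0 <= (1 - w ^+ m) ^+ (2 ^ m) <= 1.
  by rewrite exprn_ge0/= ?exprn_ile1//; lra.
by rewrite /thr; lra.
Qed.

Lemma thr_cvg0 w : 0 <= w -> w < 1 / 2 -> thr w @ \oo --> 0.
Proof.
move=> w0 w1.
apply: (@squeeze_cvgr _ _ _ _ (cst 0) (fun m => (2 * w) ^+ m)); last 2 first.
- exact: cvg_cst.
- by apply: cvg_expr; rewrite ger0_norm; lra.
apply: nearW => m; have wm : 0 <= w ^+ m <= 1 by rewrite exprn_ge0//= exprn_ile1//; lra.
have /andP[-> _] : 0 <= thr w m <= 1 by apply: thr_bounds; lra.
rewrite exprMn /=; have := bernoulli_le (2 ^ m) wm.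
by rewrite /thr natrX; lra.
Qed.

(** Since (1 - w^m)(1 + w^m) <= 1, the power of 1 - w^m is at most the inverse of that of 1 + w^m,
    which Bernoulli's inequality bounds below by (2w)^m. *)
Lemma thr_cvg1 w : w <= 1 -> 1 / 2 < w -> thr w @ \oo --> (1 : R).
Proof.
move=> w1 w0.
apply: (@squeeze_cvgr _ _ _ _ (fun m => 1 - ((2 * w)^-1) ^+ m) (cst 1)); last 2 first.
- rewrite -[X in _ --> X]subr0; apply: cvgB; first exact: cvg_cst.
  apply: cvg_expr; rewrite ger0_norm ?invr_ge0; last by lra.
  by rewrite invf_lt1; lra.
- exact: cvg_cst.
apply: nearW => m; have wm : 0 <= w ^+ m <= 1 by rewrite exprn_ge0//= ?exprn_ile1//; lra.
have /andP[_ ->] : 0 <= thr w m <= 1 by apply: thr_bounds; lra.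
rewrite andbT lerD2l lerN2 exprVn exprMn.
have wp : 0 < 2 ^+ m * w ^+ m by rewrite mulr_gt0 ?exprn_gt0//; lra.
rewrite -[X in _ <= X]mul1r ler_pdivlMr//.
have /andP[wm0 wm1] := wm; have := bernoulli_ge (2 ^ m) wm0; rewrite natrX => h.
have z0 : 0 <= (1 - w ^+ m) ^+ (2 ^ m) by rewrite exprn_ge0//; lra.
apply: le_trans (_ : (1 - w ^+ m) ^+ (2 ^ m) * (1 + w ^+ m) ^+ (2 ^ m) <= _).
  by rewrite ler_wpM2l//; lra.
by rewrite -exprMn exprn_ile1//; nra.
Qed.

End PowerThreshold.

Section Uniqueness.
Context {R : realType}.
Local Notation mu := (@lebesgue_measure R).
Local Notation torus := (@torus R).
Variable G : R -> R.
Hypothesis pG : perL1 G.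
Hypothesis G0 : forall n t, tint (fun y => G y * cos (n%:R * y + t)) = 0.

(** Bounded multipliers [phi] for which [G * phi] still has no Fourier coefficient. They form a
    vector space closed under multiplication by translated cosines, hence contain every polynomial
    in such a cosine. *)
Let ann (phi : R -> R) := [/\ measurable_fun setT phi,
  forall x, phi (x + 2 * pi) = phi x, exists M : R, forall x, `|phi x| <= M
  & forall n t, tint (fun y => G y * phi y * cos (n%:R * y + t)) = 0].

Let ann_perL1 phi : ann phi -> perL1 (fun y => G y * phi y).
Proof. by move=> [m p [M b] _]; exact: (perL1Mb pG m p b). Qed.

Let ann1 : ann (cst 1).
Proof.
split => //; first by exists 1 => x; rewrite normr1.
by move=> n t; under eq_tint do rewrite mulr1; exact: G0.
Qed.

Let annD phi psi : ann phi -> ann psi -> ann (fun x => phi x + psi x).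
Proof.
move=> aphi apsi; have p1 := ann_perL1 aphi; have p2 := ann_perL1 apsi.
case: aphi => m p [M b] z; case: apsi => m' p' [M' b'] z'; split.
- exact: measurable_funD.
- by move=> x; rewrite p p'.
- by exists (M + M') => x; apply: le_trans (ler_normD _ _) _; rewrite lerD.
- move=> n t; under eq_tint do rewrite mulrDr mulrDl.
  by rewrite tintD ?z ?z' ?addr0//; exact: perL1Mcos.
Qed.

Let annZ k phi : ann phi -> ann (fun x => k * phi x).
Proof.
move=> aphi; have p1 := ann_perL1 aphi.
case: aphi => m p [M b] z; split.
- exact: measurable_funM.
- by move=> x; rewrite p.
- by exists (`|k| * M) => x; rewrite normrM ler_wpM2l.
- move=> n t; under eq_tint do rewrite mulrCA -mulrA.
  by rewrite tintZ ?z ?mulr0//; exact: perL1Mcos.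
Qed.

Let annMcos x0 phi : ann phi -> ann (fun x => phi x * cos (x - x0)).
Proof.
move=> aphi; have p1 := ann_perL1 aphi.
case: aphi => m p [M b] z; split.
- apply: measurable_funM => //.
  by have := measurable_cosl 1 (- x0); under eq_fun do rewrite mul1r.
- by move=> x; rewrite p; have := cosl_periodic 1 (- x0) x; rewrite !mul1r => ->.
- exists M => x; rewrite normrM; apply: le_trans (b x).
  by rewrite ler_piMr// cos_max.
- move=> n t.
  have E y : G y * (phi y * cos (y - x0)) * cos (n%:R * y + t) =
     2^-1 * (G y * phi y * cos (n.+1%:R * y + (t - x0))) +
     2^-1 * (G y * phi y * (if n is k.+1 then cos (k%:R * y + (t + x0)) else
        cos (1%:R * y + (- x0 - t)))).
    have -> : (if n is k.+1 then cos (k%:R * y + (t + x0)) else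
        cos (1%:R * y + (- x0 - t))) = cos ((n%:R * y + t) - (y - x0)).
      case: n => [|k]; last by rewrite -natr1; congr cos; ring.
      by rewrite -cosN; congr cos; ring.
    rewrite (_ : n.+1%:R * y + _ = (n%:R * y + t) + (y - x0)); last by rewrite -natr1; ring.
    by move: (_ * y + t) (y - x0) => u v; rewrite cosD cosB; field.
  under eq_tint do rewrite E.
  have pc : perL1 (fun y => G y * phi y * (if n is k.+1 then cos (k%:R * y + (t + x0)) else
        cos (1%:R * y + (- x0 - t)))) by case: n {E} => [|k]; exact: perL1Mcos.
  rewrite tintD; [|by apply: perL1Z; exact: perL1Mcos|exact: perL1Z].
  rewrite !tintZ//; last exact: perL1Mcos.
  by rewrite z mulr0 add0r; case: n {E pc} => [|k]; rewrite z mulr0.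
Qed.

Let ann_eq phi psi : phi =1 psi -> ann phi -> ann psi.
Proof. by move=> /funext ->. Qed.

Section arc.
Variables (x0 c : R).
Let w y : R := 1 / 2 + (cos (y - x0) - c) / 4.

Let annMw phi : ann phi -> ann (fun x => phi x * w x).
Proof.
move=> a; apply: (ann_eq (phi := fun x => (1 / 2 - c / 4) * phi x + 4^-1 * (phi x * cos (x - x0)))).
  by move=> x; rewrite /w; field.
by apply: annD; apply: annZ => //; exact: annMcos.
Qed.

Let annMwX m phi : ann phi -> ann (fun x => phi x * w x ^+ m).
Proof.
move=> a; elim: m => [|m IH]; first by apply: ann_eq a => x; rewrite mulr1.
by apply: ann_eq (annMw IH) => x; rewrite exprSr mulrA.
Qed.

Let ann_thr m : ann (fun x => thr (w x) m).
Proof.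
have H k : ann (fun x => (1 - w x ^+ m) ^+ k).
  elim: k => [|k IH]; first exact: ann1.
  apply: (ann_eq (phi := fun x => (1 - w x ^+ m) ^+ k + (-1) * ((1 - w x ^+ m) ^+ k * w x ^+ m))).
    by move=> x; rewrite exprS; ring.
  by apply: annD => //; apply: annZ; exact: annMwX.
apply: (ann_eq (phi := fun x => cst 1 x + (-1) * (1 - w x ^+ m) ^+ (2 ^ m))).
  by move=> x; rewrite /thr /=; ring.
by apply: annD; [exact: ann1|exact: annZ].
Qed.

Lemma tint_thr m : tint (fun x => G x * thr (w x) m) = 0.
Proof.
case: (ann_thr m) => _ _ _ /(_ 0 0) <-; apply: eq_tint => x.
by rewrite mul0r addr0 cos0 mulr1.
Qed.

Lemma perL1_thr m : perL1 (fun x => G x * thr (w x) m).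
Proof. by apply: ann_perL1; exact: ann_thr. Qed.

Lemma measurable_thr m : measurable_fun setT (fun x => thr (w x) m).
Proof. by case: (ann_thr m). Qed.

End arc.


Let ae_neq2 (a b : R) : {ae mu, forall x, x != a /\ x != b}.
Proof.
exists [set a; b]; split.
- by apply: measurableU; exact: measurable_set1.
- by apply: countable_lebesgue_measure0; exact/finite_set_countable/finite_set2.
- move=> x /= h; apply: contrapT => h2; apply: h.
  by split; apply/eqP => xE; apply: h2; [left|right].
Qed.

(** With [w] affine in [cos (y - x0)], the polynomials [thr (w y) m] tend to the indicator of the
    arc off its endpoints. Their integrals against [G] vanish and their values lie in [0, 1], so
    dominated convergence applies. *)
Lemma tint_arc (a b : R) : 0 < a -> a < b -> b < 2 * pi ->
  \int[mu]_(x in `]a, b[) G x = 0.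
Proof.
move=> a0 ab b2; have [mG _ iG] := pG.
pose x0 := (a + b) / 2; pose d := (b - a) / 2.
(* On the torus [w] exceeds 1/2 exactly inside the arc; the factor 1/4 keeps it in [0, 1]. *)
pose w y : R := 1 / 2 + (cos (y - x0) - cos d) / 4.
have w01 y : 0 <= w y <= 1.
  have := cos_le1 (y - x0); have := cos_geN1 (y - x0).
  by have := cos_le1 d; have := cos_geN1 d; rewrite /w; lra.
have pi0 := pi_gt0 R.
have d0 : 0 < d < pi by rewrite /d; lra.
have wE (y : R) : torus y -> y != a -> y != b ->
    (fun n => G y * thr (w y) n) @ \oo --> (G \_ `]a, b[) y.
  rewrite /Defs.torus /= in_itv/= => /andP[y0 y2] ya yb.
  have cosz : cos (y - x0) = cos `|y - x0| by rewrite cos_norm.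
  have /andP[wy0 wy1] := w01 y.
  have dpi : d \in `[0, pi] by rewrite in_itv/=; lra.
  have [yE|yE] := pselect (`]a, b[%classic y).
    rewrite patchE mem_set// -[X in _ --> X]mulr1; apply: cvgMr; apply: thr_cvg1 => //.
    move: yE; rewrite /= in_itv/= => /andP[y1 y3].
    have zd : `|y - x0| < d by rewrite ltr_norml /x0 /d; lra.
    have : cos d < cos (y - x0).
      by rewrite cosz ltr_cos// in_itv/= normr_ge0/=; lra.
    by rewrite /w; lra.
  rewrite patchE memNset// -[X in _ --> X](mulr0 (G y)); apply: cvgMr; apply: thr_cvg0 => //.
  have zd : d < `|y - x0| < 2 * pi - d.
    rewrite ltr_norml; move: yE; rewrite /= in_itv/= => /negP; rewrite negb_and -!leNgt.
    case/orP => h.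
      have h2 : y < a by rewrite lt_neqAle ya.
      by rewrite distrC ltr_normr; apply/andP; split; [apply/orP; left|]; rewrite /x0 /d; lra.
    have h2 : b < y by rewrite lt_neqAle eq_sym yb.
    by rewrite ltr_normr; apply/andP; split; [apply/orP; left|]; rewrite /x0 /d; lra.
  have : cos (y - x0) < cos d.
    rewrite cosz; move: zd; move: `|y - x0| => z /andP[z1 z2].
    have [zp|zp] := leP z pi; first by rewrite ltr_cos// in_itv/=; lra.
    have -> : cos z = cos (2 * pi - z).
      by rewrite -cosN -(cosD2pi (- z)); congr cos; ring.
    by rewrite ltr_cos// ?in_itv/=; lra.
  by rewrite /w; lra.
have Eset : torus `&` `]a, b[ = `]a, b[%classic.
  apply/seteqP; split => [x []//|x /=].
  by rewrite /Defs.torus /= !in_itv/= => h; split => //; move: h => /andP[h1 h2]; lra.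
rewrite -Eset Rintegral_mkcondr /Rintegral.
have mE : measurable (`]a, b[ : set R) by exact: measurable_itv.
have tG n : (\int[mu]_(x in torus) (G x * thr (w x) n)%:E = 0)%E.
  have := @tint_thr x0 (cos d) n; rewrite /tint /Rintegral => h.
  have fn : (\int[mu]_(x in torus) (G x * thr (w x) n)%:E)%E \is a fin_num.
    apply: integrable_fin_num; first exact: measurable_torus.
    apply: (@perL1_integrable _ (fun x => G x * thr (w x) n)).
    exact: perL1_thr.
  by rewrite -(fineK fn) h.
have aeF : Filter (nbhs (almost_everywhere mu)) by exact: ae_filter_ringOfSetsType.
have H := @dominated_convergence _ _ R mu torus (@measurable_torus R)
  (fun n x => (G x * thr (w x) n)%:E) (fun x => ((G \_ `]a, b[) x)%:E) (fun x => `|G x|%:E).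
have {}H : (fun=> 0%E) @ \oo --> (\int[mu]_(x in torus) ((G \_ `]a, b[) x)%:E)%E.
  suff [_ _] : [/\ mu.-integrable torus (fun x => ((G \_ `]a, b[) x)%:E),
      (fun n => \int[mu]_(x in torus) `|(G x * thr (w x) n)%:E - ((G \_ `]a, b[) x)%:E|)%E @ \oo --> 0%E &
      (fun n => \int[mu]_(x in torus) (G x * thr (w x) n)%:E)%E @ \oo -->
      (\int[mu]_(x in torus) ((G \_ `]a, b[) x)%:E)%E].
    by under eq_fun do rewrite tG.
  apply: H.
  - move=> n; apply/measurable_EFinP/measurable_funTS/measurable_funM => //.
    exact: measurable_thr.
  - apply/measurable_EFinP/measurable_funTS.
    by apply/(measurable_restrictT _ mE)/measurable_funTS.
  - apply: filterS (ae_neq2 a b) => x [xa xb] xT; apply: cvg_EFin; first exact: nearW.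
    exact: wE.
  - by have /perL1_integrable := perL1_norm pG.
  - apply: filterS (ae_neq2 a b) => x _ n _.
    rewrite lee_fin normrM ler_piMr//; have /andP[h1 h2] := thr_bounds n (w01 x).
    by rewrite ger0_norm.
by rewrite -(cvg_lim (@ereal_hausdorff R) H)// lim_cst.
Qed.

(** At almost every [x] the primitive of [G] has derivative [G x], by Lebesgue's theorem, while
    [tint_arc] makes it vanish near [x]. Its base point is [x / 2] because arcs must stay away from
    0. *)
Lemma fourier_unique : {ae mu, forall x, torus x -> G x = 0}.
Proof.
have [mG _ iG] := pG.
have mT := @measurable_torus R.
have LG := lebesgue_differentiation (integrable_locally mT iG).
have aeF : Filter (nbhs (almost_everywhere mu)) by exact: ae_filter_ringOfSetsType.
apply: (filterS2 _ _ (ae_neq2 0 (2 * pi)) LG) => x [x0 x2] Lx xT.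
have {x0 x2}xin : 0 < x < 2 * pi.
  by move: xT; rewrite /Defs.torus/= in_itv/= !lt_neqAle (eq_sym 0) x0 x2 => /andP[-> ->].
have /andP[xa xb] := xin.
pose u := (x + 2 * pi) / 2; have xu : x < u by rewrite /u; lra.
have sub (y : R) : y < 2 * pi -> `[x / 2, y] `<=` torus.
  by move=> y2 z /=; rewrite /Defs.torus/= !in_itv/=; lra.
have iu : mu.-integrable [set` Interval (BLeft (x / 2)) (BRight u)] (EFin \o (G \_ torus)).
  have su : `[x / 2, u] `<=` torus by apply: sub; rewrite /u; lra.
  have i1 := @integrableS _ _ _ mu torus `[x / 2, u] (EFin \o G)
    (measurable_itv _) (measurable_itv _) su iG.
  apply: (eq_integrable _ _ _ _ i1); first exact: measurable_itv.
  by move=> z /set_mem/su zT; rewrite /= patchE mem_set.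
have xx : ((BLeft (x / 2)%R : itv_bound R) < (BRight x : itv_bound R))%E by rewrite /= lte_fin; lra.
have [dF] := FTC1_lebesgue_pt xu iu xx Lx.
rewrite patchE mem_set// => <-.
rewrite derive1E -(@derive_cst R R R 0 x 1).
apply: near_eq_derive.
near=> y.
have y1 : x / 2 < y by near: y; apply: lt_nbhsr; lra.
have y2 : y < 2 * pi by near: y; apply: lt_nbhsl; lra.
transitivity (\int[mu]_(z in `[x / 2, y]) G z).
  apply: eq_Rintegral.
  by move=> z /set_mem/(sub _ y2) zT; rewrite patchE mem_set.
rewrite /Rintegral integral_itv_bndoo; last exact/measurable_EFinP/measurable_funTS.
by have := @tint_arc (x / 2) y; apply => //; lra.
Unshelve. all: by end_near. Qed.

End Uniqueness.

(** * Trigonometric kernels *)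

Section Abel.
Context {R : realType}.
Implicit Types (A B e : nat -> R) (a b n : nat) (z t : R).

(** The sign [sg] covers increasing and decreasing sequences at once. Once the last value times the
    full sum is subtracted, only increments of [r] are left, and their absolute values telescope. *)
Lemma abel_aux (r e : nat -> R) (sg E : R) a m :
  (forall n, (a <= n)%N -> (n < a + m)%N -> sg * r n <= sg * r n.+1) ->
  (forall j, (j <= a + m.+1)%N -> `|\sum_(a <= n < j) e n| <= E) -> `|sg| = 1 ->
  `|\sum_(a <= n < a + m.+1) r n * e n -
    r (a + m)%N * \sum_(a <= n < a + m.+1) e n| <= (sg * r (a + m)%N - sg * r a) * E.
Proof.
move=> + + sg1; elim: m => [|m IH] rm eE.
  by rewrite addn1 addn0 !big_nat1 !subrr normr0 mul0r.
have R2 (f : nat -> R) : \sum_(a <= n < a + m.+2) f n =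
    \sum_(a <= n < a + m.+1) f n + f (a + m.+1)%N.
  by rewrite addnS big_nat_recr ?leq_addr.
rewrite !R2.
set S := \sum_(a <= n < a + m.+1) e n; set T := \sum_(a <= n < a + m.+1) r n * e n.
rewrite (_ : _ - _ = (T - r (a + m)%N * S) + (r (a + m)%N - r (a + m.+1)%N) * S); last by ring.
have S_E : `|S| <= E by apply: eE; lia.
have h1 : sg * r (a + m)%N <= sg * r (a + m.+1)%N by rewrite addnS; apply: rm; lia.
have h2 : `|r (a + m)%N - r (a + m.+1)%N| = sg * r (a + m.+1)%N - sg * r (a + m)%N.
  by rewrite -[LHS]mul1r -[in LHS]sg1 -normrM mulrBr distrC ger0_norm//; lra.
apply: le_trans (ler_normD _ _) _; rewrite normrM h2.
have h3 : `|T - r (a + m)%N * S| <= (sg * r (a + m)%N - sg * r a) * E.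
  by apply: IH => [n an nm|j jm]; [apply: rm|apply: eE]; lia.
have : (sg * r (a + m.+1)%N - sg * r (a + m)%N) * `|S| <=
       (sg * r (a + m.+1)%N - sg * r (a + m)%N) * E by rewrite ler_wpM2l//; lra.
lra.
Qed.

Lemma abel_dec A e (E : R) a b : (a < b)%N ->
  (forall n, (a <= n)%N -> (n.+1 < b)%N -> A n.+1 <= A n) ->
  0 <= A b.-1 ->
  (forall j, (j <= b)%N -> `|\sum_(a <= n < j) e n| <= E) ->
  `|\sum_(a <= n < b) A n * e n| <= A a * E.
Proof.
move=> ab Ad A0 eE; have bE : b = (a + (b - a).-1.+1)%N by lia.
set m := (b - a).-1 in bE; rewrite bE.
have Am : 0 <= A (a + m)%N by rewrite (_ : (a + m)%N = b.-1)//; lia.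
have h j : (j <= a + m.+1)%N -> `|\sum_(a <= n < j) e n| <= E by rewrite -bE; exact: eE.
have H : `|\sum_(a <= n < a + m.+1) A n * e n -
    A (a + m)%N * \sum_(a <= n < a + m.+1) e n| <= (-1 * A (a + m)%N - -1 * A a) * E.
  apply: abel_aux => //; last by rewrite normrN1.
  by move=> n an nm; rewrite !mulN1r lerN2; apply: Ad => //; lia.
move: H; set T := \sum_(_ <= n < _) A n * _; set S := \sum_(_ <= n < _) _ => H.
have SE : `|S| <= E by apply: h.
rewrite -(subrK (A (a + m)%N * S) T); apply: le_trans (ler_normD _ _) _.
rewrite normrM (ger0_norm Am).
have : A (a + m)%N * `|S| <= A (a + m)%N * E by rewrite ler_wpM2l.
lra.
Qed.

Lemma abel_inc B e (E : R) a b Bm : (a < b)%N ->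
  (forall n, (a <= n)%N -> (n.+1 < b)%N -> B n <= B n.+1) ->
  0 <= B a -> B b.-1 <= Bm ->
  (forall j, (j <= b)%N -> `|\sum_(a <= n < j) e n| <= E) ->
  `|\sum_(a <= n < b) B n * e n| <= 2 * Bm * E.
Proof.
move=> ab Bi B0 BM eE; have bE : b = (a + (b - a).-1.+1)%N by lia.
set m := (b - a).-1 in bE; rewrite bE.
have Bam : B (a + m)%N <= Bm by rewrite (_ : (a + m)%N = b.-1)//; lia.
have h j : (j <= a + m.+1)%N -> `|\sum_(a <= n < j) e n| <= E by rewrite -bE; exact: eE.
have Ba : B a <= B (a + m)%N.
  have : (a + m < b)%N by lia.
  elim: m {bE Bam h} => [|m IH] mb; first by rewrite addn0.
  apply: le_trans (IH _) _; first by lia.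
  by rewrite addnS; apply: Bi; lia.
have H : `|\sum_(a <= n < a + m.+1) B n * e n -
    B (a + m)%N * \sum_(a <= n < a + m.+1) e n| <= (1 * B (a + m)%N - 1 * B a) * E.
  apply: abel_aux => //; last by rewrite normr1.
  by move=> n an nm; rewrite !mul1r; apply: Bi; lia.
move: H; set T := \sum_(_ <= n < _) B n * _; set S := \sum_(_ <= n < _) _ => H.
have SE : `|S| <= E by apply: h.
have E0 : 0 <= E by apply: le_trans SE.
rewrite -(subrK (B (a + m)%N * S) T); apply: le_trans (ler_normD _ _) _.
rewrite normrM (ger0_norm (le_trans B0 Ba)).
have : B (a + m)%N * `|S| <= Bm * E by rewrite ler_pM//; lra.
have : (1 * B (a + m)%N - 1 * B a) * E <= Bm * E by rewrite ler_wpM2r//; lra.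
lra.
Qed.

(** The product of the two sequences need not be monotone: summation by parts is applied to [B]
    first, which bounds the partial sums of [B n * e n], and then to [A]. *)
Lemma abel_mix A B e (E Bm : R) a b : (a < b)%N ->
  (forall n, (a <= n)%N -> (n.+1 < b)%N -> A n.+1 <= A n) ->
  0 <= A b.-1 ->
  (forall n, (a <= n)%N -> (n.+1 < b)%N -> B n <= B n.+1) ->
  0 <= B a -> (forall n, (a <= n < b)%N -> B n <= Bm) ->
  (forall j, (j <= b)%N -> `|\sum_(a <= n < j) e n| <= E) ->
  `|\sum_(a <= n < b) A n * B n * e n| <= A a * (2 * Bm * E).
Proof.
move=> ab Ad A0 Bi B0 BM eE.
under eq_bigr do rewrite -mulrA.
have E0 : 0 <= E by apply: le_trans (eE 0%N _) => //.
have Bm0 : 0 <= Bm by apply: le_trans B0 _; apply: BM; rewrite leqnn.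
apply: (@abel_dec A (fun n => B n * e n)) => // j jb.
have [ja|aj] := leqP j a; first by rewrite big_geq// normr0 !mulr_ge0.
apply: abel_inc => //.
- by move=> n an nj; apply: Bi => //; lia.
- by apply: BM; lia.
- by move=> i ij; apply: eE; lia.
Qed.

Lemma cos_sum a b z t : (a <= b)%N ->
  2 * sin (z / 2) * (\sum_(a <= n < b) cos (n%:R * z + t)) =
  sin (b%:R * z - z / 2 + t) - sin (a%:R * z - z / 2 + t).
Proof.
move=> ab; rewrite -(subnKC ab); elim: (b - a)%N => [|m IH].
  by rewrite addn0 big_geq// mulr0 subrr.
rewrite addnS big_nat_recr ?leq_addr//= mulrDr IH -(natr1 (a + m)).
rewrite (_ : _ * z - z / 2 + t = ((a + m)%:R * z + t) - z / 2); last by ring.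
rewrite (_ : ((a + m)%:R + 1) * z - z / 2 + t = ((a + m)%:R * z + t) + z / 2); last by field.
by move: (_ * z + t) (z / 2) => u v; rewrite (sinD u v) (sinB u v); ring.
Qed.

(** The product form stays meaningful where the sine vanishes. *)
Lemma cos_sum_bound a b z t :
  `|sin (z / 2)| * `|\sum_(a <= n < b) cos (n%:R * z + t)| <= 1.
Proof.
have [ba|ab] := leqP b a; first by rewrite big_geq// normr0 mulr0.
rewrite -normrM -(@ler_pM2l _ 2)// mulr1.
rewrite -[X in X * _]ger0_norm// -normrM mulrA cos_sum ?(ltnW ab)//.
apply: le_trans (ler_normB _ _) _.
by have := sin_max (b%:R * z - z / 2 + t); have := sin_max (a%:R * z - z / 2 + t); lra.
Qed.

(** Monotonicity of sin x / x: the cosine decreases, so the mean slope of the sine on [x, y] is at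
    most the one on [0, x]. *)
Lemma sin_ratio (x y : R) : 0 < x -> x <= y -> y <= pi -> x * sin y <= y * sin x.
Proof.
move=> x0; rewrite le_eqVlt => /predU1P[->//|xy] ypi.
have cs (u v : R) : {within `[u, v], continuous (@sin R)}.
  by apply: continuous_subspaceT => w; exact: continuous_sin.
have [c1 + e1] := MVT x0 (fun z _ => @is_derive_sin R z) (cs 0 x).
have [c2 + e2] := MVT xy (fun z _ => @is_derive_sin R z) (cs x y).
rewrite !in_itv/= sin0 !subr0 in e1 * => /andP[c20 c2x] /andP[c10 c1x].
have cc : cos c2 <= cos c1.
  by rewrite ltW// ltr_cos ?in_itv/=; lra.
have : x * (sin y - sin x) <= (y - x) * sin x; last by lra.
rewrite e2 [in leRHS]e1 mulrCA [leRHS]mulrCA (mulrC x) ler_wpM2r// mulr_ge0//; lra.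
Qed.

Lemma sin_half_ge (x : R) : 0 <= x <= pi -> x / pi <= sin (x / 2).
Proof.
move=> /andP[]; rewrite le_eqVlt => /predU1P[<- _|x0 xp]; first by rewrite !mul0r sin0.
have pi0 := pi_gt0 R.
have := @sin_ratio (x / 2) (pi / 2); rewrite sin_pihalf mulr1 => h.
have {h} : x / 2 <= pi / 2 * sin (x / 2) by apply: h; lra.
move=> h; rewrite ler_pdivrMr//; lra.
Qed.


End Abel.

(** * Pointwise bounds and integrals of kernels *)

Section Kernels.
Context {R : realType}.
Local Notation mu := (@lebesgue_measure R).
Local Notation torus := (@torus R).
Implicit Types (A B : nat -> R) (a b n k : nat) (z t : R).

(* The minimum of [N] and [1 / |sin (z / 2)|], with value [N] where the sine
   vanishes (the inverse of [0] being [0]). *)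
Definition kmin (N z : R) : R :=
  if N * `|sin (z / 2)| <= 1 then N else `|sin (z / 2)|^-1.

Lemma kmin_gt0 N z : 0 < N -> 0 < kmin N z.
Proof.
move=> N0; rewrite /kmin; case: ifPn => // h.
rewrite invr_gt0 lt0r normr_ge0 andbT; apply: contraNneq h => ->.
by rewrite mulr0.
Qed.

(** Each term is at most an increment of x^s / s, by the mean value theorem. *)
Lemma sum_powR_le (s : R) n : 0 < s -> s <= 1 ->
  \sum_(1 <= j < n.+1) j%:R `^ (s - 1) <= n%:R `^ s / s.
Proof.
move=> s0 s1; elim: n => [|n IH]; first by rewrite big_geq// powR0 ?gt_eqF// mul0r.
rewrite big_nat_recr//=; apply: le_trans (lerD IH (lexx _)) _.
case: n {IH} => [|n].
  by rewrite powR0 ?gt_eqF// mul0r add0r !powR1 ler_pdivlMr// mul1r.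
rewrite -lerBrDl -mulrBl ler_pdivlMr//.
have nn : (n.+1%:R : R) < n.+2%:R by rewrite ltr_nat.
have n0 : (0 : R) < n.+1%:R by rewrite ltr0n.
have d (x : R) : x \in `]n.+1%:R, n.+2%:R[ -> is_derive x 1 (fun x => x `^ s) (s * x `^ (s - 1)).
  by rewrite in_itv/= => /andP[nx _]; apply: is_derive1_powR; exact: lt_trans nx.
have c : {within `[n.+1%:R, n.+2%:R], continuous (fun x : R => x `^ s)}.
  apply: derivable_within_continuous => x; rewrite in_itv/= => /andP[nx _].
  exact: (@ex_derive _ _ _ _ _ _ _ (is_derive1_powR s (lt_le_trans n0 nx))).
have [x + ->] := MVT nn d c; rewrite in_itv/= => /andP[x1 x2].
have -> : n.+2%:R - n.+1%:R = 1 :> R by rewrite -(natr1 n.+1) addrAC subrr add0r.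
rewrite mulr1 mulrC ler_wpM2l ?(ltW s0)//.
rewrite -(opprB 1 s) !powRN lef_pV2 ?posrE ?powR_gt0//; last exact: lt_trans x1.
by rewrite ge0_ler_powR ?nnegrE//; lra.
Qed.

Lemma block_kernel_bound A B (Bm : R) a b (N : R) z t : (a < b)%N -> (b - a)%:R <= N ->
  (forall n, (a <= n)%N -> (n.+1 < b)%N -> A n.+1 <= A n) -> (forall n, 0 <= A n) ->
  (forall n, (a <= n)%N -> (n.+1 < b)%N -> B n <= B n.+1) ->
  (forall n, 0 <= B n) -> (forall n, (a <= n < b)%N -> B n <= Bm) ->
  `|\sum_(a <= n < b) A n * B n * cos (n%:R * z + t)| <= 2 * A a * Bm * kmin N z.
Proof.
move=> ab bN Ad A0 Bi B0 BM.
have Bm0 : 0 <= Bm by apply: le_trans (B0 a) _; apply: BM; lia.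
rewrite /kmin; case: ifPn => [_|]; last first.
  rewrite -ltNge => h.
  have s0 : 0 < `|sin (z / 2)|.
    by rewrite lt0r normr_ge0 andbT; apply: contraTneq h => ->; rewrite mulr0 ltr10.
  rewrite (_ : 2 * A a * Bm * _ = A a * (2 * Bm * `|sin (z / 2)|^-1)); last by ring.
  apply: (@abel_mix _ A B (fun n => cos (n%:R * z + t))) => // j _.
  by rewrite -[leRHS]mul1r ler_pdivlMr// mulrC; exact: cos_sum_bound.
have Aa n : (a <= n < b)%N -> A n <= A a.
  move=> /andP[an nb]; rewrite -(subnKC an); have : (a + (n - a) < b)%N by lia.
  elim: (n - a)%N => [|m IH] mb; first by rewrite addn0.
  apply: le_trans (IH _); last by lia.
  by rewrite addnS; apply: Ad; lia.
apply: le_trans (ler_norm_sum _ _ _) _.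
apply: le_trans (_ : \sum_(a <= n < b) A a * Bm <= _).
  rewrite !big_nat; apply: ler_sum => n nab; rewrite normrM (ger0_norm (mulr_ge0 _ _))//.
  rewrite -[leRHS]mulr1 ler_pM ?mulr_ge0 ?cos_max//; apply: ler_pM => //; [exact: Aa|exact: BM].
rewrite sumr_const_nat -(mulr_natr (A a * Bm)).
have h : 0 <= A a * Bm by rewrite mulr_ge0.
have N0 : 0 <= N by apply: le_trans bN.
rewrite [leRHS](_ : _ = A a * Bm * (2 * N)); last by ring.
by rewrite ler_wpM2l//; apply: le_trans bN _; lra.
Qed.

(** If y = 1 / |sin (z / 2)| is below [N], the sum is cut at an integer [M] between y and y + 1 <= 2
    y. Before the cut absolute values give (2 y)^s / s; after it summation by parts gives 2 M^(s -
    1) y <= 2 y^s. *)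
Lemma low_kernel_bound A B (s Am Bm : R) N z t : 0 < s -> s < 1 -> (0 < N)%N ->
  (forall n, (1 <= n)%N -> (n.+1 < N)%N -> A n.+1 <= A n) -> (forall n, 0 <= A n) ->
  (forall n, (1 <= n < N)%N -> A n <= Am) ->
  (forall n, (1 <= n)%N -> (n.+1 < N)%N -> B n <= B n.+1) ->
  (forall n, 0 <= B n) -> (forall n, (1 <= n < N)%N -> B n <= Bm) -> 0 <= Am -> 0 <= Bm ->
  `|\sum_(1 <= n < N) n%:R `^ (s - 1) * A n * B n * cos (n%:R * z + t)| <=
  (2 / s + 2) * Am * Bm * kmin N%:R z `^ s.
Proof.
move=> s0 s1 N0 Ad A0 AM Bi B0 BM Am0 Bm0.
have triv M : (M <= N)%N -> (0 < M)%N ->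
    `|\sum_(1 <= n < M) n%:R `^ (s - 1) * A n * B n * cos (n%:R * z + t)| <= M%:R `^ s / s * (Am * Bm).
  move=> MN M0; apply: le_trans (ler_norm_sum _ _ _) _.
  apply: le_trans (_ : (\sum_(1 <= n < M.-1.+1) n%:R `^ (s - 1)) * (Am * Bm) <= _).
    rewrite prednK// big_distrl/= !big_nat; apply: ler_sum => n nM.
    rewrite normrM (ger0_norm (mulr_ge0 _ _))// ?mulr_ge0 ?powR_ge0//.
    rewrite -[leRHS]mulr1 ler_pM ?mulr_ge0 ?cos_max ?powR_ge0//.
    rewrite -mulrA ler_wpM2l ?powR_ge0//; apply: ler_pM => //; [apply: AM|apply: BM]; lia.
  rewrite ler_wpM2r ?mulr_ge0//; apply: le_trans (sum_powR_le _ s0 (ltW s1)) _.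
  rewrite ler_wpM2r ?invr_ge0 ?(ltW s0)//; apply: ge0_ler_powR; rewrite ?nnegrE ?ler0n ?(ltW s0)//.
  by rewrite ler_nat leq_pred.
have AB0 : 0 <= Am * Bm by rewrite mulr_ge0.
rewrite /kmin; case: ifPn => [_|].
  apply: le_trans (triv N (leqnn N) N0) _.
  rewrite (_ : _ / s * _ = s^-1 * (Am * Bm * N%:R `^ s)); last by ring.
  rewrite [leRHS](_ : _ = (2 / s + 2) * (Am * Bm * N%:R `^ s)); last by ring.
  rewrite ler_wpM2r ?mulr_ge0 ?powR_ge0//.
  have h : 0 < s^-1 by rewrite invr_gt0.
  lra.
rewrite -ltNge => h.
have sz : 0 < `|sin (z / 2)|.
  by rewrite lt0r normr_ge0 andbT; apply: contraTneq h => ->; rewrite mulr0 ltr10.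
set y : R := `|sin (z / 2)|^-1.
have y0 : 0 < y by rewrite invr_gt0.
have y1 : 1 <= y by rewrite invf_ge1// sin_max.
have yN : y < N%:R by rewrite /y -div1r ltr_pdivrMr.
have [M [yM My]] : exists M : nat, y < M%:R /\ M%:R <= y + 1.
  exists (Num.truncn y).+1; split; first exact: truncnS_gt.
  by rewrite -natr1 lerD2r truncn_le ltW.
have M0 : (0 < M)%N by rewrite -(ltr0n R); exact: lt_trans yM.
have MN : (M <= N)%N.
  have : (M%:R : R) < N.+1%:R by rewrite -(natr1 N); lra.
  by rewrite ltr_nat ltnS.
rewrite (big_cat_nat (n := M))//=.
apply: le_trans (ler_normD _ _) _.
have head : `|\sum_(1 <= n < M) n%:R `^ (s - 1) * A n * B n * cos (n%:R * z + t)| <=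
    2 / s * (Am * Bm * y `^ s).
  apply: le_trans (triv M MN M0) _.
  rewrite [leRHS](_ : _ = 2 * y `^ s / s * (Am * Bm)); last by ring.
  rewrite ler_wpM2r// ler_wpM2r ?invr_ge0 ?(ltW s0)//.
  apply: le_trans (_ : (2 * y) `^ s <= _).
    by apply: ge0_ler_powR; rewrite ?nnegrE ?ler0n ?(ltW s0)//; lra.
  rewrite powRM// ?(ltW y0)// ler_wpM2r ?powR_ge0//.
  by apply: ler1_powR; lra.
have tail : `|\sum_(M <= n < N) n%:R `^ (s - 1) * A n * B n * cos (n%:R * z + t)| <=
    2 * (Am * Bm * y `^ s).
  have := MN; rewrite leq_eqVlt => /predU1P[->|MN'].
    by rewrite big_geq// normr0 !mulr_ge0 ?powR_ge0.
  have pd n : (1 <= n)%N -> n.+1%:R `^ (s - 1) <= n%:R `^ (s - 1) :> R.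
    move=> n1; rewrite -(opprB 1 s) !powRN lef_pV2 ?posrE ?powR_gt0 ?ltr0n//.
    by apply: ge0_ler_powR; rewrite ?nnegrE ?ler0n ?ler_nat//; lra.
  apply: le_trans (@abel_mix _ (fun n => n%:R `^ (s - 1) * A n) B
    (fun n => cos (n%:R * z + t)) y Bm M N MN' _ _ _ _ _ _) _ => //.
  - move=> n Mn nN; have n1 : (0 < n)%N := leq_trans M0 Mn.
    by apply: ler_pM; [exact: powR_ge0|exact: A0|exact: pd|exact: Ad].
  - by rewrite mulr_ge0 ?powR_ge0.
  - by move=> n Mn nN; apply: Bi => //; exact: leq_trans M0 Mn.
  - by move=> n /andP[Mn nN]; apply: BM; rewrite nN andbT; exact: leq_trans M0 Mn.
  - by move=> j _; rewrite -[leRHS]mul1r ler_pdivlMr// mulrC; exact: cos_sum_bound.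
  have yy : M%:R `^ (s - 1) <= y `^ (s - 1).
    rewrite -(opprB 1 s) !powRN lef_pV2 ?posrE ?powR_gt0 ?ltr0n//.
    by apply: ge0_ler_powR; rewrite ?nnegrE ?ler0n ?(ltW yM) ?(ltW y0)//; lra.
  rewrite -(mulr_powRB1 (ltW y0) s0).
  rewrite [leRHS](_ : _ = y `^ (s - 1) * Am * (2 * Bm * y)); last by ring.
  rewrite ler_wpM2r ?mulr_ge0 ?(ltW y0)//; apply: ler_pM; rewrite ?powR_ge0//.
  by apply: AM; rewrite MN' andbT.
have := lerD head tail; lra.
Qed.


Definition sin_ind (d z : R) : R := \1_[set x : R | `|sin (x / 2)| <= d] z.

Lemma sin_indE d z : sin_ind d z = (`|sin (z / 2)| <= d)%R%:R.
Proof. by rewrite /sin_ind indicE; case: (boolP (`|sin (z / 2)| <= d)) => h;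
  [rewrite mem_set|rewrite memNset//; exact/negP]. Qed.

Lemma measurable_sin_half : measurable_fun setT (fun x : R => `|sin (x / 2)|).
Proof.
apply: measurableT_comp => //; apply: continuous_measurable_fun => x.
apply: continuous_comp; last exact: continuous_sin.
by apply: continuousM => //; exact: cst_continuous.
Qed.

Lemma sin_ind_measurable d : measurable_fun setT (sin_ind d).
Proof.
apply: measurable_indic; rewrite -[X in measurable X]setTI.
rewrite (_ : [set x : R | _] = (fun x : R => `|sin (x / 2)|) @^-1` `]-oo, d]).
  by apply: measurable_sin_half => //; exact: measurable_itv.
by apply/seteqP; split => x/=; rewrite in_itv.
Qed.

Lemma sin_ind_perL1 d : perL1 (sin_ind d).
Proof.
apply: (@perL1_bounded _ _ 1); first exact: sin_ind_measurable.
  move=> x; rewrite !sin_indE (_ : (x + 2 * pi) / 2 = x / 2 + pi); last by field.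
  by rewrite sinDpi normrN.
by move=> x; rewrite sin_indE; case: (_ <= d); rewrite ?normr1 ?normr0.
Qed.

Lemma tint_indic_itv (a b : R) : a <= b ->
  tint (\1_(`[a, b]%classic : set R)) <= b - a.
Proof.
move=> ab; rewrite /tint /Rintegral integral_indic//=; last exact: measurable_torus.
have h : (mu (`[a, b] `&` torus) <= (b - a)%:E)%E.
  apply: le_trans (_ : mu `[a, b]%classic <= _)%E.
    apply: le_measure; rewrite ?inE//; apply: measurableI => //; exact: measurable_torus.
  rewrite lebesgue_measure_itv/= lte_fin; case: ifPn => [_|_]; first by rewrite -EFinB.
  by rewrite lee_fin subr_ge0.
have : (0 <= mu (`[a, b] `&` torus))%E by exact: measure_ge0.
by case: (mu _) h => [r||]//=; rewrite !lee_fin.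
Qed.

(** By [sin_half_ge] the set lies within distance [pi * d] of the two ends of the torus. *)
Lemma tint_sin_ind d : 0 <= d -> tint (sin_ind d) <= 2 * pi * d.
Proof.
move=> d0; have pi0 := pi_gt0 R.
have perI (a b : R) : mu.-integrable torus (EFin \o (\1_(`[a, b]%classic : set R))).
  apply: (@measurable_bounded_integrable _ _ _ mu).
  - exact: measurable_torus.
  - exact: torus_lty.
  - exact: measurable_indic.
  - exists 1; split; first exact: num_real.
    by move=> y /ltW y1 x _; apply: le_trans y1; rewrite /= indicE; case: (_ \in _); rewrite ?normr1 ?normr0.
apply: le_trans (_ : tint (fun x => \1_(`[0, pi * d]%classic : set R) x +
   \1_(`[2 * pi - pi * d, 2 * pi]%classic : set R) x) <= _).
  have [_ _ i1] := sin_ind_perL1 d.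
  apply: (le_Rintegral _ i1); first exact: measurable_torus.
    exact: (@integrableD _ _ _ mu torus (measurable_itv _) _ _ (perI 0 (pi * d)) (perI (2 * pi - pi * d) (2 * pi))).
  move=> x; rewrite /Defs.torus/= in_itv/= => /andP[x0 x2].
  rewrite sin_indE; case: (leP _ d) => [sd|_]; last by rewrite addr_ge0 ?indicE.
  rewrite !indicE; have [xp|xp] := leP x pi.
    rewrite mem_set ?lerDl//= in_itv/= x0/=.
    have : x / pi <= d.
      by apply: le_trans sd; apply: le_trans (ler_norm _); apply: sin_half_ge; rewrite x0.
    by rewrite ler_pdivrMr// mulrC.
  rewrite addrC mem_set ?lerDl//= in_itv/= x2 andbT.
  have : (2 * pi - x) / pi <= d.
    apply: le_trans sd; apply: le_trans (ler_norm _).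
    have -> : sin (x / 2) = sin ((2 * pi - x) / 2).
      rewrite (_ : (2 * pi - x) / 2 = - (x / 2 - pi)); last by field.
      by rewrite sinN -(subrK pi (x / 2)) sinDpi addrK.
    by apply: sin_half_ge; lra.
  rewrite ler_pdivrMr//; lra.
rewrite /tint (@RintegralD _ _ _ mu torus _ _ (measurable_itv _) (perI _ _) (perI _ _)).
have pd : 0 <= pi * d by rewrite mulr_ge0// ltW.
have le2 : 2 * pi - pi * d <= 2 * pi by lra.
have h1 := tint_indic_itv pd; have h2 := tint_indic_itv le2.
by move: h1 h2; rewrite /tint; lra.
Qed.

Lemma powRX (r : R) k : (2 ^+ k) `^ r = (2 `^ r) ^+ k.
Proof.
elim: k => [|k IH]; first by rewrite !expr0 powR1.
by rewrite !exprS powRM ?exprn_ge0// IH.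
Qed.

(** A finite combination of indicators replaces the integration of a negative power of the sine. *)
Lemma kmin_dyadic k z (r : R) : 0 < r -> kmin (2 ^+ k) z `^ r <=
  \sum_(0 <= j < k.+1) (2 `^ r) ^+ j * sin_ind (2 / 2 ^+ j) z.
Proof.
move=> r0; set S := `|sin (z / 2)|.
have single j : (j < k.+1)%N -> S <= 2 / 2 ^+ j ->
    (2 `^ r) ^+ j <= \sum_(0 <= j < k.+1) (2 `^ r) ^+ j * sin_ind (2 / 2 ^+ j) z.
  move=> jk Sj; rewrite big_mkord (bigD1 (Ordinal jk))//= sin_indE Sj mulr1 lerDl.
  by apply: sumr_ge0 => i _; rewrite mulr_ge0 ?exprn_ge0 ?powR_ge0// sin_indE.
have p2 j : (0 : R) < 2 ^+ j by rewrite exprn_gt0.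
rewrite /kmin -/S; case: ifPn => [h|].
  rewrite powRX; apply: single => //.
  by rewrite ler_pdivlMr// mulrC; apply: le_trans h _; rewrite ler1n.
rewrite -ltNge => h.
(* The least such [j] is the dyadic level of the sine: minimality yields [S <= 2 / 2 ^+ j]. *)
have ex : exists j, 1 < 2 ^+ j * S by exists k.
have [j hj jmin] := ex_minnP ex.
have jk : (j < k.+1)%N by rewrite ltnS; apply: jmin.
have S0 : 0 < S by rewrite lt0r normr_ge0 andbT; apply: contraTneq hj => ->; rewrite mulr0 ltr10.
apply: le_trans (_ : (2 ^+ j) `^ r <= _).
  apply: ge0_ler_powR; rewrite ?nnegrE ?invr_ge0 ?(ltW r0) ?(ltW (p2 _)) ?(ltW S0)//.
  by rewrite -div1r ler_pdivrMr// ltW.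
rewrite powRX; apply: single => //.
case: j hj jmin {jk} => [|j] hj jmin.
  by move: hj; rewrite expr0 mul1r ltNge sin_max.
have {}jmin : 2 ^+ j * S <= 1 by rewrite leNgt; apply/negP => /jmin; rewrite ltnn.
by rewrite ler_pdivlMr// exprS mulrC -mulrA -[leRHS]mulr1 ler_pM2l.
Qed.

(** Level [j] of the majorant contributes 2^(jr) times a measure of order 2^(-j). At [r = 1] all
    levels weigh the same, which is the source of the logarithm; for [r > 1] the last one
    dominates. *)
Definition kint k (r : R) : R := 4 * pi * \sum_(0 <= j < k.+1) (2 `^ (r - 1)) ^+ j.

Definition kmaj k r (x y : R) : R :=
  \sum_(0 <= j < k.+1) (2 `^ r) ^+ j * sin_ind (2 / 2 ^+ j) (y - x).

Lemma perL1_kmaj k r x : perL1 (kmaj k r x).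
Proof.
apply: perL1_sum => j; apply: perL1Z; apply: (perL1_translate (- x)).
exact: sin_ind_perL1.
Qed.

Lemma tint_kmaj k r x : tint (kmaj k r x) <= kint k r.
Proof.
have p2 j : (0 : R) < 2 ^+ j by rewrite exprn_gt0.
rewrite /kmaj tint_sum; last first.
  by move=> j; apply: perL1Z; apply: (perL1_translate (- x)); exact: sin_ind_perL1.
rewrite /kint big_distrr/=; apply: ler_sum => j _.
have pj := perL1_translate (- x) (sin_ind_perL1 (2 / 2 ^+ j)).
rewrite tintZ// tint_translate; last exact: sin_ind_perL1.
apply: le_trans (_ : (2 `^ r) ^+ j * (2 * pi * (2 / 2 ^+ j)) <= _).
  by rewrite ler_wpM2l ?exprn_ge0 ?powR_ge0// tint_sin_ind// divr_ge0// ltW.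
rewrite powRB ?powRr1//; last by apply/implyP => _; rewrite pnatr_eq0.
by rewrite le_eqVlt; apply/orP; left; apply/eqP; rewrite exprMn exprVn; field; rewrite gt_eqF.
Qed.

Lemma kint1 k : kint k 1 = 4 * pi * k.+1%:R.
Proof.
rewrite /kint subrr; under eq_bigr do rewrite powRr0 expr1n.
by rewrite sumr_const_nat subn0.
Qed.

Lemma kint_ge0 k r : 0 <= kint k r.
Proof.
rewrite /kint mulr_ge0 ?mulr_ge0 ?pi_ge0//; apply: sumr_ge0 => i _.
by rewrite exprn_ge0// powR_ge0.
Qed.

Lemma kint_gt1 k r : 1 < r ->
  kint k r <= 4 * pi * (2 `^ (r - 1) / (2 `^ (r - 1) - 1)) * (2 ^+ k) `^ (r - 1).
Proof.
move=> r1; rewrite powRX /kint -[leRHS]mulrA ler_wpM2l ?mulr_ge0 ?pi_ge0//.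
set c : R := 2 `^ (r - 1).
have c1 : 1 < c.
  by rewrite -[X in X < _](powRr0 2) /c /powR pnatr_eq0/= ltr_expR ltr_pM2r ?ln_gt0 ?ltr1n//; lra.
elim: k => [|k IH].
  by rewrite big_nat1 !expr0 mulr1 ler_pdivlMr; lra.
rewrite big_nat_recr//=; apply: le_trans (lerD IH (lexx _)) _.
rewrite le_eqVlt; apply/orP; left; apply/eqP; rewrite !exprS; field; lra.
Qed.

End Kernels.

(** * Norms on the torus *)

Section Norms.
Context {R : realType}.
Local Notation mu := (@lebesgue_measure R).
Local Notation torus := (@torus R).

(** The integral of a nonnegative function is a supremum over the simple functions below it, hence
    monotone even for functions that are not measurable. It is applied to differences and moduli
    whose measurability is not established. *)
Lemma ge0_le_integral_nomeas d (T : measurableType d) (m : {measure set T -> \bar R})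
  (D : set T) (f g : T -> \bar R) :
  (forall x, D x -> (0 <= f x)%E) -> (forall x, D x -> (f x <= g x)%E) ->
  (\int[m]_(x in D) f x <= \int[m]_(x in D) g x)%E.
Proof.
move=> f0 fg; rewrite integral_mkcond [leRHS]integral_mkcond.
have h0 x : (0 <= (f \_ D) x)%E by rewrite patchE; case: ifPn => // /set_mem; exact: f0.
have hle x : ((f \_ D) x <= (g \_ D) x)%E.
  by rewrite !patchE; case: ifPn => // /set_mem; exact: fg.
rewrite !ge0_integralTE//; last by move=> x; apply: le_trans (hle x).
apply: ereal_sup_le => _ [h /= hf <-]; exists h => //=.
by move=> x; apply: le_trans (hle x); exact: hf.
Qed.

Definition NT (p : R) (G : R -> R) : \bar R := 'N[mu]_p%:E[(fun x => (G x)%:E) \_ torus].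

Lemma normTE p f : normT p%:E f = NT p (fun x => Normc.normc (f x)).
Proof. by []. Qed.

Lemma NTE (p : R) G : p != 0 -> NT p G = ((\int[mu]_(x in torus) (`|G x| `^ p)%:E) `^ p^-1)%E.
Proof.
move=> p0; rewrite /NT unlock; congr (_ `^ _)%E; rewrite [RHS]integral_mkcond.
apply: eq_integral => x _; rewrite !patchE; case: ifPn => _.
  by rewrite abse_EFin poweR_EFin.
by rewrite abse0 poweR0r.
Qed.

Lemma NT_mono (p : R) G H : 0 < p -> (forall x, torus x -> `|G x| <= `|H x|) -> (NT p G <= NT p H)%E.
Proof.
move=> p0 GH; have pn : p != 0 by rewrite gt_eqF.
rewrite (NTE _ pn) (NTE _ pn); apply: gt0_ler_poweR.
- by rewrite invr_ge0 ltW.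
- by rewrite in_itv/= leey andbT integral_ge0// => x _; rewrite lee_fin powR_ge0.
- by rewrite in_itv/= leey andbT integral_ge0// => x _; rewrite lee_fin powR_ge0.
apply: ge0_le_integral_nomeas => x xT; rewrite lee_fin ?powR_ge0//.
by apply: ge0_ler_powR; rewrite ?nnegrE ?(ltW p0)//; exact: GH.
Qed.

Lemma NT_ge0 p G : (0 <= NT p G)%E.
Proof. exact: Lnorm_ge0. Qed.

Lemma tintE F : perL1 F -> (\int[mu]_(x in torus) (F x)%:E)%E = (tint F)%:E.
Proof.
move=> [_ _ iF]; rewrite /tint /Rintegral fineK//; apply: integrable_fin_num => //.
exact: measurable_torus.
Qed.

Lemma NT_le (q : R) K M C : 0 < q -> perL1 M -> (forall y, torus y -> `|K y| `^ q <= M y) ->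
  tint M <= C -> (NT q K <= (C `^ q^-1)%:E)%E.
Proof.
move=> q0 pM KM MC; rewrite NTE ?gt_eqF//.
have h : (\int[mu]_(x in torus) (`|K x| `^ q)%:E <= C%:E)%E.
  apply: le_trans (_ : (\int[mu]_(x in torus) (M x)%:E <= _)%E).
    by apply: ge0_le_integral_nomeas => x xT; rewrite lee_fin ?powR_ge0//; exact: KM.
  by rewrite tintE// lee_fin.
have h0 : (0 <= \int[mu]_(x in torus) (`|K x| `^ q)%:E)%E.
  by apply: integral_ge0 => x _; rewrite lee_fin powR_ge0.
rewrite -poweR_EFin; apply: gt0_ler_poweR => //.
- by rewrite invr_ge0 ltW.
- by rewrite in_itv/= leey andbT.
- by rewrite in_itv/= leey andbT (le_trans h0 h).
Qed.

Lemma hoelder_tint (p q : R) (D K : R -> R) (E M : R) : 0 < p -> 0 < q -> p^-1 + q^-1 = 1 ->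
  measurable_fun setT D -> measurable_fun setT K ->
  (NT p D <= E%:E)%E -> (NT q K <= M%:E)%E ->
  `|tint (fun x => D x * K x)| <= E * M.
Proof.
move=> p0 q0 pq mD mK DE KM.
have mT := @measurable_torus R.
have mr (G : R -> R) : measurable_fun setT G -> measurable_fun setT (G \_ torus).
  by move=> mG; apply/(measurable_restrictT _ mT)/measurable_funTS.
have := hoelder mu (mr D mD) (mr K mK) p0 q0 pq; rewrite Lnorm1 => H.
have NE r (G : R -> R) : ('N[mu]_r%:E[EFin \o (G \_ torus)] = NT r G)%E.
  by apply: eq_Lnorm => x; rewrite /= !patchE; case: ifP.
rewrite !NE in H.
have {}H : (\int[mu]_(x in torus) `|(D x * K x)%:E| <= (E * M)%:E)%E.
  rewrite EFinM; apply: le_trans (lee_pmul _ _ DE KM); rewrite ?NT_ge0//.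
  apply: le_trans H; rewrite [leLHS]integral_mkcond le_eqVlt; apply/orP; left; apply/eqP.
  apply: eq_integral => x _; rewrite /= !patchE; case: ifP => // _.
  by rewrite /= mul0r normr0.
have mDK : measurable_fun torus (EFin \o (fun x => D x * K x)).
  by apply/measurable_EFinP/measurable_funTS/measurable_funM.
rewrite /tint -lee_fin; apply: (le_trans _ H).
have iDK : mu.-integrable torus (EFin \o (fun x => D x * K x)).
  apply/integrableP; split => //.
  by apply: (le_lt_trans H); rewrite ltry.
rewrite EFin_normr_Rintegral//; exact: le_abse_integral.
Qed.

Lemma ess_sup_torus (F : R -> R) (M : R) : 0 <= M ->
  {ae mu, forall x, torus x -> `|F x| <= M} ->
  ('N[mu]_+oo[(fun x => (F x)%:E) \_ torus] <= M%:E)%E.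
Proof.
move=> M0 FM; rewrite unlock; case: ifP => _; last by rewrite lee_fin.
apply/ess_supP; have aeF : Filter (nbhs (almost_everywhere mu)) by exact: ae_filter_ringOfSetsType.
apply: (filterS _ FM) => x h; rewrite /= patchE; case: ifPn => [/set_mem xT|_].
  by rewrite abse_EFin lee_fin; exact: h.
by rewrite abse0 lee_fin.
Qed.

(** Near [x] the continuous minorant [F] exceeds [F x - e] on an interval, which has positive
    measure. This turns a lower bound at one point into one for the essential supremum. *)
Lemma cont_le_ess_sup (F H : R -> R) (x : R) : continuous F -> (forall y, F y <= `|H y|) ->
  0 < x < 2 * pi -> ((F x)%:E <= 'N[mu]_+oo[(fun x => (H x)%:E) \_ torus])%E.
Proof.
move=> cF FH x02; rewrite unlock.
have muT : (0 < mu [set: R])%E.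
  apply: (@lt_le_trans _ _ (mu `[0, 1]%classic)); last by apply: le_measure; rewrite ?inE.
  by rewrite lebesgue_measure_itv/= lte_fin ltr01 -EFinB subr0 lte_fin ltr01.
rewrite muT; apply/lee_addgt0Pr => e e0; rewrite leNgt; apply/negP => h.
have : (ess_sup mu (abse \o (fun x0 : R => (H x0)%:E) \_ torus) <= (F x - e)%:E)%E.
  by rewrite EFinB leeBrDr// ltW.
move=> /ess_supP[A [mA A0 AP]].
have [d d0 dP] : exists2 d, 0 < d & forall y, `|x - y| < d -> 0 < y < 2 * pi /\ F x - e < F y.
  have : \forall y \near x, 0 < y < 2 * pi /\ F x - e < F y.
    near=> y; split; first (apply/andP; split).
    - near: y; apply: lt_nbhsr; lra.
    - near: y; apply: lt_nbhsl; lra.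
    - have : `|F x - F y| < e by near: y; apply: cvgr_dist_lt => //; exact: cF.
      by rewrite ltr_distlC => /andP[]; lra.
  by move=> /nbhs_ballP[d /= d0 dP]; exists d => // y xy; apply: dP.
have sub : `]x - d, x + d[ `<=` A.
  move=> y /=; rewrite in_itv/= => yd; apply: AP => /=.
  have [y02 Fy] : 0 < y < 2 * pi /\ F x - e < F y by apply: dP; rewrite ltr_distl; lra.
  rewrite patchE mem_set; last by rewrite /Defs.torus/= in_itv/=; lra.
  by rewrite abse_EFin lee_fin => h2; have := FH y; lra.
have : (mu `](x - d)%R, (x + d)%R[%classic <= mu A)%E by apply: le_measure; rewrite ?inE.
have xd : x - d < x + d by lra.
by rewrite A0 lebesgue_measure_itv/= lte_fin xd -EFinB lee_fin; lra.
Unshelve. all: by end_near. Qed.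

End Norms.

(** * Fractional differences *)

Section FracDiff.
Context {R : realType}.
Local Notation mu := (@lebesgue_measure R).
Local Notation torus := (@torus R).
Implicit Types (s h x t : R) (F : R -> R).

Definition fdt s h F x (j : nat) : R := bc s j * F (x + (s - j%:R) * h).
Definition rdiff s h F x : R := ser (fdt s h F x).

Lemma fracdiffE s h (f : R -> R[i]) x :
  fracdiff s h f x = Complex (rdiff s h (@complex.Re R \o f) x) (rdiff s h (@complex.Im R \o f) x).
Proof. by []. Qed.

Lemma rdiffD s h F G x : summ (fdt s h F x) -> summ (fdt s h G x) ->
  rdiff s h (fun y => F y + G y) x = rdiff s h F x + rdiff s h G x.
Proof.
by move=> sF sG; rewrite /rdiff -serD//; apply: eq_ser => j; rewrite /fdt mulrDr.
Qed.

Lemma summ_fdt_bounded s h F x M : 0 < s -> (forall j : nat, `|F (x + (s - j%:R) * h)| <= M) ->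
  summ (fdt s h F x).
Proof. by move=> s0 FM; apply: (summM_bounded (M := M)) => //; exact: bc_summ. Qed.

Definition bcn s : R := ser (fun j => `|bc s j|).

Lemma bcn_ge0 s : 0 < s -> 0 <= bcn s.
Proof.
move=> s0; have := bc_summ s0 => sb; apply: limr_ge => //.
by near=> n; exact: sumr_ge0.
Unshelve. all: by end_near. Qed.

Lemma rdiff_bounded s h F x M : 0 < s -> (forall j : nat, `|F (x + (s - j%:R) * h)| <= M) ->
  `|rdiff s h F x| <= M * bcn s.
Proof.
move=> s0 FM; apply: ser_normM; last exact: bc_summ.
by move=> n; rewrite normrM mulrC ler_wpM2r.
Qed.

Lemma rdiff_cst s h (c : R) x : 0 < s -> rdiff s h (cst c) x = 0.
Proof.
move=> s0; rewrite /rdiff (@eq_ser _ _ (fun j => c * bc s j)).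
  by rewrite serZ ?ser_bc ?mulr0//; exact: bc_summ.
by move=> j; rewrite /fdt /= mulrC.
Qed.

(** Argument of (i sgn h)^s, the phase of the multiplier (2 i sin (n h / 2))^s. *)
Definition fphase s h : R := if 0 <= h then s * pi / 2 else - (s * pi / 2).

(** The condition on [h] keeps [n * |h|] in the range of [binom_cosE]; a negative step is reduced to
    a positive one by the evenness of the cosine. *)
Lemma rdiff_cos s h (n : nat) t x : 0 < s -> n%:R * `|h| < 2 * pi ->
  rdiff s h (fun y => cos (n%:R * y + t)) x =
  fdc s * (2 * sin (n%:R * `|h| / 2)) `^ s * cos (n%:R * (x + s * h / 2) + t + fphase s h).
Proof.
move=> s0 nh; have nh0 : 0 <= n%:R * `|h| by rewrite mulr_ge0.
rewrite /fphase; case: (leP 0 h) => h0.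
  have eh : `|h| = h by exact: ger0_norm.
  rewrite eh in nh nh0 *.
  have nb : 0 <= n%:R * h < 2 * pi by rewrite nh0.
  rewrite mulrAC -(binom_cosE (n%:R * (x + s * h / 2) + t) s0 nb).
  by apply: eq_ser => j; rewrite /fdt; congr (_ * cos _); field.
have eh : `|h| = - h by exact: ltr0_norm.
rewrite eh in nh nh0 *.
have nb : 0 <= n%:R * (- h) < 2 * pi by rewrite nh0.
have := binom_cosE (- (n%:R * (x + s * h / 2) + t)) s0 nb.
rewrite [cos (n%:R * _ + t - _)](_ : _ = cos (- (n%:R * (x + s * h / 2) + t) + s * pi / 2)); last by rewrite -cosN opprD opprK.
rewrite [X in _ -> _ = X]mulrAC => <-.
by apply: eq_ser => j; rewrite /fdt -cosN; congr (_ * cos _); field.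
Qed.

Section Regularised.
Variables (s h : R) (F : R -> R).
Hypotheses (s0 : 0 < s) (pF : perL1 F).

Let g x : \bar R := (\sum_(0 <= j <oo) `|fdt s h F x j|%:E)%E.
Let good : set R := [set x | (g x < +oo)%E].

Let mterm j : measurable_fun setT (fun x => fdt s h F x j).
Proof.
case: pF => mF _ _; apply: measurable_funM => //.
exact: (measurable_translate _ mF).
Qed.

Let mg : measurable_fun setT g.
Proof.
apply: ge0_emeasurable_sum => // j _; apply/measurable_EFinP.
by apply: measurableT_comp => //; exact: mterm.
Qed.

Let mgood : measurable good.
Proof.
rewrite -[X in measurable X]setTI (_ : good = g @^-1` [set` Interval (BInfty _ true) (BLeft +oo%E)]).
  by apply: mg => //; exact: emeasurable_itv.
by apply/seteqP; split => x; rewrite /good/= in_itv.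
Qed.

Let goodP x : good x -> summ (fdt s h F x).
Proof.
rewrite /good/= => gx.
apply: (@summ_bounded _ _ (fine (g x))) => n.
have gf : g x \is a fin_num.
  by rewrite ge0_fin_numE//; apply: nneseries_ge0 => j _; rewrite lee_fin.
rewrite -lee_fin fineK// -sumEFin.
by apply: nneseries_lim_ge => j _; rewrite lee_fin.
Qed.

(* The series of the difference of an integrable function converges absolutely
   only almost everywhere; it is replaced by 0 on the exceptional set to obtain
   a measurable function. *)
Definition regdiff : R -> R := rdiff s h F \_ good.

(** By translation invariance every term has the L_1 norm of [F] up to its coefficient, and the
    coefficients are summable. *)
Let int_g : (\int[mu]_(x in torus) g x < +oo)%E.
Proof.
have mT := @measurable_torus R.
case: (pF) => mF perF /integrableP[_ iF].
rewrite /g integral_nneseries//; last first.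
  by move=> j; apply/measurable_EFinP/measurable_funTS/measurableT_comp => //; exact: mterm.
set I := (\int[mu]_(x in torus) `|(EFin \o F) x|)%E in iF.
have E j : (\int[mu]_(x in torus) `|fdt s h F x j|%:E = `|bc s j|%:E * I)%E.
  under eq_integral do rewrite normrM EFinM.
  rewrite ge0_integralZl//; last first.
    apply/measurable_EFinP/measurable_funTS/measurableT_comp => //.
    exact: (measurable_translate _ mF).
  congr (_ * _)%E.
  rewrite (ge0_torus_translate (f := fun x => (`|F x|%:E)%E))//.
    by apply/measurable_EFinP/measurableT_comp.
  by move=> x; rewrite perF.
have I0 : (0 <= I)%E by exact: integral_ge0.
have If : I = (fine I)%:E by rewrite fineK// ge0_fin_numE.
rewrite (eq_eseriesr (g := fun j => (`|bc s j| * fine I)%:E)); last first.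
  by move=> j _; rewrite E If EFinM.
apply: (@le_lt_trans _ _ (bcn s * fine I)%:E); last exact: ltry.
apply: lime_le; first by apply: is_cvg_nneseries => n _ _; rewrite lee_fin mulr_ge0// fine_ge0.
apply: nearW => n; rewrite sumEFin lee_fin -mulr_suml ler_wpM2r ?fine_ge0//.
have := bc_summ s0 => sb.
by apply: nondecreasing_cvgn_le => //; apply: nondecreasing_series => i _ _.
Qed.

Let ig : mu.-integrable torus g.
Proof.
apply/integrableP; split; first exact: measurable_funTS.
under eq_integral do (rewrite gee0_abs; last by apply: nneseries_ge0 => j _; rewrite lee_fin).
exact: int_g.
Qed.

Let aegood : {ae mu, forall x, torus x -> good x}.
Proof.
have aeF : Filter (nbhs (almost_everywhere mu)) by exact: ae_filter_ringOfSetsType.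
have := @integrable_ae _ _ _ mu torus (@measurable_torus R) _ ig.
by apply: filterS => x /[apply]; rewrite /good/= => /fin_numPlt/andP[].
Qed.

Lemma measurable_rdiff_good : measurable_fun setT regdiff.
Proof.
have mr : measurable_fun good (rdiff s h F).
  apply: (@measurable_fun_cvg _ _ R good (fun n x => series (fdt s h F x) n)).
    by move=> n; apply: measurable_sum => i; apply: measurable_funTS; exact: mterm.
  by move=> x /goodP /summ_cvg.
exact: (iffLR (measurable_restrictT (rdiff s h F) mgood) mr).
Qed.

Lemma norm_regdiff x : `|regdiff x| <= `|rdiff s h F x|.
Proof. by rewrite /regdiff patchE; case: ifPn => // _; rewrite normr0. Qed.

Let fdt_per x : fdt s h F (x + 2 * pi) = fdt s h F x.
Proof.
by case: pF => _ perF _; apply/funext => j; rewrite /fdt -(perF (x + _)) addrAC.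
Qed.

Let regdiff_g x : (`|(regdiff x)%:E| <= g x)%E.
Proof.
rewrite /regdiff patchE; case: ifPn => [/set_mem gx|_]; last first.
  by rewrite abse0; apply: nneseries_ge0 => j _; rewrite lee_fin.
have gf : g x \is a fin_num.
  by rewrite ge0_fin_numE//; apply: nneseries_ge0 => j _; rewrite lee_fin.
rewrite -(fineK gf) abse_EFin lee_fin; have := summ_cvg (goodP gx) => /cvg_norm.
move=> h1; apply: (cvgr_to_le h1).
near=> n; rewrite -lee_fin fineK// (le_trans (y := (\sum_(0 <= j < n) `|fdt s h F x j|)%:E))//.
  by rewrite lee_fin ler_norm_sum.
by rewrite -sumEFin; apply: nneseries_lim_ge => j _; rewrite lee_fin.
Unshelve. all: by end_near. Qed.

Lemma perL1_regdiff : perL1 regdiff.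
Proof.
split; first exact: measurable_rdiff_good.
  move=> x; rewrite /regdiff !patchE /rdiff fdt_per.
  rewrite (_ : (x + 2 * pi \in good) = (x \in good))//.
  by apply/idP/idP => /set_mem h1; apply/mem_set; move: h1; rewrite /good/= /g fdt_per.
apply: (le_integrable _ _ _ ig) => //; first exact: measurable_torus.
  by apply/measurable_EFinP/measurable_funTS; exact: measurable_rdiff_good.
move=> x _ /=; apply: le_trans (regdiff_g x) _.
by rewrite gee0_abs//; apply: nneseries_ge0 => j _; rewrite lee_fin.
Qed.

Let fdtw (n : nat) t (j : nat) := t - n%:R * (s - j%:R) * h.

Let tint_fdt (n : nat) t j : tint (fun x => fdt s h F x j * cos (n%:R * x + t)) =
  bc s j * tint (fun y => F y * cos (n%:R * y + fdtw n t j)).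
Proof.
have pc := perL1Mcos n (fdtw n t j) pF.
rewrite -tintZ// -[LHS](tint_translate (- ((s - j%:R) * h))).
  apply: eq_tint => x; rewrite /fdt subrK -mulrA; congr (_ * (_ * cos _)).
  by rewrite /fdtw; ring.
rewrite (_ : (fun _ => _) = fun x => bc s j * F (x + (s - j%:R) * h) * cos (n%:R * x + t))//.
by apply/perL1Mcos/perL1Z/perL1_translate.
Qed.

Let perL1_fdt j : perL1 (fun x => fdt s h F x j).
Proof. by apply/perL1Z/perL1_translate. Qed.

Let cvg_tint_fdt (n : nat) t :
  (fun J => \sum_(0 <= j < J) bc s j * tint (fun y => F y * cos (n%:R * y + fdtw n t j))) @ \oo
    --> tint (fun x => regdiff x * cos (n%:R * x + t)).
Proof.
pose P J x := (\sum_(0 <= j < J) fdt s h F x j) * cos (n%:R * x + t).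
have pP J : perL1 (P J) by apply/perL1Mcos/perL1_sum.
rewrite (_ : (fun J => _) = fun J => tint (P J)); last first.
  apply/funext => J; rewrite -(eq_tint (F := fun x => \sum_(0 <= j < J) fdt s h F x j * cos (n%:R * x + t))).
    rewrite tint_sum => [|j]; last exact: perL1Mcos.
    by apply: eq_bigr => j _; rewrite tint_fdt.
  by move=> x; rewrite /P mulr_suml.
have pR := perL1Mcos n t perL1_regdiff.
have gJ J x : (`|(P J x)%:E| <= g x)%E.
  apply: le_trans (_ : ((\sum_(0 <= j < J) `|fdt s h F x j|)%:E <= _)%E).
    rewrite abse_EFin lee_fin normrM -[leRHS]mulr1 ler_pM// ?ler_norm_sum//.
    exact: cos_max.
  by rewrite -sumEFin; apply: nneseries_lim_ge => j _; rewrite lee_fin.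
have aeF : Filter (nbhs (almost_everywhere mu)) by exact: ae_filter_ringOfSetsType.
have /(_ _ _ _ _)[|||||] := @dominated_convergence _ _ _ mu torus (@measurable_torus R)
  (fun J x => (P J x)%:E) (fun x => (regdiff x * cos (n%:R * x + t))%:E) g.
- by move=> J; case: (pP J) => mP _ _; apply/measurable_EFinP/measurable_funTS.
- by case: pR => mP _ _; apply/measurable_EFinP/measurable_funTS.
- apply: (filterS _ aegood) => x /[apply] gx.
  apply/cvg_EFin; first exact: nearW.
  apply: cvgMr_tmp; rewrite /regdiff patchE (mem_set gx).
  exact: (summ_cvg (goodP gx)).
- exact: ig.
- exact: (aeW _).
move=> _ _; rewrite (tintE pR).
under eq_fun do rewrite (tintE (pP _)).
by move=> /fine_cvg.
Qed.

(** The partial sums are dominated by the integrable [g], so coefficients are taken term by term.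
    Translating each term moves its shift into the phase, and expanding the phase leaves two series
    of the form [binom_cos]. *)
Lemma fourier_regdiff (n : nat) t : 0 <= h -> n%:R * h < 2 * pi ->
  tint (fun x => regdiff x * cos (n%:R * x + t)) =
  fdc s * (2 * sin (n%:R * h / 2)) `^ s *
    tint (fun y => F y * cos (n%:R * y + (t - n%:R * (s * h / 2) - s * pi / 2))).
Proof.
move=> h0 nh; set L := RHS.
suff H : (fun J => \sum_(0 <= j < J) bc s j * tint (fun y => F y * cos (n%:R * y + fdtw n t j))) @ \oo --> L.
  exact: (cvg_unique _ (@cvg_tint_fdt n t) H).
rewrite /L {L}.
pose w := n%:R * (s * h / 2) - t.
pose A := tint (fun y => F y * cos (n%:R * y + 0)).
pose B := tint (fun y => F y * cos (n%:R * y - pi / 2)).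
have pA := perL1Mcos n 0 pF; have pB := perL1Mcos n (- (pi / 2)) pF.
have AB v : tint (fun y => F y * cos (n%:R * y + v)) = A * cos v - B * sin v.
  rewrite [A * _]mulrC [B * _]mulrC /A /B -(tintZ _ pA) -(tintZ _ pB) -(tintB (perL1Z _ pA) (perL1Z _ pB)).
  apply: eq_tint => y; rewrite cosD addr0 cosBpihalf; ring.
have wv j : cos (fdtw n t j) = cos (w + (s / 2 - j%:R) * (n%:R * h)).
  by rewrite -cosN /fdtw; congr cos; rewrite /w; field.
have wv' j : sin (fdtw n t j) = - cos (w - pi / 2 + (s / 2 - j%:R) * (n%:R * h)).
  by rewrite addrAC cosBpihalf -sinN /fdtw; congr sin; rewrite /w; field.
have nb : 0 <= n%:R * h < 2 * pi by rewrite nh mulr_ge0.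
have sb w' : summ (fun j => bc s j * cos (w' + (s / 2 - j%:R) * (n%:R * h))).
  exact: summ_bccos.
rewrite (_ : (fun J => _) = series (fun j => A * (bc s j * cos (w + (s / 2 - j%:R) * (n%:R * h)))
  + B * (bc s j * cos (w - pi / 2 + (s / 2 - j%:R) * (n%:R * h))))); last first.
  apply/funext => J; apply: eq_bigr => j _; rewrite AB wv wv'; ring.
rewrite AB.
rewrite [X in _ --> X](_ : _ = ser (fun j => A * (bc s j * cos (w + (s / 2 - j%:R) * (n%:R * h)))
  + B * (bc s j * cos (w - pi / 2 + (s / 2 - j%:R) * (n%:R * h))))).
  by apply/summ_cvg/summD; apply/summZ.
rewrite (serD (summZ (k:=A) (sb w)) (summZ (k:=B) (sb (w - pi / 2)))).
rewrite !serZ// -!/(binom_cos _ _ _) (binom_cosE _ s0 nb) (binom_cosE _ s0 nb).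
rewrite (_ : t - n%:R * (s * h / 2) - s * pi / 2 = - (w + s * pi / 2)); last by rewrite /w; ring.
rewrite cosN sinN [w - pi / 2 + _]addrAC cosBpihalf; ring.
Qed.

End Regularised.
End FracDiff.

(** * Dyadic decomposition *)

Section Harmonics.
Context {R : realType}.
Local Notation mu := (@lebesgue_measure R).
Local Notation torus := (@torus R).
Implicit Types (s h x t : R) (F G : R -> R) (n m a b : nat).

Definition cos_coef F n : R := tint (fun y => F y * cos (n%:R * y)).
Definition sin_coef F n : R := tint (fun y => F y * sin (n%:R * y)).

Lemma perL1Mcosn F n : perL1 F -> perL1 (fun y => F y * cos (n%:R * y)).
Proof. by move=> /(perL1Mcos n 0); under eq_fun do rewrite addr0. Qed.

Lemma perL1Msinn F n : perL1 F -> perL1 (fun y => F y * sin (n%:R * y)).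
Proof. by move=> /(perL1Mcos n (- (pi / 2))); under eq_fun do rewrite cosBpihalf. Qed.

Lemma tint_cosE F n v : perL1 F ->
  tint (fun y => F y * cos (n%:R * y + v)) = cos_coef F n * cos v - sin_coef F n * sin v.
Proof.
move=> pF; have pA := perL1Mcosn n pF; have pB := perL1Msinn n pF.
rewrite [cos_coef _ _ * _]mulrC [sin_coef _ _ * _]mulrC /cos_coef /sin_coef -(tintZ _ pA) -(tintZ _ pB).
rewrite -(tintB (perL1Z _ pA) (perL1Z _ pB)).
by apply: eq_tint => y; rewrite cosD; ring.
Qed.

(** For [0 < a], the sharp projection onto the frequencies [a <= n < b]; the coefficients are bare
    integrals, whence the factor [pi^-1]. *)
Definition fourier_part F a b x : R := pi^-1 * \sum_(a <= n < b) (cos_coef F n * cos (n%:R * x) + sin_coef F n * sin (n%:R * x)).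

Lemma perL1_harm u v n : perL1 (fun x : R => u * cos (n%:R * x) + v * sin (n%:R * x)).
Proof.
apply: perL1D; apply: perL1Z.
  by have := perL1_cos n (0 : R); under eq_fun do rewrite addr0.
by have := perL1_cos n (- (pi / 2) : R); under eq_fun do rewrite cosBpihalf.
Qed.

Lemma perL1_fourier_part F a b : perL1 (fourier_part F a b).
Proof. by apply/perL1Z/perL1_sum => n; exact: perL1_harm. Qed.

Lemma fourier_part_cat F a b c x : (a <= b)%N -> (b <= c)%N -> fourier_part F a c x = fourier_part F a b x + fourier_part F b c x.
Proof. by move=> ab bc; rewrite /fourier_part (big_cat_nat ab bc)//= mulrDr. Qed.

Lemma tint_harm_cos u v n m t : (0 < n)%N ->
  tint (fun x => (u * cos (n%:R * x) + v * sin (n%:R * x)) * cos (m%:R * x + t)) =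
  if n == m then pi * (u * cos t - v * sin t) else 0.
Proof.
move=> n0.
have p1 := perL1Z u (perL1Mcos m t (perL1_cos n 0)).
have p2 := perL1Z v (perL1Mcos m t (perL1_cos n (- (pi / 2)))).
rewrite -(eq_tint (F := fun x => u * (cos (n%:R * x + 0) * cos (m%:R * x + t)) +
   v * (cos (n%:R * x - pi / 2) * cos (m%:R * x + t)))); last first.
  by move=> x; rewrite addr0 cosBpihalf; ring.
rewrite (tintD p1 p2) (tintZ _ (perL1Mcos m t (perL1_cos n 0))).
rewrite (tintZ _ (perL1Mcos m t (perL1_cos n (- (pi / 2))))) !tint_coscos//.
case: eqP => _; last by rewrite !mulr0 addr0.
by rewrite sub0r cosN -opprD cosN [pi / 2 + t]addrC cosDpihalf; ring.
Qed.

Lemma tint_fourier_part F a b m t : perL1 F -> (0 < a)%N ->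
  tint (fun x => fourier_part F a b x * cos (m%:R * x + t)) =
  if (a <= m < b)%N then tint (fun y => F y * cos (m%:R * y + t)) else 0.
Proof.
move=> pF a0.
pose h n x := (cos_coef F n * cos (n%:R * x) + sin_coef F n * sin (n%:R * x)) * cos (m%:R * x + t).
have ph n : perL1 (h n) by apply: perL1Mcos; exact: perL1_harm.
rewrite -(eq_tint (F := fun x => pi^-1 * \sum_(a <= n < b) h n x)); last first.
  by move=> x; rewrite /fourier_part -mulrA mulr_suml.
rewrite tintZ; last exact: perL1_sum.
rewrite tint_sum// (tint_cosE _ _ pF).
rewrite (eq_big_nat _ _ (F2 := fun n => if n == m then pi * (cos_coef F m * cos t - sin_coef F m * sin t) else 0)); last first.
  move=> n /andP[an _]; rewrite /h tint_harm_cos ?(leq_trans a0)//.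
  by case: eqP => // ->.
rewrite -big_mkcond/= big_const_seq.
case: ifP => amb.
  rewrite (_ : count _ _ = 1)%N/= ?addr0 ?mulKf ?gt_eqF ?pi_gt0//.
  by have := count_uniq_mem m (iota_uniq a (b - a)); rewrite -/(index_iota a b) mem_index_iota amb.
rewrite (_ : count _ _ = 0)%N/= ?mulr0//.
by have := count_uniq_mem m (iota_uniq a (b - a)); rewrite -/(index_iota a b) mem_index_iota amb.
Qed.

Definition tmean F : R := (2 * pi)^-1 * tint F.

Section Decomposition.
Variables (F : R -> R) (e : nat -> R) (S : R) (k0 : nat).
Hypotheses (pF : perL1 F)
  (Fe : forall k x, (k0 <= k)%N -> `|fourier_part F (2 ^ k) (2 ^ k.+1) x| <= e k)
  (eS : forall K, \sum_(k0 <= k < K) e k <= S).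

Let u k x := fourier_part F (2 ^ (k0 + k)) (2 ^ (k0 + k).+1) x.

Let sum_u K x : \sum_(0 <= k < K) u k x = fourier_part F (2 ^ k0) (2 ^ (k0 + K)) x.
Proof.
elim: K => [|K IH]; first by rewrite big_nil addn0 /fourier_part big_geq// mulr0.
rewrite big_nat_recr//= IH /u -fourier_part_cat ?addnS//; rewrite leq_exp2l//; lia.
Qed.

Let u_le K x : \sum_(0 <= k < K) `|u k x| <= S.
Proof.
apply: le_trans (eS (k0 + K)); rewrite -[X in _ <= \sum_(X <= _ < _) _]add0n big_addn addKn.
by apply: ler_sum => k _; rewrite /u [(k + k0)%N]addnC; apply: Fe; lia.
Qed.

Let summ_u x : summ (u^~ x). Proof. by apply: (summ_bounded (S := S)) => n; exact: u_le. Qed.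

Let H x := ser (u^~ x).

Let H_le x : `|H x| <= S.
Proof.
have := summ_cvg (@summ_u x) => /cvg_norm h1; apply: (cvgr_to_le h1).
by apply: nearW => n; apply: le_trans (u_le n x); exact: ler_norm_sum.
Qed.

Let mH : measurable_fun setT H.
Proof.
apply: (@measurable_fun_cvg _ _ R setT (fun n x => series (u^~ x) n)).
  by move=> n; apply: measurable_sum => i; case: (perL1_fourier_part F (2 ^ (k0 + i)) (2 ^ (k0 + i).+1)).
by move=> x _; exact: summ_cvg.
Qed.

Let pH : perL1 H.
Proof.
apply: (perL1_bounded (M := S)); [exact: mH| |exact: H_le].
move=> x; apply: eq_ser => k.
by case: (perL1_fourier_part F (2 ^ (k0 + k)) (2 ^ (k0 + k).+1)) => _ per _; exact: per.
Qed.

Let tint_H m t : tint (fun x => H x * cos (m%:R * x + t)) =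
  if (2 ^ k0 <= m)%N then tint (fun y => F y * cos (m%:R * y + t)) else 0.
Proof.
have pHm := perL1Mcos m t pH.
pose P n x := fourier_part F (2 ^ k0) (2 ^ (k0 + n)) x * cos (m%:R * x + t).
have pP n : perL1 (P n) by apply/perL1Mcos/perL1_fourier_part.
have c1 : (fun n => tint (P n)) @ \oo --> tint (fun x => H x * cos (m%:R * x + t)).
  have /(_ _ _ _ _)[|||||] := @dominated_convergence _ _ _ mu torus (@measurable_torus R)
    (fun J x => (P J x)%:E) (fun x => (H x * cos (m%:R * x + t))%:E) (cst S%:E).
  - by move=> J; case: (pP J) => mP _ _; apply/measurable_EFinP/measurable_funTS.
  - by case: pHm => mP _ _; apply/measurable_EFinP/measurable_funTS.
  - apply: aeW => x _; apply/cvg_EFin; first exact: nearW.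
    apply: cvgMr_tmp; rewrite (_ : (fun n => _) = series (u^~ x)); first exact: summ_cvg.
    by apply/funext => n; rewrite -sum_u.
  - by case: (perL1_cst S).
  - apply: aeW => x n _; rewrite abse_EFin lee_fin normrM -[leRHS]mulr1 ler_pM//.
      by rewrite -sum_u; apply: le_trans (u_le n x); exact: ler_norm_sum.
    exact: cos_max.
  move=> _ _; rewrite (tintE pHm).
  under eq_fun do rewrite (tintE (pP _)).
  by move=> /fine_cvg.
apply: (cvg_unique _ c1) => //.
apply: cvg_near_cst; near=> n.
rewrite tint_fourier_part ?expn_gt0//.
have nm : (m < 2 ^ (k0 + n))%N.
  by apply: (leq_trans (ltn_expl m (ltnSn 1))); rewrite leq_exp2l//; apply: leq_trans (leq_addl _ _); near: n; exists m.
by rewrite nm andbT.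
Unshelve. all: by end_near. Qed.

(* The dyadic blocks sum uniformly to a bounded function with the Fourier
   coefficients of frequency at least [2 ^ k0] of [F], so that the difference
   below has no Fourier coefficient. *)
Lemma dyadic_decomposition :
  {ae mu, forall x, torus x -> `|F x - tmean F - fourier_part F 1 (2 ^ k0) x| <= S}.
Proof.
pose G x := F x - tmean F - fourier_part F 1 (2 ^ k0) x - H x.
have p1 : perL1 (fun x => F x - tmean F) by apply: perL1B => //; exact: perL1_cst.
have pb := perL1_fourier_part F 1 (2 ^ k0).
have p2 : perL1 (fun x => F x - tmean F - fourier_part F 1 (2 ^ k0) x) by exact: perL1B.
have pG : perL1 G by exact: (perL1B p2 pH).
have aeF : Filter (nbhs (almost_everywhere mu)) by exact: ae_filter_ringOfSetsType.
have e_mean m t : tint (fun x => tmean F * cos (m%:R * x + t)) =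
    if m == 0%N then tint (fun y => F y * cos (m%:R * y + t)) else 0.
  rewrite tintZ; last exact: perL1_cos.
  case: eqP => [->|/eqP m0]; last by rewrite tint_cos0 ?mulr0// lt0n.
  rewrite -(eq_tint (F := cst (cos t))) => [|x]; last by rewrite mul0r add0r.
  have -> : tint (fun y => F y * cos (0%:R * y + t)) = cos t * tint F.
    by rewrite -tintZ//; apply: eq_tint => x; rewrite mul0r add0r mulrC.
  rewrite tint_cst /tmean; have := pi_gt0 R; move: (pi : R) (tint F) (cos t) => P I c P0.
  by field; rewrite gt_eqF.
(* The mean removes frequency 0, the partial sum removes those from 1 to [2 ^ k0 - 1], and [H]
   removes all the others. *)
have G0 m t : tint (fun y => G y * cos (m%:R * y + t)) = 0.
  have q1 := perL1Mcos m t pF.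
  have q2 := perL1Mcos m t (perL1_cst (tmean F)).
  have q3 := perL1Mcos m t pb.
  have q4 := perL1Mcos m t pH.
  rewrite -(eq_tint (F := fun y => F y * cos (m%:R * y + t) - tmean F * cos (m%:R * y + t)
     - fourier_part F 1 (2 ^ k0) y * cos (m%:R * y + t) - H y * cos (m%:R * y + t))); last first.
    by move=> y; rewrite /G; ring.
  rewrite (tintB (perL1B (perL1B q1 q2) q3) q4) (tintB (perL1B q1 q2) q3) (tintB q1 q2).
  rewrite e_mean tint_H tint_fourier_part//.
  have k1 : (0 < 2 ^ k0)%N by rewrite expn_gt0.
  case: (posnP m) => [->|m0]; first by rewrite leqn0 expn_eq0/=; ring.
  case: leqP => _ /=; ring.
have := fourier_unique pG G0; apply: filterS => x /[apply] /eqP.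
by rewrite /G subr_eq0 => /eqP ->.
Qed.

End Decomposition.

(** The exceptional set has an indicator of integral 0 over a period, and this integral does not
    change under translation. A difference evaluates its argument at translates, so a bound almost
    everywhere has to be moved along. *)
Lemma ae_translate F S (a : R) : measurable_fun setT F -> (forall x, F (x + 2 * pi) = F x) ->
  {ae mu, forall x, torus x -> `|F x| <= S} ->
  {ae mu, forall x, torus x -> `|F (x + a)| <= S}.
Proof.
move=> mF pF FS; have mT := @measurable_torus R.
pose B : set R := [set x | S < `|F x|].
have mB : measurable B.
  rewrite -[X in measurable X]setTI (_ : B = (fun x => `|F x|) @^-1` `]S, +oo[%classic).
    by apply: (measurableT_comp (@normr_measurable _ _) mF).
  by apply/seteqP; split => x /=; rewrite /B/= in_itv/= andbT.
have m1 : measurable_fun setT (fun x => (\1_B x : R)%:E) by apply/measurable_EFinP; exact: measurable_indic.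
have p1 x : ((\1_B (x + 2 * pi) : R)%:E = (\1_B x : R)%:E)%E.
  rewrite !indicE; congr ((_ : bool)%:R)%:E; apply/idP/idP => /set_mem h; apply/mem_set.
    by rewrite /B/= -pF.
  by rewrite /B/= pF.
have := ge0_torus_translate a m1 _ p1.
have aeF : Filter (nbhs (almost_everywhere mu)) by exact: ae_filter_ringOfSetsType.
have I0 : (\int[mu]_(x in torus) (\1_B x : R)%:E = 0)%E.
  rewrite (ae_eq_integral (cst 0%E))//; first by rewrite integral0.
    exact: measurable_funTS.
  apply: (filterS _ FS) => x h xT; rewrite indicE (_ : (x \in B) = false)//.
  by apply/negbTE/negP => /set_mem; rewrite /B/= ltNge h.
have b0 x : (0 <= (\1_B x : R)%:E)%E by rewrite lee_fin indicE.
rewrite I0 => /(_ b0) I1.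
have m2 : measurable_fun torus (fun x => (\1_B (x + a) : R)%:E).
  apply/measurable_funTS; exact: (measurable_translate a m1).
have := (ae_eq_integral_abs mu mT m2).1; rewrite /ae_eq.
have -> : (\int[mu]_(x in torus) `|(\1_B (x + a) : R)%:E| = 0)%E.
  by rewrite -I1; apply: eq_integral => x _; rewrite gee0_abs// lee_fin indicE.
move=> /(_ erefl); apply: filterS => x /[apply] /eqP.
rewrite indicE eqe pnatr_eq0 eqb0 => h; rewrite leNgt; apply/negP => h2; move/negP: h; apply.
exact: mem_set.
Qed.

End Harmonics.

Section RdiffSum.
Context {R : realType}.
Implicit Types (s h x t : R) (F G : R -> R) (n m a b : nat).

Lemma rdiffZ s h F x (c : R) : summ (fdt s h F x) ->
  rdiff s h (fun y => c * F y) x = c * rdiff s h F x.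
Proof.
by move=> sF; rewrite /rdiff -serZ//; apply: eq_ser => j; rewrite /fdt mulrCA.
Qed.

Lemma summ_fdtZ s h F x (c : R) : summ (fdt s h F x) -> summ (fdt s h (fun y => c * F y) x).
Proof. by move=> /(summZ (k := c)); under eq_fun do rewrite mulrCA. Qed.

Lemma summ_fdtD s h F G x : summ (fdt s h F x) -> summ (fdt s h G x) ->
  summ (fdt s h (fun y => F y + G y) x).
Proof. by move=> sF sG; rewrite /fdt; under eq_fun do rewrite mulrDr; exact: summD. Qed.

Lemma rdiff_sum s h x (G : nat -> R -> R) (l : seq nat) : (forall j, summ (fdt s h (G j) x)) ->
  summ (fdt s h (fun y => \sum_(j <- l) G j y) x) /\
  rdiff s h (fun y => \sum_(j <- l) G j y) x = \sum_(j <- l) rdiff s h (G j) x.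
Proof.
move=> sG; elim: l => [|i l [IH1 IH2]].
  rewrite /rdiff /fdt; under eq_fun do rewrite big_nil mulr0.
  split; first by apply: (summ_bounded (S := 0)) => n; rewrite big1// => i _; rewrite normr0.
  rewrite big_nil /ser (_ : series _ = cst 0); last by apply/funext => n; rewrite /series/= big1.
  exact: lim_cst.
rewrite big_cons -IH2 -(rdiffD (sG i) IH1).
rewrite (_ : (fun y => \sum_(j <- i :: l) G j y) = (fun y => G i y + \sum_(j <- l) G j y)).
  by split => //; exact: summ_fdtD.
by apply/funext => y; rewrite big_cons.
Qed.

Lemma summ_fdt_cos s h n t x : 0 < s -> summ (fdt s h (fun y => cos (n%:R * y + t)) x).
Proof. by move=> s0; apply: (summ_fdt_bounded (M := 1)) => // j; exact: cos_max. Qed.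

Lemma rdiff_fourier_part s h F a b x : 0 < s -> perL1 F -> (forall n, (n < b)%N -> n%:R * `|h| < 2 * pi) ->
  rdiff s h (fourier_part F a b) x = pi^-1 * \sum_(a <= n < b) fdc s * (2 * sin (n%:R * `|h| / 2)) `^ s *
    tint (fun y => F y * cos (n%:R * y + (- (n%:R * (x + s * h / 2)) - fphase s h))).
Proof.
move=> s0 pF nh.
pose G n y := cos_coef F n * cos (n%:R * y + 0) + sin_coef F n * cos (n%:R * y - pi / 2).
have sc n := summ_fdtZ (c := cos_coef F n) (@summ_fdt_cos s h n 0 x s0).
have ss n := summ_fdtZ (c := sin_coef F n) (@summ_fdt_cos s h n (- (pi / 2)) x s0).
have sG n : summ (fdt s h (G n) x) by exact: summ_fdtD.
have [S1 S2] := rdiff_sum (index_iota a b) sG.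
rewrite (_ : fourier_part F a b = fun y => pi^-1 * \sum_(a <= n < b) G n y); last first.
  apply/funext => y; rewrite /fourier_part; congr (_ * _); apply: eq_bigr => n _.
  by rewrite /G addr0 cosBpihalf.
rewrite (rdiffZ _ S1) S2; congr (_ * _); apply: eq_big_nat => n /andP[_ nb].
rewrite (rdiffD (sc n) (ss n)) !rdiffZ; [|exact: summ_fdt_cos..].
rewrite !rdiff_cos ?nh// (tint_cosE _ _ pF) addr0.
move: (n%:R * (x + s * h / 2)) (fphase s h) => u v.
rewrite (addrAC u) cosBpihalf -opprD cosN sinN; ring.
Qed.

End RdiffSum.

Section Sinc.
Context {R : realType}.
Implicit Types (n k : nat) (al h z w e r : R).

Lemma sinc_ge0 h k n : (forall n, (n < 2 ^ k)%N -> n%:R * `|h| < 2 * pi) -> (n < 2 ^ k)%N ->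
  0 <= sin (n%:R * `|h| / 2).
Proof.
move=> nh /nh h2; apply: sin_ge0_pi; rewrite ?divr_ge0 ?mulr_ge0//.
by rewrite /= ler_pdivrMr// [pi * 2]mulrC ltW.
Qed.

Lemma sinc_factor al e (S : R) n : (0 < n)%N -> 0 <= S ->
  fdc al * (2 * S) `^ al * n%:R `^ (- (al + e)) = n%:R `^ (- e) * (fdc al * (2 * S / n%:R) `^ al).
Proof.
move=> n0 S0; have n1 : (0 : R) < n%:R by rewrite ltr0n.
rewrite (@powRM _ (2 * S) n%:R^-1) ?invr_ge0 ?mulr_ge0// ?ltW//.
rewrite (_ : - (al + e) = - e - al); last by ring.
rewrite powRD ?(gt_eqF n1) ?implybT// powRN.
have -> : (n%:R^-1 : R) `^ al = (n%:R `^ al)^-1 by rewrite -powR_inv1 ?ltW// -powRrM mulN1r powRN.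
by rewrite powRN; ring.
Qed.

(** As long as n |h| / 2 <= pi, the quotient 2 sin (n |h| / 2) / n decreases in n, by [sin_ratio],
    and is at most |h|: it plays the part of [A] in [low_kernel_bound]. *)
Lemma sinc_kernel_bound al h k r (B : nat -> R) (Bm : R) z w : 0 < al -> 0 < r -> r < 1 ->
  (forall n, (n < 2 ^ k)%N -> n%:R * `|h| < 2 * pi) ->
  (forall n, (1 <= n)%N -> (n.+1 < 2 ^ k)%N -> B n <= B n.+1) -> (forall n, 0 <= B n) ->
  (forall n, (1 <= n < 2 ^ k)%N -> B n <= Bm) -> 0 <= Bm ->
  `|\sum_(1 <= n < 2 ^ k) n%:R `^ (r - 1) * (fdc al * (2 * sin (n%:R * `|h| / 2) / n%:R) `^ al) *
    B n * cos (n%:R * z + w)| <= (2 / r + 2) * (fdc al * `|h| `^ al) * Bm * kmin (2 ^+ k) z `^ r.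
Proof.
move=> al0 r0 r1 nh incB B0 BBm Bm0.
have k1 : (0 < 2 ^ k)%N by rewrite expn_gt0.
have fdc0 := ltW (fdc_gt0 al0).
have nz n : (1 <= n)%N -> (n%:R : R) > 0 by move=> n1; rewrite ltr0n.
have s0 n := @sinc_ge0 h k n nh.
rewrite -natrX.
apply: (low_kernel_bound (A := fun n => fdc al * (2 * sin (n%:R * `|h| / 2) / n%:R) `^ al)) => //.
- move=> n n1 n2; rewrite ler_wpM2l//.
  have n0 := nz n n1; have n0' := nz n.+1 isT.
  have sn := s0 n (ltn_trans (ltnSn n) n2); have sn' := s0 _ n2.
  apply: ge0_ler_powR; rewrite ?nnegrE ?divr_ge0 ?mulr_ge0//; first exact: ltW.
  have : n%:R * sin (n.+1%:R * `|h| / 2) <= n.+1%:R * sin (n%:R * `|h| / 2).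
    have [->|h0] := eqVneq h 0; first by rewrite normr0 !mulr0 !mul0r sin0 !mulr0.
    have h1 : 0 < `|h| by rewrite normr_gt0.
    have h2 : 0 < `|h| / 2 by rewrite divr_gt0.
    have h3 := nh _ n2.
    have : n%:R * `|h| / 2 * sin (n.+1%:R * `|h| / 2) <= n.+1%:R * `|h| / 2 * sin (n%:R * `|h| / 2).
      apply: sin_ratio; first by rewrite -mulrA mulr_gt0.
        by rewrite -!mulrA ler_pM2r// ler_nat.
      by rewrite ler_pdivrMr// [pi * 2]mulrC ltW.
    move: (sin _) (sin (n%:R * _ / _)) => S S'.
    by rewrite -!mulrA [n%:R * _]mulrA [n.+1%:R * _]mulrA mulrAC [X in _ <= X -> _]mulrAC; nra.
  move: (sin _) (sin (_ * _ / _)) => S S' SS.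
  by rewrite ler_pdivrMr// mulrAC ler_pdivlMr// -!mulrA ler_pM2l// mulrC [S * _]mulrC.
- by move=> n; rewrite mulr_ge0 ?powR_ge0.
- move=> n /andP[n1 n2]; have n0 := nz n n1; rewrite ler_wpM2l//.
  apply: ge0_ler_powR; rewrite ?nnegrE ?divr_ge0 ?mulr_ge0 ?s0//; first exact: ltW.
  rewrite ler_pdivrMr//.
  have := @sin_lip R 0 (n%:R * `|h| / 2).
  rewrite sin0 !subr0 (ger0_norm (s0 _ n2)) [X in _ <= X -> _]ger0_norm ?divr_ge0 ?mulr_ge0//.
  by rewrite [`|h| * _]mulrC -ler_pdivlMl// [2^-1 * _]mulrC.
- by rewrite mulr_ge0 ?powR_ge0.
Qed.

End Sinc.

(** * Convolution with the kernels *)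

Section Bounds.
Context {R : realType}.
Local Notation mu := (@lebesgue_measure R).
Implicit Types (n a b : nat) (v w x t h : R).
Variables (p q : R) (F D : R -> R) (E tau sg : R) (A B : nat -> R) (Bm : R).
Hypotheses (p1 : 1 < p) (q1 : 1 < q) (pq : p^-1 + q^-1 = 1) (pF : perL1 F) (pD : perL1 D)
  (DE : (NT p D <= E%:E)%E).

(* [F] is obtained from [D] by a Fourier multiplier [A n * B n], with [A]
   decreasing and [B] increasing in the applications, up to a translation by
   [tau] and a phase shift [sg]: [D] is a fractional derivative or difference of
   [F]. *)
Definition freq_rel n := forall t, tint (fun y => F y * cos (n%:R * y + (t - n%:R * tau - sg))) =
  A n * B n * tint (fun y => D y * cos (n%:R * y + t)).

(** Hoelder's inequality, the [q]-th power of the kernel being dominated by [kmaj] with exponent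
    [e * q], centred at [v]. *)
Lemma conv_bound (K : R -> R) (c e : R) k v : measurable_fun setT K -> 0 <= c -> 0 < e ->
  (forall z, `|K z| <= c * kmin (2 ^+ k) z `^ e) ->
  `|tint (fun y => D y * K (y - v))| <= E * (c * kint k (e * q) `^ q^-1).
Proof.
move=> mK c0 e0 Kc; have q0 : 0 < q := lt_trans ltr01 q1.
have eq0 : 0 < e * q by exact: mulr_gt0.
have mKv : measurable_fun setT (fun y : R => K (y - v)) by exact: measurable_translate mK.
apply: (hoelder_tint _ _ pq) => //; [exact: lt_trans ltr01 p1|by case: pD|].
rewrite -[c](powRr1 c0) -(mulfV (lt0r_neq0 q0)) powRrM -powRM ?powR_ge0 ?kint_ge0//.
apply: (@NT_le _ q _ (fun y => c `^ q * kmaj k (e * q) v y)) => //.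
- by apply: perL1Z; exact: perL1_kmaj.
- move=> y _; apply: le_trans (_ : (c * kmin (2 ^+ k) (y - v) `^ e) `^ q <= _).
    by apply: ge0_ler_powR => //; rewrite ?nnegrE ?mulr_ge0 ?powR_ge0// ltW.
  rewrite powRM ?powR_ge0// -powRrM ler_wpM2l ?powR_ge0//.
  exact: kmin_dyadic.
- rewrite tintZ; last exact: perL1_kmaj.
  by rewrite ler_wpM2l ?powR_ge0// tint_kmaj.
Qed.

(** Matching the phases in [freq_rel] moves the centre of the kernel to [v - tau] and adds [sg] to
    its phase, so neither affects the size of the kernel. *)
Lemma sum_conv (c : nat -> R) a b v w : (forall n, (a <= n < b)%N -> freq_rel n) ->
  \sum_(a <= n < b) c n * tint (fun y => F y * cos (n%:R * y + (- (n%:R * v) + w))) =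
  tint (fun y => D y * \sum_(a <= n < b) c n * (A n * B n) * cos (n%:R * (y - (v - tau)) + (sg + w))).
Proof.
move=> rel.
have pc n z : perL1 (fun y => D y * cos (n%:R * y + z)) by exact: perL1Mcos.
transitivity (tint (fun y => \sum_(a <= n < b) c n * (A n * B n) *
    (D y * cos (n%:R * y + (- (n%:R * (v - tau)) + (sg + w)))))).
  rewrite tint_sum => [|n]; last by apply: perL1Z.
  apply: eq_big_nat => n nab; rewrite tintZ// -mulrA -(rel n nab); congr (_ * tint _).
  by apply/funext => y; congr (_ * cos (_ + _)); ring.
apply: eq_tint => y; rewrite mulr_sumr; apply: eq_bigr => n _.
rewrite mulrCA; congr (_ * (_ * cos _)); ring.
Qed.

Let measurable_kernel (c : nat -> R) a b w :
  measurable_fun setT (fun z : R => \sum_(a <= n < b) c n * cos (n%:R * z + w)).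
Proof.
apply: measurable_sum => n; apply: measurable_funM => //; exact: measurable_cosl.
Qed.

Lemma fourier_block_bound k x :
  (forall n, (2 ^ k <= n < 2 ^ k.+1)%N -> freq_rel n) ->
  (forall n, (2 ^ k <= n)%N -> (n.+1 < 2 ^ k.+1)%N -> A n.+1 <= A n) -> (forall n, 0 <= A n) ->
  (forall n, (2 ^ k <= n)%N -> (n.+1 < 2 ^ k.+1)%N -> B n <= B n.+1) -> (forall n, 0 <= B n) ->
  (forall n, (2 ^ k <= n < 2 ^ k.+1)%N -> B n <= Bm) ->
  `|fourier_part F (2 ^ k) (2 ^ k.+1) x| <= pi^-1 * (E * (2 * A (2 ^ k)%N * Bm * kint k q `^ q^-1)).
Proof.
move=> rel decA A0 incB B0 BBm.
have k2 : (2 ^ k < 2 ^ k.+1)%N by rewrite ltn_exp2l.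
have Bm0 : 0 <= Bm by apply: le_trans (B0 (2 ^ k)%N) (BBm _ _); rewrite leqnn.
rewrite /fourier_part normrM ger0_norm ?invr_ge0 ?pi_ge0// ler_wpM2l ?invr_ge0 ?pi_ge0//.
have -> : \sum_(2 ^ k <= n < 2 ^ k.+1) (cos_coef F n * cos (n%:R * x) + sin_coef F n * sin (n%:R * x)) =
  \sum_(2 ^ k <= n < 2 ^ k.+1) 1 * tint (fun y => F y * cos (n%:R * y + (- (n%:R * x) + 0))).
  by apply: eq_bigr => n _; rewrite (tint_cosE _ _ pF) addr0 cosN sinN; ring.
rewrite (sum_conv _ _ _ rel) -[X in kint k X]mul1r.
apply: (@conv_bound (fun z => \sum_(2 ^ k <= n < 2 ^ k.+1) 1 * (A n * B n) * cos (n%:R * z + (sg + 0)))) => //.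
- by rewrite !mulr_ge0.
move=> z; rewrite powRr1; last by apply/ltW/kmin_gt0; rewrite exprn_gt0.
under eq_bigr do rewrite mul1r.
apply: block_kernel_bound => //.
by rewrite expnS mul2n -addnn addnK natrX.
Qed.

(* The difference of order [al] contributes the factor [(2 sin (n h / 2)) ^ al],
   which is [n ^ al] times a decreasing sequence: the kernel behaves like the sum
   of [n ^ (1 / q - 1) cos (n z)], whose L_q norm is of order [k ^ (1 / q)]. *)
Lemma rdiff_low_bound (al : R) h k x : 0 < al ->
  (forall n, (1 <= n < 2 ^ k)%N -> freq_rel n) ->
  (forall n, (n < 2 ^ k)%N -> n%:R * `|h| < 2 * pi) ->
  (forall n, A n = n%:R `^ (- (al + p^-1))) ->
  (forall n, (1 <= n)%N -> (n.+1 < 2 ^ k)%N -> B n <= B n.+1) -> (forall n, 0 <= B n) ->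
  (forall n, (1 <= n < 2 ^ k)%N -> B n <= Bm) -> 0 <= Bm ->
  `|rdiff al h (fourier_part F 1 (2 ^ k)) x| <=
    pi^-1 * (E * ((2 * q + 2) * (fdc al * `|h| `^ al) * Bm * (4 * pi * k.+1%:R) `^ q^-1)).
Proof.
move=> al0 rel nh AE incB B0 BBm Bm0.
have q0 : 0 < q := lt_trans ltr01 q1.
have qi : 0 < q^-1 < 1 by rewrite invr_gt0 q0 invf_lt1.
have [qi0 qi1] := andP qi.
have fdc0 := ltW (fdc_gt0 al0).
rewrite (rdiff_fourier_part _ _ al0 pF nh).
rewrite normrM ger0_norm ?invr_ge0 ?pi_ge0// ler_wpM2l ?invr_ge0 ?pi_ge0//.
rewrite (@sum_conv (fun n => fdc al * (2 * sin (n%:R * `|h| / 2)) `^ al) _ _ _ _ rel).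
rewrite -kint1 -[X in kint k X](mulVf (lt0r_neq0 q0)).
apply: (@conv_bound (fun z => \sum_(1 <= n < 2 ^ k) (fdc al * (2 * sin (n%:R * `|h| / 2)) `^ al) * (A n * B n) * cos (n%:R * z + (sg + - fphase al h)))) => //.
- have q2 : 0 <= 2 * q + 2 by rewrite addr_ge0// mulr_ge0// ltW.
  by do 3!(apply: mulr_ge0 => //); exact: powR_ge0.
move=> z.
rewrite (eq_big_nat _ _ (F2 := fun n => n%:R `^ (q^-1 - 1) *
   (fdc al * (2 * sin (n%:R * `|h| / 2) / n%:R) `^ al) * B n * cos (n%:R * z + (sg + - fphase al h)))); last first.
  move=> n /andP[n0 nk]; rewrite AE mulrA (sinc_factor _ _ n0 (sinc_ge0 nh nk)).
  by rewrite (_ : - p^-1 = q^-1 - 1)// -pq; ring.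
have {2}-> : q = 1 / q^-1 by rewrite div1r invrK.
rewrite (_ : 2 * (1 / q^-1) = 2 / q^-1); last by rewrite mulrA mulr1.
exact: sinc_kernel_bound.
Qed.

End Bounds.

(** * Bounds on the modulus of smoothness *)

Section ModulusBounds.
Context {R : realType}.
Local Notation mu := (@lebesgue_measure R).
Local Notation torus := (@torus R).
Local Notation Re := (@complex.Re R).
Local Notation Im := (@complex.Im R).
Implicit Types (s h x t u al : R) (F G : R -> R) (f g : R -> R[i]) (n m a b k : nat).

Lemma normc_le (z : R[i]) : Normc.normc z <= `|Re z| + `|Im z|.
Proof.
case: z => u v /=; rewrite -(ler_pXn2r (ltn0Sn 1)) ?nnegrE ?sqrtr_ge0 ?addr_ge0//.
rewrite sqr_sqrtr ?addr_ge0 ?sqr_ge0// sqrrD !real_normK ?num_real//.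
by rewrite lerD2r lerDl mulrn_wge0// mulr_ge0.
Qed.

Lemma Re_le_normc (z : R[i]) : `|Re z| <= Normc.normc z.
Proof.
by case: z => u v /=; rewrite -sqrtr_sqr ler_wsqrtr// lerDl sqr_ge0.
Qed.

Lemma Im_le_normc (z : R[i]) : `|Im z| <= Normc.normc z.
Proof.
by case: z => u v /=; rewrite -sqrtr_sqr ler_wsqrtr// lerDr sqr_ge0.
Qed.

Lemma normT_infty_le f (M : R) : 0 <= M ->
  {ae mu, forall x, torus x -> `|Re (f x)| <= M} ->
  {ae mu, forall x, torus x -> `|Im (f x)| <= M} -> (normT +oo f <= (2 * M)%:E)%E.
Proof.
move=> M0 hr hi; have aeF : Filter (nbhs (almost_everywhere mu)) by exact: ae_filter_ringOfSetsType.
apply: ess_sup_torus; first by rewrite mulr_ge0.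
apply: (filterS2 _ _ hr hi) => x h1 h2 xT; rewrite ger0_norm; last first.
  by apply: le_trans (normr_ge0 _) (Re_le_normc _).
apply: le_trans (normc_le _) _; rewrite mulr2n mulrDl mul1r lerD//; [exact: h1|exact: h2].
Qed.

Lemma modulus_infty_le al t (M : R) f : 0 <= M ->
  (forall h, `|h| <= t -> {ae mu, forall x, torus x -> `|rdiff al h (Re \o f) x| <= M}) ->
  (forall h, `|h| <= t -> {ae mu, forall x, torus x -> `|rdiff al h (Im \o f) x| <= M}) ->
  (modulus al +oo f t <= (2 * M)%:E)%E.
Proof.
move=> M0 hr hi; apply: ge_ereal_sup => _ [h /= ht <-].
by apply: normT_infty_le => //; [exact: hr|exact: hi].
Qed.

Lemma modulus_mono s p f u v : u <= v -> (modulus s p f u <= modulus s p f v)%E.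
Proof.
move=> uv; apply: le_ereal_sup => _ [h /= hu <-]; exists h => //=; exact: le_trans hu uv.
Qed.

Lemma modulus_ge s p f u h : `|h| <= u -> (normT p (fracdiff s h f) <= modulus s p f u)%E.
Proof. by move=> hu; apply: ereal_sup_ubound; exists h. Qed.

Lemma normT_ge0 p f : (0 <= normT p f)%E.
Proof. exact: Lnorm_ge0. Qed.

Lemma modulus_ge0 s p f u : 0 <= u -> (0 <= modulus s p f u)%E.
Proof.
move=> u0; apply: le_trans (normT_ge0 _ _) (@modulus_ge s p f u 0 _).
by rewrite normr0.
Qed.

Lemma NT_Re_le (p : R) f : 0 < p -> (NT p (Re \o f) <= normT p%:E f)%E.
Proof.
move=> p0; rewrite normTE; apply: NT_mono => // x _; rewrite (le_trans (Re_le_normc _))//.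
exact: ler_norm.
Qed.

Lemma NT_Im_le (p : R) f : 0 < p -> (NT p (Im \o f) <= normT p%:E f)%E.
Proof.
move=> p0; rewrite normTE; apply: NT_mono => // x _; rewrite (le_trans (Im_le_normc _))//.
exact: ler_norm.
Qed.

Lemma perL1_NT (p : R) F : 1 <= p -> measurable_fun setT F -> (forall x, F (x + 2 * pi) = F x) ->
  (NT p F < +oo)%E -> perL1 F.
Proof.
move=> p1 mF pF; have p0 : 0 < p := lt_le_trans ltr01 p1.
rewrite (NTE _ (lt0r_neq0 p0)) => NF; split => //.
have mT := @measurable_torus R.
have m2 : measurable_fun torus (fun x => (`|F x| `^ p)%:E).
  apply/measurable_EFinP; apply: measurableT_comp (measurable_powR _) _.
  by apply: measurableT_comp => //; exact: measurable_funTS.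
have I2 : mu.-integrable torus (fun x => (`|F x| `^ p)%:E).
  apply/integrableP; split => //.
  under eq_integral do rewrite gee0_abs ?lee_fin ?powR_ge0//.
  by apply: lty_poweRy NF; rewrite invr_neq0// lt0r_neq0.
have I1 : mu.-integrable torus (EFin \o cst (1 : R)) by case: (perL1_cst (1 : R)).
apply: (le_integrable _ _ _ (@integrableD _ _ _ mu torus mT _ _ I1 I2)) => //.
  by apply/measurable_EFinP; exact: measurable_funTS.
move=> x _ /=; rewrite !lee_fin [leRHS]ger0_norm ?addr_ge0 ?powR_ge0//.
have [F1|F1] := leP `|F x| 1; first by rewrite (le_trans F1)// lerDl powR_ge0.
apply: (@le_trans _ _ (`|F x| `^ p)); last by rewrite lerDr.
by rewrite -[leLHS]powRr1// ler_powR// ltW.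
Qed.

Lemma LpT_perL1 (p : R) f : 1 <= p -> LpT p%:E f -> perL1 (Re \o f) /\ perL1 (Im \o f).
Proof.
move=> p1 [pf [mr mi] nf]; have p0 : 0 < p := lt_le_trans ltr01 p1.
by split; apply: (perL1_NT p1) => //; [move=> x; rewrite /= pf|exact: le_lt_trans (NT_Re_le _ p0) nf
  |move=> x; rewrite /= pf|exact: le_lt_trans (NT_Im_le _ p0) nf].
Qed.

Lemma summ_fdt_fourier_part s h F a b x : 0 < s -> summ (fdt s h (fourier_part F a b) x).
Proof.
move=> s0; pose M := pi^-1 * \sum_(a <= n < b) (`|cos_coef F n| + `|sin_coef F n|).
apply: (summ_fdt_bounded (M := M)) => // j.
rewrite /fourier_part normrM ger0_norm ?invr_ge0 ?pi_ge0// ler_wpM2l ?invr_ge0 ?pi_ge0//.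
apply: le_trans (ler_norm_sum _ _ _) _; apply: ler_sum => n _.
apply: le_trans (ler_normD _ _) _; rewrite !normrM lerD// -[leRHS]mulr1 ler_wpM2l//.
  exact: cos_max.
exact: sin_max.
Qed.

(** The difference kills the mean, the low frequencies satisfy a pointwise bound, and the remainder
    is bounded at all the points [x + (al - j) * h] simultaneously for almost every [x], since they
    are countably many. *)
Lemma rdiff_ae al h F (S L : R) k0 : 0 < al -> perL1 F ->
  {ae mu, forall x, torus x -> `|F x - tmean F - fourier_part F 1 (2 ^ k0) x| <= S} ->
  (forall x, `|rdiff al h (fourier_part F 1 (2 ^ k0)) x| <= L) ->
  {ae mu, forall x, torus x -> `|rdiff al h F x| <= S * bcn al + L}.
Proof.
move=> al0 pF hS hL.
have aeF : Filter (nbhs (almost_everywhere mu)) by exact: ae_filter_ringOfSetsType.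
pose G x := F x - tmean F - fourier_part F 1 (2 ^ k0) x.
have [mG pG _] : perL1 G.
  by apply: perL1B (perL1_fourier_part _ _ _); apply: perL1B => //; exact: perL1_cst.
have /ae_foralln : forall j : nat, {ae mu, forall x, torus x -> `|G (x + (al - j%:R) * h)| <= S}.
  by move=> j; exact: (ae_translate _ mG pG hS).
apply: filterS => x hx xT.
have sG : summ (fdt al h G x) by apply: (summ_fdt_bounded (M := S)) => // j; exact: hx.
have sm : summ (fdt al h (cst (tmean F)) x) by apply: (summ_fdt_bounded (M := `|tmean F|)).
have sb := @summ_fdt_fourier_part al h F 1 (2 ^ k0) x al0.
have -> : F = (fun y => (G y + fourier_part F 1 (2 ^ k0) y) + cst (tmean F) y).
  by apply/funext => y; rewrite /G/=; ring.
rewrite rdiffD//; last exact: summ_fdtD.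
rewrite rdiffD// rdiff_cst// addr0; apply: le_trans (ler_normD _ _) _.
by apply: lerD (hL x); apply: rdiff_bounded => // j; exact: hx.
Qed.

(** The exponent is (q - 1) / q = 1 / p: a block costs a factor 2^(k/p), which turns the amplitude
    2^(-k (al + 1/p)) into the summable 2^(-k al). *)
Lemma kint_root (q p : R) k : 1 < q -> p^-1 + q^-1 = 1 ->
  kint k q `^ q^-1 <=
  (4 * pi * (2 `^ (q - 1) / (2 `^ (q - 1) - 1))) `^ q^-1 * (2 ^+ k) `^ p^-1.
Proof.
move=> q1 pq; have q0 : 0 < q := lt_trans ltr01 q1.
have c0 : 0 <= 4 * pi * (2 `^ (q - 1) / (2 `^ (q - 1) - 1)) :> R.
  rewrite !mulr_ge0 ?pi_ge0 ?powR_ge0// invr_ge0 subr_ge0.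
  by rewrite -[leLHS](powRr0 2) ler_powR ?ler1n// subr_ge0 ltW.
have -> : p^-1 = (q - 1) * q^-1.
  by rewrite mulrBl mul1r mulfV ?lt0r_neq0// -[X in X - _]pq addrK.
rewrite powRrM -powRM ?powR_ge0//.
apply: ge0_ler_powR; rewrite ?nnegrE ?kint_ge0 ?(mulr_ge0 c0) ?powR_ge0//.
  by rewrite invr_ge0 ltW.
exact: kint_gt1.
Qed.

Lemma one_le_lnV t : 0 < t < 1 -> 1 <= 1 - ln t.
Proof. by move=> /andP[t0 t1]; rewrite lerDl oppr_ge0 ltW// ln_lt0// t0. Qed.

Lemma ln2_gt0 : 0 < ln 2 :> R.
Proof. by apply: ln_gt0; rewrite ltr1n. Qed.

(** The constant 4 leaves room for both splittings, at [t] and at t (1 - ln t)^(b / al). *)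
Lemma dyadic_log t k : 0 < t < 1 -> t * 2 ^+ k <= 4 -> k.+1%:R <= (3 + (ln 2)^-1) * (1 - ln t).
Proof.
move=> t01 tk; have t1 := one_le_lnV t01; have /andP[t0 _] := t01.
have l2 := ln2_gt0.
have h : k%:R * ln 2 <= 2 * ln 2 - ln t.
  have : ln (t * 2 ^+ k) <= ln (4 : R) by rewrite ler_ln ?posrE ?mulr_gt0 ?exprn_gt0.
  have -> : (4 : R) = 2 ^+ 2 by rewrite -natrX.
  rewrite lnM ?posrE ?exprn_gt0// lnXn// lnXn// -[ln 2 *+ k]mulr_natl -[ln 2 *+ 2]mulr_natl.
  by move: (k%:R * ln 2) (2 * ln 2) (ln t) => u v w; lra.
have h2 : k%:R <= 2 + (ln 2)^-1 * (1 - ln t).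
  rewrite -(ler_pM2r l2) mulrDl mulrAC mulVf ?lt0r_neq0// mul1r.
  by apply: le_trans h _; rewrite lerD2l lerDr.
rewrite -natr1; have : 0 < (ln 2 : R)^-1 by rewrite invr_gt0.
by move: (ln 2)^-1 (ln t) (k%:R) t1 h2 => u v w; nra.
Qed.

End ModulusBounds.

(** * Sobolev functions *)

Section FourierRelation.
Context {R : realType}.
Local Notation mu := (@lebesgue_measure R).
Local Notation torus := (@torus R).
Local Notation Re := (@complex.Re R).
Local Notation Im := (@complex.Im R).
Implicit Types (s : R) (f g : R -> R[i]) (n : nat).

Let RM c (z : R[i]) : Re (Complex c 0 * z) = c * Re z.
Proof. by case: z => u v /=; rewrite mul0r subr0. Qed.

Let IM c (z : R[i]) : Im (Complex c 0 * z) = c * Im z.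
Proof. by case: z => u v /=; rewrite mul0r addr0. Qed.

Lemma fourierE f n : perL1 (Re \o f) -> perL1 (Im \o f) ->
  fourier f n%:Z = Complex ((2 * pi)^-1 * (cos_coef (Re \o f) n + sin_coef (Im \o f) n))
                           ((2 * pi)^-1 * (cos_coef (Im \o f) n - sin_coef (Re \o f) n)).
Proof.
move=> pr pi'; rewrite /fourier.
have [r1 r2] := (perL1Mcosn n pr, perL1Msinn n pr).
have [i1 i2] := (perL1Mcosn n pi', perL1Msinn n pi').
rewrite /cos_coef /sin_coef -(tintD r1 i2) -(tintB i1 r2).
apply/eqP; rewrite eq_complex RM IM /=; apply/andP; split; apply/eqP; congr (_ * _).
  apply: eq_tint => x; rewrite /expi /=; case: (f x) => u v /=.
  by rewrite cosN sinN mulrN opprK.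
by apply: eq_tint => x; rewrite /expi /=; case: (f x) => u v /=; rewrite cosN sinN; ring.
Qed.

Lemma fourierNE f n : perL1 (Re \o f) -> perL1 (Im \o f) ->
  fourier f (- n%:Z) = Complex ((2 * pi)^-1 * (cos_coef (Re \o f) n - sin_coef (Im \o f) n))
                           ((2 * pi)^-1 * (cos_coef (Im \o f) n + sin_coef (Re \o f) n)).
Proof.
move=> pr pi'; rewrite /fourier.
have [r1 r2] := (perL1Mcosn n pr, perL1Msinn n pr).
have [i1 i2] := (perL1Mcosn n pi', perL1Msinn n pi').
rewrite /cos_coef /sin_coef -(tintB r1 i2) -(tintD i1 r2).
apply/eqP; rewrite eq_complex RM IM /=; apply/andP; split; apply/eqP; congr (_ * _).
  by apply: eq_tint => x; rewrite /expi mulrNz mulNr opprK /=; case: (f x) => u v /=.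
apply: eq_tint => x; rewrite /expi mulrNz mulNr opprK /=; case: (f x) => u v /=.
by rewrite addrC.
Qed.

Lemma ipow_pos s n : (0 < n)%N -> ipow (n%:~R * 1) s =
  Complex (n%:R `^ s * cos (s * pi / 2)) (n%:R `^ s * sin (s * pi / 2)) :> R[i].
Proof.
move=> n0; have n1 : (0 : R) < n%:R by rewrite ltr0n.
apply/eqP; rewrite /ipow eq_complex RM IM /expi /= mulr1 gtr0_sg// ger0_norm ?ltW// mulr1 mulrA.
by rewrite !eqxx.
Qed.

Lemma ipow_neg s n : (0 < n)%N -> ipow ((- n%:Z)%:~R * 1) s =
  Complex (n%:R `^ s * cos (s * pi / 2)) (- (n%:R `^ s * sin (s * pi / 2))) :> R[i].
Proof.
move=> n0; have n1 : (0 : R) < n%:R by rewrite ltr0n.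
apply/eqP; rewrite /ipow eq_complex RM IM /expi /= mulr1 mulrNz ltr0_sg ?oppr_lt0// normrN ger0_norm ?ltW//.
by rewrite mulrN1 mulrA cosN sinN mulrN !eqxx.
Qed.

(** The coefficients at [n] and [-n] together determine the cosine and sine coefficients of both
    parts. Since the multipliers at [n] and [-n] are conjugate, the derivative acts on real and
    imaginary parts separately. *)
Lemma fracderiv_freq s f g n : (0 < n)%N ->
  perL1 (Re \o f) -> perL1 (Im \o f) -> perL1 (Re \o g) -> perL1 (Im \o g) ->
  is_fracderiv s 1 f g ->
  freq_rel (Re \o f) (Re \o g) 0 (s * pi / 2) (fun n => n%:R `^ (- s)) (cst 1) n /\
  freq_rel (Im \o f) (Im \o g) 0 (s * pi / 2) (fun n => n%:R `^ (- s)) (cst 1) n.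
Proof.
move=> n0 rf if_ rg ig [_ fg].
have n1 : (0 : R) < n%:R by rewrite ltr0n.
have := fg n%:Z; rewrite (fourierE _ rg ig) (fourierE _ rf if_) ipow_pos//.
have := fg (- n%:Z); rewrite (fourierNE _ rg ig) (fourierNE _ rf if_) ipow_neg//.
have P0 : (2 * pi : R)^-1 != 0 by rewrite invr_neq0// mulf_neq0// gt_eqF// pi_gt0.
move: P0; move: (2 * pi : R)^-1 => P P0.
rewrite /freq_rel.
have E F t : perL1 F -> tint (fun y => F y * cos (n%:R * y + (t - n%:R * 0 - s * pi / 2))) =
    cos_coef F n * (cos t * cos (s * pi / 2) + sin t * sin (s * pi / 2)) -
    sin_coef F n * (sin t * cos (s * pi / 2) - cos t * sin (s * pi / 2)).
  by move=> pF; rewrite mulr0 subr0 (tint_cosE _ _ pF) cosB sinB.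
have NN : n%:R `^ (- s) * n%:R `^ s = 1 :> R by rewrite powRN mulVf// gt_eqF// powR_gt0.
move: NN; move: (n%:R `^ (- s)) (n%:R `^ s) => M N NN.
move: (cos (s * pi / 2)) (sin (s * pi / 2)) E => c si E.
move=> /eqP; rewrite eq_complex /= => /andP[/eqP e1 /eqP e2].
move=> /eqP; rewrite eq_complex /= => /andP[/eqP e3 /eqP e4].
have K (u v : R) : P * u = P * v -> u = v by apply: mulfI.
split=> t; rewrite E// /= mulr1.
- rewrite (tint_cosE _ _ rg); have Ea : cos_coef (Re \o g) n = N * (c * cos_coef (Re \o f) n + si * sin_coef (Re \o f) n).
    apply: K; lra.
  have Eb : sin_coef (Re \o g) n = N * (c * sin_coef (Re \o f) n - si * cos_coef (Re \o f) n).
    apply: K; lra.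
  rewrite Ea Eb; transitivity (M * N * (cos_coef (Re \o f) n * (cos t * c + sin t * si) -
    sin_coef (Re \o f) n * (sin t * c - cos t * si))); last by ring.
  by rewrite NN mul1r.
- rewrite (tint_cosE _ _ ig); have Ea : cos_coef (Im \o g) n = N * (c * cos_coef (Im \o f) n + si * sin_coef (Im \o f) n).
    apply: K; lra.
  have Eb : sin_coef (Im \o g) n = N * (c * sin_coef (Im \o f) n - si * cos_coef (Im \o f) n).
    apply: K; lra.
  rewrite Ea Eb; transitivity (M * N * (cos_coef (Im \o f) n * (cos t * c + sin t * si) -
    sin_coef (Im \o f) n * (sin t * c - cos t * si))); last by ring.
  by rewrite NN mul1r.
Qed.

End FourierRelation.

Section SobolevBound.
Context {R : realType}.
Local Notation mu := (@lebesgue_measure R).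
Local Notation torus := (@torus R).
Local Notation Re := (@complex.Re R).
Local Notation Im := (@complex.Im R).
Implicit Types (f g : R -> R[i]) (n k : nat) (t x h : R).

Lemma powR_ge1 (x r : R) : 1 <= x -> 0 <= r -> 1 <= x `^ r.
Proof. by move=> x1 r0; rewrite -[leLHS](powRr0 x) ler_powR. Qed.

Lemma powR_gt1 (x r : R) : 1 < x -> 0 < r -> 1 < x `^ r.
Proof.
move=> x1 r0; have -> : 1 = 1 `^ r :> R by rewrite powR1.
by apply: gt0_ltr_powR; rewrite ?nnegrE// ltW// (lt_trans ltr01).
Qed.

Lemma geometric_tail_le (r : R) k0 K : 0 <= r < 1 ->
  \sum_(k0 <= k < K) r ^+ k <= r ^+ k0 / (1 - r).
Proof.
move=> /andP[r0 r1]; have d0 : 0 < 1 - r by rewrite subr_gt0.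
have [Kk|/ltnW kK] := leqP K k0; first by rewrite big_geq// divr_ge0 ?exprn_ge0// ltW.
rewrite ler_pdivlMr// -(subnKC kK); apply: (@le_trans _ _ (r ^+ k0 - r ^+ (k0 + (K - k0)))); last first.
  by rewrite lerBlDr lerDl exprn_ge0.
elim: (K - k0)%N => [|m IH]; first by rewrite addn0 big_geq// mul0r subrr.
rewrite addnS big_nat_recr ?leq_addr//= mulrDl; apply: le_trans (lerD IH (lexx _)) _.
by rewrite exprS; move: (r ^+ k0) (r ^+ (k0 + m)) => u v; lra.
Qed.

Lemma exists_dyadic t : 0 < t < 1 -> exists k0 : nat,
  [/\ (0 < k0)%N, 2^-1 ^+ k0 <= t & t * 2 ^+ k0 <= 2].
Proof.
move=> /andP[t0 t1].
have ex : exists k, 2^-1 ^+ k <= t.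
  have : (fun k => (2^-1 : R) ^+ k) @ \oo --> (0 : R) by apply: cvg_expr; rewrite ger0_norm// invf_lt1// ltr1n.
  move=> /cvgrPdist_le/(_ _ t0) [k _ /(_ k (leqnn k))].
  by rewrite sub0r normrN ger0_norm ?exprn_ge0// => h; exists k.
exists (ex_minn ex); case: ex_minnP => k hk kmin.
have k0 : (0 < k)%N by rewrite lt0n; apply/eqP => k0; move: hk; rewrite k0 expr0 leNgt t1.
split => //; case: k k0 hk kmin => // k _ _ kmin.
have : t < 2^-1 ^+ k by rewrite ltNge; apply/negP => /kmin; rewrite ltnn.
rewrite exprVn => h; rewrite exprS mulrCA -[leRHS]mulr1 ler_pM2l//.
by rewrite -ler_pdivlMr ?exprn_gt0// div1r ltW.
Qed.

Variables (al p q : R).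
Hypotheses (al0 : 0 < al) (p1 : 1 < p) (q1 : 1 < q) (pq : p^-1 + q^-1 = 1).
Let s := al + p^-1.
Let cq := (4 * pi * (2 `^ (q - 1) / (2 `^ (q - 1) - 1))) `^ q^-1.
Let r := (2 : R) `^ (- al).

Let r01 : 0 < r < 1.
Proof.
rewrite /r powR_gt0//= powRN invf_lt1 ?powR_gt0//.
by apply: powR_gt1; rewrite ?ltr1n.
Qed.

Section Part.
Variables (F D : R -> R) (E : R).
Hypotheses (pF : perL1 F) (pD : perL1 D) (DE : (NT p D <= E%:E)%E)
  (rel : forall n, (0 < n)%N -> freq_rel F D 0 (s * pi / 2) (fun n => n%:R `^ (- s)) (cst 1) n).

Let E0 : 0 <= E.
Proof. by rewrite -lee_fin; apply: le_trans DE; exact: NT_ge0. Qed.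

Let blk_le k x : `|fourier_part F (2 ^ k) (2 ^ k.+1) x| <= E * (2 / pi * cq) * r ^+ k.
Proof.
have bb : `|fourier_part F (2 ^ k) (2 ^ k.+1) x| <=
    pi^-1 * (E * (2 * (2 ^ k)%:R `^ (- s) * 1 * kint k q `^ q^-1)).
  apply: (@fourier_block_bound _ p q F D E 0 (s * pi / 2) (fun n => n%:R `^ (- s)) (cst 1) 1) => //.
  - by move=> n /andP[kn _]; apply: rel; apply: leq_trans kn; rewrite expn_gt0.
  - move=> n kn _; rewrite !powRN lef_pV2 ?posrE ?powR_gt0 ?ltr0n//; last first.
      by apply: leq_trans kn; rewrite expn_gt0.
    apply: ge0_ler_powR; rewrite ?nnegrE ?ler_nat//.
    by rewrite addr_ge0// ?invr_ge0 ltW// (lt_trans ltr01).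
apply: (le_trans bb).
rewrite mulr1 natrX; have := kint_root k q1 pq; rewrite -/cq => hk.
have -> : E * (2 / pi * cq) * r ^+ k = pi^-1 * (E * (2 * (2 ^+ k) `^ (- s) * (cq * (2 ^+ k) `^ p^-1))).
  have -> : r ^+ k = (2 ^+ k) `^ (- s) * (2 ^+ k) `^ p^-1.
    by rewrite -powRX -powRD ?lt0r_neq0 ?exprn_gt0 ?implybT//; congr (_ `^ _); rewrite /s; ring.
  by ring.
rewrite ler_wpM2l ?invr_ge0 ?pi_ge0// ler_wpM2l// ler_wpM2l// mulr_ge0// powR_ge0.
Qed.

Let dec k0 : {ae mu, forall x, torus x ->
  `|F x - tmean F - fourier_part F 1 (2 ^ k0) x| <= E * (2 / pi * cq) * (r ^+ k0 / (1 - r))}.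
Proof.
apply: (dyadic_decomposition (e := fun k => E * (2 / pi * cq) * r ^+ k)) => // K.
rewrite -mulr_sumr ler_wpM2l ?mulr_ge0 ?powR_ge0 ?invr_ge0 ?pi_ge0//.
by apply: geometric_tail_le; case/andP: r01 => /ltW -> ->.
Qed.

(** With [k0 = 0] the low part is empty, so the blocks alone bound [F] up to its mean. Membership in
    [lip] includes essential boundedness. *)
Lemma sobolev_ae_bounded : exists M, {ae mu, forall x, torus x -> `|F x| <= M}.
Proof.
have aeF : Filter (nbhs (almost_everywhere mu)) by exact: ae_filter_ringOfSetsType.
exists (E * (2 / pi * cq) * (r ^+ 0 / (1 - r)) + `|tmean F|).
apply: filterS (dec 0) => x /[apply]; rewrite /fourier_part big_geq// mulr0 subr0 => h.
by rewrite -[F x](subrK (tmean F)); apply: le_trans (ler_normD _ _) _; rewrite lerD2r.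
Qed.

(** The first summand comes from the blocks, on which the difference costs a factor [bcn al]; the
    second comes from the low frequencies. *)
Definition sobolev_cst : R := 2 / pi * cq / (1 - r) * bcn al +
  pi^-1 * ((2 * q + 2) * fdc al * (4 * pi * (3 + (ln 2)^-1)) `^ q^-1).

Lemma sobolev_rdiff_le t h : 0 < t < 1 -> `|h| <= t ->
  {ae mu, forall x, torus x -> `|rdiff al h F x| <= E * sobolev_cst * (t `^ al * (1 - ln t) `^ q^-1)}.
Proof.
move=> t01 ht; have [k0 [k00 kt tk]] := exists_dyadic t01.
have aeF : Filter (nbhs (almost_everywhere mu)) by exact: ae_filter_ringOfSetsType.
have /andP[t0 _] := t01; have t1 := one_le_lnV t01.
have p0 : 0 < p := lt_trans ltr01 p1.
have q0 : 0 < q := lt_trans ltr01 q1.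
have l2 := @ln2_gt0 R.
have low x := @rdiff_low_bound _ p q F D E 0 (s * pi / 2) (fun n => n%:R `^ (- s)) (cst 1) 1 p1 q1 pq pF pD DE al h k0 x al0.
have lowb x : `|rdiff al h (fourier_part F 1 (2 ^ k0)) x| <=
    pi^-1 * (E * ((2 * q + 2) * (fdc al * `|h| `^ al) * 1 * (4 * pi * k0.+1%:R) `^ q^-1)).
  apply: low => // n; first by move=> /andP[n0 _]; exact: rel.
  (* As [t * 2 ^+ k0 <= 2], all low frequencies satisfy [n * |h| < 2 * pi], the range where the
     multiplier is known. *)
  move=> nk; apply: le_lt_trans (_ : 2 < _); last first.
    by have := pi_ge2 R; lra.
  apply: le_trans tk; rewrite mulrC ler_pM// -natrX ler_nat ltnW//.
have := rdiff_ae al0 pF (dec k0) lowb.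
apply: filterS => x /[apply] /le_trans; apply.
have hal : `|h| `^ al <= t `^ al by apply: ge0_ler_powR; rewrite ?nnegrE// ltW.
have rk : r ^+ k0 <= t `^ al.
  rewrite /r -powRX -mulN1r powRrM powR_inv1 ?exprn_ge0// -exprVn.
  by apply: ge0_ler_powR; rewrite ?nnegrE ?exprn_ge0// ltW.
have kk : (4 * pi * k0.+1%:R) `^ q^-1 <= (4 * pi * (3 + (ln 2)^-1)) `^ q^-1 * (1 - ln t) `^ q^-1.
  have l0 : 0 <= 3 + (ln (2 : R))^-1 by rewrite addr_ge0// invr_ge0 ltW.
  rewrite -powRM ?mulr_ge0 ?pi_ge0//; last by rewrite (le_trans ler01).
  apply: ge0_ler_powR; rewrite ?nnegrE ?mulr_ge0 ?pi_ge0 ?invr_ge0//; last first.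
  - rewrite -[leRHS]mulrA ler_pM2l ?mulr_gt0 ?pi_gt0//; apply: dyadic_log => //.
    by apply: le_trans tk _; rewrite ler_nat.
  - by rewrite (le_trans ler01).
  exact: ltW.
have L1 : 1 <= (1 - ln t) `^ q^-1.
  by apply: powR_ge1; rewrite ?invr_ge0// ltW.
have T0 : 0 <= t `^ al by exact: powR_ge0.
have [r0 r1] := andP r01.
have b0 := bcn_ge0 al0.
have f0 := ltW (fdc_gt0 al0).
rewrite /sobolev_cst [leRHS](_ : _ = E * (2 / pi * cq) * (t `^ al * (1 - ln t) `^ q^-1 / (1 - r)) * bcn al +
  pi^-1 * (E * ((2 * q + 2) * (fdc al * t `^ al) * ((4 * pi * (3 + (ln 2)^-1)) `^ q^-1 * (1 - ln t) `^ q^-1)))); last by ring.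
apply: lerD.
  rewrite ler_wpM2r// ler_wpM2l ?mulr_ge0 ?powR_ge0 ?invr_ge0 ?pi_ge0//.
  rewrite ler_pM2r ?invr_gt0 ?subr_gt0//; apply: le_trans rk _.
  by rewrite -[leLHS]mulr1 ler_wpM2l.
rewrite ler_wpM2l ?invr_ge0 ?pi_ge0// ler_wpM2l// mulr1.
have q2 : 0 <= 2 * q + 2 by rewrite addr_ge0// mulr_ge0// ltW.
have f1 := mulr_ge0 q2 (mulr_ge0 f0 (powR_ge0 `|h| al)).
by rewrite ler_pM ?powR_ge0// ler_wpM2l// ler_wpM2l.
Qed.

Lemma sobolev_cst_ge0 : 0 <= sobolev_cst.
Proof.
have [_ r1] := andP r01; have q0 : 0 < q := lt_trans ltr01 q1.
rewrite addr_ge0//.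
  by rewrite !mulr_ge0 ?powR_ge0 ?invr_ge0 ?pi_ge0 ?subr_ge0 ?bcn_ge0// ltW.
have q2 : 0 <= 2 * q + 2 by rewrite addr_ge0// mulr_ge0// ltW.
by rewrite mulr_ge0 ?invr_ge0 ?pi_ge0// mulr_ge0 ?powR_ge0// (mulr_ge0 q2)// ltW// fdc_gt0.
Qed.

End Part.

Lemma sobolev_bounded f g : LpT 1%E f -> is_fracderiv s 1 f g -> (normT p%:E g < +oo)%E ->
  (normT +oo f < +oo)%E.
Proof.
move=> Lf fg Ng; have p0 : 0 < p := lt_trans ltr01 p1.
have [fr fi] := @LpT_perL1 _ 1 f (lexx _) Lf.
have [gr gi] := @LpT_perL1 _ 1 g (lexx _) fg.1.
have Nf : normT p%:E g = (fine (normT p%:E g))%:E by rewrite fineK// ge0_fin_numE// normT_ge0.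
have Dr : (NT p (Re \o g) <= (fine (normT p%:E g))%:E)%E by rewrite -Nf; exact: NT_Re_le.
have Di : (NT p (Im \o g) <= (fine (normT p%:E g))%:E)%E by rewrite -Nf; exact: NT_Im_le.
have rel n (n0 : (0 < n)%N) := @fracderiv_freq _ s f g n n0 fr fi gr gi fg.
have [Mr hr] := sobolev_ae_bounded fr gr Dr (fun n ngt => (@rel n ngt).1).
have [Mi hi] := sobolev_ae_bounded fi gi Di (fun n ngt => (@rel n ngt).2).
have aeF : Filter (nbhs (almost_everywhere mu)) by exact: ae_filter_ringOfSetsType.
apply: le_lt_trans (@normT_infty_le _ f (Num.max 0 (Num.max Mr Mi)) _ _ _) (ltry _).
- by rewrite le_max lexx.
- by apply: filterS hr => x /[apply] /le_trans; apply; rewrite !le_max lexx orbT.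
- by apply: filterS hi => x /[apply] /le_trans; apply; rewrite !le_max lexx !orbT.
Qed.

Lemma sobolev_modulus_le f g t : LpT 1%E f -> is_fracderiv s 1 f g -> 0 < t < 1 ->
  (normT p%:E g < +oo)%E ->
  (modulus al +oo f t <=
    (2 * sobolev_cst * (t `^ al * (1 - ln t) `^ q^-1))%:E * normT p%:E g)%E.
Proof.
move=> Lf fg t01 Ng; have p0 : 0 < p := lt_trans ltr01 p1.
have [fr fi] := @LpT_perL1 _ 1 f (lexx _) Lf.
have [gr gi] := @LpT_perL1 _ 1 g (lexx _) fg.1.
have E0 : 0 <= fine (normT p%:E g) by rewrite fine_ge0// normT_ge0.
have Nf : normT p%:E g = (fine (normT p%:E g))%:E by rewrite fineK// ge0_fin_numE// normT_ge0.
have Dr : (NT p (Re \o g) <= (fine (normT p%:E g))%:E)%E by rewrite -Nf; exact: NT_Re_le.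
have Di : (NT p (Im \o g) <= (fine (normT p%:E g))%:E)%E by rewrite -Nf; exact: NT_Im_le.
have rel n (n0 : (0 < n)%N) := @fracderiv_freq _ s f g n n0 fr fi gr gi fg.
rewrite Nf -EFinM.
rewrite (_ : 2 * _ * _ * _ = 2 * (fine (normT p%:E g) * sobolev_cst * (t `^ al * (1 - ln t) `^ q^-1))); last by ring.
apply: modulus_infty_le => [|h ht|h ht].
- by rewrite !mulr_ge0 ?sobolev_cst_ge0// ?powR_ge0.
- exact: (sobolev_rdiff_le fr gr Dr (fun n ngt => (@rel n ngt).1)).
- exact: (sobolev_rdiff_le fi gi Di (fun n ngt => (@rel n ngt).2)).
Qed.

Lemma sobolev_embedded b : q^-1 <= b ->
  embedded (sobolev s p%:E) (lip al b) (sobolev_norm s p%:E) (lip_norm al b).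
Proof.
(* The summand 1 makes the constant positive, [sobolev_cst] being only nonnegative. *)
move=> qb; pose C := 2 * sobolev_cst + 1.
have C0 : 0 < C by rewrite ltr_wpDl// mulr_ge0// sobolev_cst_ge0.
have key f : LpT 1%E f -> (lip_norm al b f <= C%:E * sobolev_norm s p%:E f)%E.
  move=> Lf; apply: ge_ereal_sup => _ [t /= t01 <-].
  rewrite in_itv/= in t01; have t1 := one_le_lnV t01; have /andP[t0 _] := t01.
  (* The derivative in direction 1 suffices, as the Sobolev norm is a supremum over directions. *)
  have one : [set zeta : R | `|zeta| = 1] 1 by rewrite /= normr1.
  apply: (@le_trans _ _ (C%:E * fracderiv_norm s p%:E 1 f)%E); last first.
    by rewrite lee_pmul2l ?lte_fin//; apply: ereal_sup_ubound; exists 1.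
  rewrite -lee_pdivrMl//; apply: le_ereal_inf_tmp => _ [g /= fg <-].
  rewrite lee_pdivrMl//.
  (* A derivative [g] of infinite norm makes the right-hand side infinite. *)
  have [Ng|] := ltP (normT p%:E g) +oo%E; last first.
    by rewrite leye_eq => /eqP ->; rewrite gt0_muley ?leey// lte_fin.
  have := sobolev_modulus_le Lf fg t01 Ng.
  have w0 : 0 <= t `^ (- al) * (1 - ln t) `^ (- b) by rewrite mulr_ge0 ?powR_ge0.
  move=> /(lee_wpmul2l (x := (t `^ (- al) * (1 - ln t) `^ (- b))%:E)).
  rewrite lee_fin => /(_ w0) /le_trans; apply.
  rewrite muleA -EFinM lee_wpmul2r ?normT_ge0// lee_fin.
  rewrite [leLHS](_ : _ = 2 * sobolev_cst * (t `^ (- al) * t `^ al * ((1 - ln t) `^ (- b) * (1 - ln t) `^ q^-1))); last by ring.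
  rewrite -powRD ?addNr ?powRr0 ?mul1r; last by rewrite (lt0r_neq0 t0) implybT.
  rewrite -powRD; last by rewrite (lt0r_neq0 (lt_le_trans ltr01 t1)) implybT.
  apply: (@le_trans _ _ (2 * sobolev_cst)); last by rewrite /C lerDl.
  rewrite -[leRHS]mulr1 ler_wpM2l ?mulr_ge0 ?sobolev_cst_ge0//.
  by rewrite -[leRHS](powRr0 (1 - ln t)) ler_powR// addrC subr_le0.
split; last by exists C; split => // f [Lf _]; exact: key.
move=> f [Lf Nf]; split; last first.
  by apply: le_lt_trans (key f Lf) _; rewrite lte_mul_pinfty// ltW.
have /ereal_inf_lt[_ [g /= fg <-] Ng] : (fracderiv_norm s p%:E 1 f < +oo)%E.
  apply: le_lt_trans Nf; apply: ereal_sup_ubound; exists 1 => //=; exact: normr1.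
split; [by case: Lf|by case: Lf|exact: sobolev_bounded Lf fg Ng].
Qed.

End SobolevBound.

(** * Besov functions *)

Section StepSum.
Context {R : realType}.
Local Notation mu := (@lebesgue_measure R).
Implicit Types (f : R -> R[i]) (j k m : nat) (u x : R).

Definition dyad j : R := 2^-1 ^+ j.

Lemma dyad_gt0 j : 0 < dyad j.
Proof. by rewrite exprn_gt0. Qed.

Lemma dyadS j : 2 * dyad j.+1 = dyad j.
Proof. by rewrite /dyad exprS mulrA mulfV ?mul1r. Qed.

Variables (s e U : R) (P : \bar R) (f : R -> R[i]) (k0 : nat).
Hypotheses (e0 : 0 <= e) (kU : 2 * dyad k0 <= U).

Let phi u : \bar R := ((u `^ (- e))%:E * modulus s P f u * (u^-1)%:E)%E.
Let c j : \bar R := (((2 * dyad j) `^ (- e) * (2 * dyad j)^-1)%:E * modulus s P f (dyad j))%E.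
Let A j : set R := `[dyad j, 2 * dyad j[%classic.

Let c0 j : (0 <= c j)%E.
Proof. by rewrite mule_ge0 ?modulus_ge0 ?lee_fin ?mulr_ge0 ?powR_ge0 ?invr_ge0 ?mulr_ge0 ?ltW ?dyad_gt0. Qed.

Let phi0 u : 0 < u -> (0 <= phi u)%E.
Proof.
move=> u0; rewrite /phi mule_ge0 ?lee_fin ?invr_ge0 ?(ltW u0)// mule_ge0 ?lee_fin ?powR_ge0//.
by rewrite modulus_ge0// ltW.
Qed.

Let c_le_phi j u : A j u -> (c j <= phi u)%E.
Proof.
rewrite /A /= in_itv/= => /andP[ju uj]; have d0 := dyad_gt0 j.
have u0 : 0 < u := lt_le_trans d0 ju.
rewrite /phi /c muleAC -EFinM lee_pmul ?modulus_mono//.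
- by rewrite lee_fin mulr_ge0 ?powR_ge0// invr_ge0 mulr_ge0// ltW.
- by rewrite modulus_ge0// ltW.
rewrite lee_fin ler_pM ?powR_ge0 ?invr_ge0 ?mulr_ge0 ?(ltW d0)//.
  by rewrite !powRN lef_pV2 ?posrE ?powR_gt0 ?mulr_gt0// ge0_ler_powR ?nnegrE ?mulr_ge0 ?(ltW d0)// ltW.
by rewrite lef_pV2 ?posrE ?mulr_gt0// ltW.
Qed.

(** The second conjunct, that the intervals counted so far contain no point below
    [2 * dyad (k0 + m)], carries their disjointness through the induction. *)
Let sum_le m u : 0 < u ->
  (\sum_(k0 <= j < k0 + m) c j * (\1_(A j) u)%:E <= phi u)%E /\
  ((u < 2 * dyad (k0 + m))%R -> (\sum_(k0 <= j < k0 + m) c j * (\1_(A j) u)%:E = 0)%E).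
Proof.
move=> u0; elim: m => [|m [IH1 IH2]]; first by rewrite addn0 big_geq//; split => //; exact: phi0.
rewrite addnS big_nat_recr ?leq_addr//=.
have [Au|Au] := pselect (A (k0 + m)%N u).
  have : u < 2 * dyad (k0 + m) by move: Au; rewrite /A/= in_itv/= => /andP[].
  move=> /IH2 ->; rewrite add0e indicE mem_set// mule1; split; first exact: c_le_phi.
  by rewrite dyadS ltNge; move: Au; rewrite /A/= in_itv/= => /andP[-> _].
rewrite indicE memNset// mule0 adde0; split => //.
rewrite dyadS => h; apply: IH2; apply: lt_trans h _.
by rewrite ltr_pMl ?dyad_gt0// ltr1n.
Qed.

(** On [2^-j, 2^(1-j)) the integrand is at least a constant, by monotonicity of the modulus and of
    the powers. The intervals are disjoint and, by [kU], contained in the domain; only the step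
    function is measurable. *)
Lemma step_sum_le K : (\sum_(k0 <= j < K) ((2 `^ (- e - 1) * dyad j `^ (- e))%:E * modulus s P f (dyad j))
  <= \int[mu]_(u in `]0%R, U[) ((u `^ (- e))%:E * modulus s P f u * (u^-1)%:E))%E.
Proof.
have [Kk|/ltnW kK] := leqP K k0.
  rewrite big_geq//; apply: integral_ge0 => u /=; rewrite in_itv/= => /andP[u0 _]; exact: phi0.
rewrite -(subnKC kK); move: (K - k0)%N => m {kK}.
apply: (@le_trans _ _ (\int[mu]_(u in `]0%R, U[) (\sum_(k0 <= j < k0 + m) c j * (\1_(A j) u)%:E)%E)%E); last first.
  apply: ge0_le_integral_nomeas => u /=; rewrite in_itv/= => /andP[u0 _].
    by apply: sume_ge0 => j _; rewrite mule_ge0.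
  by have [] := sum_le m u0.
have mD : measurable (`]0%R, U[%classic : set R) by exact: measurable_itv.
have mA j : measurable (A j) by exact: measurable_itv.
have m1 j : measurable_fun (`]0%R, U[%classic : set R) (fun u => (\1_(A j) u : R)%:E).
  by apply/measurable_funTS/measurable_EFinP; exact: measurable_indic.
rewrite ge0_integral_sum//; last 2 first.
- by move=> j; apply: emeasurable_funM; [exact: measurable_cst|exact: m1].
- by move=> j u _; rewrite mule_ge0.
rewrite big_seq [leRHS]big_seq; apply: lee_sum => j; rewrite mem_index_iota => /andP[kj _].
rewrite (@ge0_integralZl _ _ _ mu _ mD _ (m1 j) (c j) _ (c0 j)); last first.
  by move=> u _; rewrite lee_fin indicE.
have AD : A j `<=` `]0%R, U[%classic.
  move=> u; rewrite /A /= !in_itv/= => /andP[ju uj].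
  rewrite (lt_le_trans (dyad_gt0 j) ju)/=; apply: (lt_le_trans uj); apply: le_trans kU.
  by rewrite ler_pM2l// /dyad ler_wiXn2l// invf_le1// ler1n.
have -> : (\int[mu]_(x in `]0%R, U[) (\1_(A j) x)%:E = mu (A j))%E.
  rewrite (@integral_indic _ _ _ mu _ mD _ (mA j)); congr (mu _); apply/seteqP; split => u; first by case.
  by move=> Au; split => //; exact: AD.
have d0 := dyad_gt0 j.
rewrite /A lebesgue_measure_itv/= lte_fin ltr_pMl// ltr1n -EFinB /c muleAC -EFinM.
rewrite lee_wpmul2r ?(modulus_ge0 _ _ _ (ltW d0))// lee_fin powRM ?(ltW d0)//.
rewrite [leRHS](_ : _ = 2 `^ (- e) * 2^-1 * dyad j `^ (- e)).
  by rewrite powRD ?(_ : 2 `^ -1 = 2^-1)// ?powR_inv1// pnatr_eq0 implybT.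
by field; rewrite gt_eqF.
Qed.

End StepSum.

(** * Inversion of a difference at low frequencies *)

Section BesovBound.
Context {R : realType}.
Local Notation mu := (@lebesgue_measure R).
Local Notation torus := (@torus R).
Local Notation Re := (@complex.Re R).
Local Notation Im := (@complex.Im R).
Implicit Types (n k j : nat) (t x h v : R) (F : R -> R).

(** Reciprocal of sin y / y at y = n v / 2. *)
Definition xsin (v : R) n : R := n%:R * v / (2 * sin (n%:R * v / 2)).

Lemma sin_half_gt0 v n : 0 < v -> (0 < n)%N -> n%:R * v <= 1 -> 0 < sin (n%:R * v / 2).
Proof.
move=> v0 n0 nv; have n1 : 0 < n%:R * v by rewrite mulr_gt0// ltr0n.
have pi2 := pi_ge2 R.
by apply: sin_gt0_pi; rewrite divr_gt0//= ltr_pdivrMr//; apply: le_lt_trans nv _; lra.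
Qed.

Lemma xsin_le v n : 0 < v -> (0 < n)%N -> n%:R * v <= 1 -> 0 <= xsin v n <= pi / 2.
Proof.
move=> v0 n0 nv; have n1 : 0 < n%:R * v by rewrite mulr_gt0// ltr0n.
have pi2 := pi_ge2 R; have p0 := pi_gt0 R.
have s0 := sin_half_gt0 v0 n0 nv.
rewrite /xsin divr_ge0 ?mulr_ge0 ?(ltW s0) ?(ltW n1) ?(ltW v0)//=.
rewrite ler_pdivrMr ?mulr_gt0//.
have := @sin_half_ge _ (n%:R * v); rewrite (ltW n1) (le_trans nv) => [/(_ isT)|]; last by lra.
by rewrite ler_pdivrMr// => /le_trans; apply; rewrite mulrA divfK// mulrC.
Qed.

Lemma xsin_inc v n : 0 < v -> (0 < n)%N -> n.+1%:R * v <= 1 -> xsin v n <= xsin v n.+1.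
Proof.
move=> v0 n0 nv; have pi2 := pi_ge2 R.
have nn : n%:R * v <= n.+1%:R * v by rewrite ler_pM2r// ler_nat.
have s0 := sin_half_gt0 v0 n0 (le_trans nn nv).
have s1 := sin_half_gt0 v0 (ltn0Sn n) nv.
have : n%:R * v / 2 * sin (n.+1%:R * v / 2) <= n.+1%:R * v / 2 * sin (n%:R * v / 2).
  apply: sin_ratio; [by rewrite divr_gt0// mulr_gt0// ltr0n|by rewrite ler_pM2r|].
  by rewrite ler_pdivrMr//; apply: le_trans nv _; lra.
rewrite /xsin; move: s0 s1; move: (sin _) (sin (n.+1%:R * _ / _)) => S S' s0 s1 h.
by rewrite ler_pdivrMr ?mulr_gt0// mulrAC ler_pdivlMr ?mulr_gt0//; lra.
Qed.

Variables (s : R) (F : R -> R).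
Hypotheses (s0 : 0 < s) (pF : perL1 F).

Definition regA (n : nat) : R := n%:R `^ (- s).
(** [regA s n * regB v n] is the inverse of the amplitude fdc s (2 sin (n v / 2))^s of the
    difference of step [v]. The factor [regA] decreases and [regB] increases in [n], and for
    [n * v <= 1] the latter is bounded because [xsin] is at most [pi / 2]. *)
Definition regB v n : R := (fdc s)^-1 * v `^ (- s) * xsin v n `^ s.

Lemma regdiff_freq v n : 0 < v -> (0 < n)%N -> n%:R * v <= 1 ->
  freq_rel F (regdiff s v F) (s * v / 2) (s * pi / 2) regA (regB v) n.
Proof.
move=> v0 n0 nv t; have pi2 := pi_ge2 R.
have S0 := sin_half_gt0 v0 n0 nv; have n1 : 0 < (n%:R : R) by rewrite ltr0n.
rewrite fourier_regdiff ?(ltW v0)//; last by lra.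
have f0 := fdc_gt0 s0.
rewrite [RHS]mulrA -[LHS]mul1r; congr (_ * _).
rewrite /regA /regB /xsin; move: S0; move: (sin _) => S S0.
rewrite powRM ?invr_ge0 ?mulr_ge0 ?(ltW S0) ?(ltW v0)// (powRM _ (ltW n1) (ltW v0)) !powRN.
have -> : (2 * S)^-1 `^ s = ((2 * S) `^ s)^-1.
  by rewrite -powR_inv1 ?mulr_ge0 ?(ltW S0)// -powRrM mulN1r powRN.
have x0 : (2 * S) `^ s != 0 by rewrite gt_eqF// powR_gt0// mulr_gt0.
have x1 : v `^ s != 0 by rewrite gt_eqF// powR_gt0.
have x2 : (n%:R : R) `^ s != 0 by rewrite gt_eqF// powR_gt0.
move: x0 x1 x2 f0; move: (_ `^ s) (v `^ s) (n%:R `^ s) (fdc s) => X Y Z W x0 x1 x2 /lt0r_neq0 x3.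
by field; rewrite x0 x1 x2 x3.
Qed.

Lemma regB_ge0 v n : 0 <= regB v n.
Proof. by rewrite !mulr_ge0 ?powR_ge0 ?invr_ge0 ?(ltW (fdc_gt0 s0)). Qed.

Lemma regB_inc v n : 0 < v -> (0 < n)%N -> n.+1%:R * v <= 1 -> regB v n <= regB v n.+1.
Proof.
move=> v0 n0 nv; rewrite ler_wpM2l ?mulr_ge0 ?powR_ge0 ?invr_ge0 ?(ltW (fdc_gt0 s0))//.
have nn : n%:R * v <= 1 by apply: le_trans nv; rewrite ler_pM2r// ler_nat.
have /andP[h _] := xsin_le v0 n0 nn; have /andP[h1 _] := xsin_le v0 (ltn0Sn n) nv.
by apply: ge0_ler_powR; rewrite ?nnegrE ?(ltW s0)// xsin_inc.
Qed.

Definition regBm v : R := (fdc s)^-1 * v `^ (- s) * (pi / 2) `^ s.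

Lemma regB_le v n : 0 < v -> (0 < n)%N -> n%:R * v <= 1 -> regB v n <= regBm v.
Proof.
move=> v0 n0 nv; rewrite ler_wpM2l ?mulr_ge0 ?powR_ge0 ?invr_ge0 ?(ltW (fdc_gt0 s0))//.
have /andP[h h1] := xsin_le v0 n0 nv.
by apply: ge0_ler_powR; rewrite ?nnegrE ?(ltW s0)// divr_ge0// pi_ge0.
Qed.

End BesovBound.

Section BesovModulus.
Context {R : realType}.
Local Notation mu := (@lebesgue_measure R).
Local Notation torus := (@torus R).
Local Notation Re := (@complex.Re R).
Local Notation Im := (@complex.Im R).
Implicit Types (n k j m : nat) (t x h v U : R) (F : R -> R).

Lemma invr_powR x (r : R) : 0 <= x -> x^-1 `^ r = x `^ (- r).
Proof. by move=> x0; rewrite -powR_inv1// -powRrM mulN1r. Qed.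

Lemma nat_dyad k : (2 ^ k)%:R = (dyad k)^-1 :> R.
Proof. by rewrite natrX /dyad exprVn invrK. Qed.

Lemma mul_dyad_le1 n k : (n <= 2 ^ k)%N -> n%:R * dyad k <= 1 :> R.
Proof. by move=> nk; rewrite -ler_pdivlMr ?dyad_gt0// div1r -nat_dyad ler_nat. Qed.

(** The upper bound is restricted to [0 < k0] because the numbers U = t (1 - ln t)^(b / al) need not
    stay below 4 when b / al is large. *)
Lemma exists_dyadic_step U : 0 < U -> exists k0 : nat, 2 * dyad k0 <= U /\
  ((0 < k0)%N -> U < 4 * dyad k0).
Proof.
move=> U0.
have ex : exists k : nat, 2 * dyad k <= U.
  have : (fun k => (2^-1 : R) ^+ k) @ \oo --> (0 : R) by apply: cvg_expr; rewrite ger0_norm// invf_lt1// ltr1n.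
  have U2 : 0 < U / 2 by rewrite divr_gt0.
  move=> /cvgrPdist_le/(_ _ U2) [k _ /(_ k (leqnn k))].
  by rewrite sub0r normrN ger0_norm ?exprn_ge0// => h; exists k; rewrite mulrC -ler_pdivlMr.
exists (ex_minn ex); case: ex_minnP => k hk kmin; split => // k0.
case: k k0 hk kmin => // k _ _ kmin.
rewrite (_ : 4 * dyad k.+1 = 2 * dyad k); last by rewrite -(dyadS k) mulrA; congr (_ * _); ring.
by rewrite ltNge; apply/negP => /kmin; rewrite ltnn.
Qed.

Variables (al p q : R).
Hypotheses (al0 : 0 < al) (p1 : 1 < p) (q1 : 1 < q) (pq : p^-1 + q^-1 = 1).
Let s := al + p^-1.
Let cq := (4 * pi * (2 `^ (q - 1) / (2 `^ (q - 1) - 1))) `^ q^-1.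
(** The constant of [step_sum_le] for the exponent 1/p. *)
Let kap : R := 2 `^ (- p^-1 - 1).

Let p0 : 0 < p := lt_trans ltr01 p1.
Let q0 : 0 < q := lt_trans ltr01 q1.
Let s0 : 0 < s. Proof. by rewrite addr_gt0// invr_gt0. Qed.
Let kap0 : 0 < kap. Proof. by rewrite powR_gt0. Qed.

Let Ch : R := pi^-1 * (2 * 2 `^ s * ((fdc s)^-1 * (pi / 2) `^ s) * (cq * 2 `^ (- p^-1))).
Let Cl : R := pi^-1 * ((2 * q + 2) * fdc al * ((fdc s)^-1 * (pi / 2) `^ s) * (4 * pi) `^ q^-1).
Let C3 : R := (3 + (ln 2)^-1) `^ q^-1 * 4 `^ al + 1.

Definition besov_cst : R := (Ch * bcn al + Cl * C3) / kap.

Let Ch0 : 0 <= Ch.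
Proof.
have f0 := fdc_gt0 s0.
by rewrite !mulr_ge0 ?powR_ge0 ?invr_ge0 ?pi_ge0// ltW.
Qed.

Let Cl0 : 0 <= Cl.
Proof.
have f0 := ltW (fdc_gt0 s0); have f1 := ltW (fdc_gt0 al0).
rewrite mulr_ge0 ?invr_ge0 ?pi_ge0// mulr_ge0 ?powR_ge0//; apply: mulr_ge0.
  by apply: mulr_ge0 => //; rewrite addr_ge0// mulr_ge0// ltW.
by rewrite mulr_ge0 ?powR_ge0// invr_ge0.
Qed.

Let C30 : 0 <= C3. Proof. by rewrite addr_ge0// mulr_ge0// powR_ge0. Qed.

Lemma besov_cst_ge0 : 0 <= besov_cst.
Proof. by rewrite divr_ge0 ?(ltW kap0)// addr_ge0// mulr_ge0// bcn_ge0. Qed.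

Section Part.
Variables (F : R -> R) (k0 : nat) (w : nat -> R) (I t b : R).
Hypotheses (pF : perL1 F)
  (Dw : forall j, (k0 <= j)%N -> (NT p (regdiff s (dyad j) F) <= (w j)%:E)%E)
  (wI : forall K, \sum_(k0 <= j < K) kap * dyad j `^ (- p^-1) * w j <= I)
  (t01 : 0 < t < 1) (qb : q^-1 <= b)
  (kU : (0 < k0)%N -> t * (1 - ln t) `^ (b / al) < 4 * dyad k0).

Let w0 j : (k0 <= j)%N -> 0 <= w j.
Proof. by move=> /Dw h; rewrite -lee_fin; apply: le_trans h; exact: NT_ge0. Qed.

(** Block [k] is recovered from the difference of step [dyad k.+1], for which [n * v <= 1] on the
    whole block; hence the shift of the index of [w]. *)
Let blk_le k x : (k0 <= k)%N ->
  `|fourier_part F (2 ^ k) (2 ^ k.+1) x| <= Ch * (dyad k.+1 `^ (- p^-1) * w k.+1).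
Proof.
move=> kk; have wk : 0 <= w k.+1 by apply: w0; apply: leq_trans kk _.
have v0 := @dyad_gt0 R k.+1; set v := dyad k.+1 in v0 *.
have pos n : (2 ^ k <= n)%N -> (0 < n)%N by apply: leq_trans; rewrite expn_gt0.
have nv n : (n <= 2 ^ k.+1)%N -> n%:R * v <= 1 by exact: mul_dyad_le1.
have bb : `|fourier_part F (2 ^ k) (2 ^ k.+1) x| <=
    pi^-1 * (w k.+1 * (2 * regA s (2 ^ k)%N * regBm s v * kint k q `^ q^-1)).
  apply: (@fourier_block_bound _ p q F (regdiff s v F) (w k.+1) (s * v / 2) (s * pi / 2) (regA s) (regB s v)) => //.
  - exact: perL1_regdiff.
  - by apply: Dw; apply: leq_trans kk _.
  - by move=> n /andP[kn nk]; apply: regdiff_freq => //; [exact: pos|apply: nv; exact: ltnW].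
  - move=> n kn _; rewrite /regA !powRN lef_pV2 ?posrE ?powR_gt0 ?ltr0n ?(pos _ kn)//.
    by apply: ge0_ler_powR; rewrite ?nnegrE ?ler_nat// ltW.
  - by move=> n; exact: powR_ge0.
  - by move=> n kn nk; apply: regB_inc => //; [exact: pos|apply: nv; exact: ltnW].
  - by move=> n; exact: regB_ge0.
  - by move=> n /andP[kn nk]; apply: regB_le => //; [exact: pos|apply: nv; exact: ltnW].
apply: (le_trans bb).
have f0 := fdc_gt0 s0.
have hk := kint_root k q1 pq; rewrite -/cq -natrX nat_dyad invr_powR ?(ltW (dyad_gt0 _))// in hk.
rewrite -(dyadS k) -/v powRM ?(ltW v0)// in hk.
apply: (@le_trans _ _ (pi^-1 * (w k.+1 * (2 * regA s (2 ^ k) * regBm s v * (cq * (2 `^ (- p^-1) * v `^ (- p^-1))))))).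
  rewrite ler_wpM2l ?invr_ge0 ?pi_ge0// ler_wpM2l// ler_wpM2l//.
  rewrite mulr_ge0 ?mulr_ge0 ?powR_ge0 ?invr_ge0 ?(ltW f0)//.
rewrite /regA nat_dyad invr_powR ?(ltW (dyad_gt0 _))// opprK -(dyadS k) -/v powRM ?(ltW v0)//.
rewrite /regBm powRN /Ch.
have x1 : v `^ s != 0 by rewrite gt_eqF// powR_gt0.
move: x1; move: (v `^ s) => V x1; rewrite le_eqVlt; apply/orP; left; apply/eqP.
rewrite -[X in _ = X]mul1r -(mulfV x1); ring.
Qed.

Let sum_le K : \sum_(k0 <= k < K) Ch * (dyad k.+1 `^ (- p^-1) * w k.+1) <= Ch * (I / kap).
Proof.
rewrite -mulr_sumr ler_wpM2l// ler_pdivlMr// mulr_suml.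
apply: le_trans (wI K.+1).
have [kK|/ltnW Kk] := leqP k0 K; last first.
  rewrite big_geq//; rewrite big_nat; apply: sumr_ge0 => j /andP[h _].
  by rewrite mulr_ge0 ?w0// mulr_ge0 ?powR_ge0.
rewrite [leRHS]big_ltn ?ltnS// big_add1/= ler_wpDl//.
  by rewrite mulr_ge0 ?w0// mulr_ge0 ?powR_ge0.
by apply: ler_sum => j _; rewrite mulrC mulrA.
Qed.

Let wk0 : kap * (dyad k0 `^ (- p^-1) * w k0) <= I.
Proof. by have := wI k0.+1; rewrite big_nat1 mulrA. Qed.

(** This is where the exponent b / al comes from. If [0 < k0], then 2^(k0 al) <= 4^al U^(-al) with
    U^al = t^al (1 - ln t)^b, and the power (1 - ln t)^b absorbs (k0 + 1)^(1/q), which is of order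
    (1 - ln t)^(1/q) at most. The summand 1 in [C3] covers [k0 = 0]. *)
Let log_bound : t `^ al * (k0.+1%:R) `^ q^-1 * dyad k0 `^ (- al) <= C3.
Proof.
have /andP[t0 t1'] := t01; have t1 := one_le_lnV t01.
have l1 : 0 < 1 - ln t := lt_le_trans ltr01 t1.
have [k00|kpos] := posnP k0.
  have d1 : dyad 0 = 1 :> R by rewrite /dyad expr0.
  rewrite k00 d1 powR1 !mulr1 ler_wpDl ?mulr_ge0 ?powR_ge0//.
  have -> : 1 = 1 `^ al :> R by rewrite powR1.
  by apply: ge0_ler_powR; rewrite ?nnegrE// ltW.
have := kU kpos; set U := t * _ => hU.
have U0 : 0 < U by rewrite mulr_gt0// powR_gt0.
have tU : t <= U by rewrite ler_peMr ?(ltW t0)// powR_ge1// divr_ge0 ?(ltW al0)// (le_trans _ qb)// invr_ge0 ltW.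
have tk : t * 2 ^+ k0 <= 4.
  rewrite -natrX nat_dyad ler_pdivrMr ?dyad_gt0//; exact: le_trans tU (ltW hU).
have h1 := dyadic_log t01 tk.
have c2 : 0 <= 3 + (ln (2 : R))^-1 by rewrite addr_ge0// invr_ge0 ltW// ln2_gt0.
have h2 : k0.+1%:R `^ q^-1 <= (3 + (ln 2)^-1) `^ q^-1 * (1 - ln t) `^ b.
  apply: (@le_trans _ _ ((3 + (ln 2)^-1) `^ q^-1 * (1 - ln t) `^ q^-1)).
    rewrite -powRM ?(ltW l1)//; apply: ge0_ler_powR => //; rewrite ?nnegrE ?mulr_ge0 ?(ltW l1)//.
    by rewrite invr_ge0 ltW.
  by rewrite ler_wpM2l ?powR_ge0// ler_powR.
have h3 : dyad k0 `^ (- al) <= 4 `^ al * U `^ (- al).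
  rewrite !powRN ler_pdivlMr ?powR_gt0// mulrC ler_pdivrMr ?powR_gt0 ?dyad_gt0//.
  rewrite -powRM ?(ltW (dyad_gt0 _))//; apply: ge0_ler_powR; rewrite ?nnegrE; [exact: ltW|exact: ltW|by rewrite mulr_ge0// ltW ?dyad_gt0|exact: ltW].
have h4 : t `^ al * (1 - ln t) `^ b * U `^ (- al) = 1.
  have -> : t `^ al * (1 - ln t) `^ b = U `^ al.
    by rewrite /U powRM ?(ltW t0) ?powR_ge0// -powRrM divfK// lt0r_neq0.
  by rewrite powRN mulfV// gt_eqF// powR_gt0.
apply: (@le_trans _ _ (t `^ al * ((3 + (ln 2)^-1) `^ q^-1 * (1 - ln t) `^ b) * (4 `^ al * U `^ (- al)))).
  by apply: ler_pM => //; rewrite ?mulr_ge0 ?powR_ge0// ler_wpM2l ?powR_ge0.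
rewrite [leLHS](_ : _ = (3 + (ln 2)^-1) `^ q^-1 * 4 `^ al * (t `^ al * (1 - ln t) `^ b * U `^ (- al))); last by ring.
by rewrite h4 mulr1 lerDl.
Qed.

Lemma besov_rdiff_le h : `|h| <= t ->
  {ae mu, forall x, torus x -> `|rdiff al h F x| <= besov_cst * I}.
Proof.
move=> ht; have /andP[t0 t1'] := t01; have t1 := one_le_lnV t01.
have aeF : Filter (nbhs (almost_everywhere mu)) by exact: ae_filter_ringOfSetsType.
have v0 := @dyad_gt0 R k0; set v := dyad k0 in v0 *.
have wk : 0 <= w k0 by exact: w0.
have nv n : (n <= 2 ^ k0)%N -> n%:R * v <= 1 by exact: mul_dyad_le1.
have dec := dyadic_decomposition pF blk_le sum_le.
have pi2 := pi_ge2 R.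
have Bm0 : 0 <= regBm s v by rewrite !mulr_ge0 ?powR_ge0 ?invr_ge0 ?(ltW (fdc_gt0 s0)).
have tk0 : (0 < k0)%N -> t < 4 * v.
  move=> kpos; apply: le_lt_trans (kU kpos); rewrite ler_peMr ?(ltW t0)// powR_ge1//.
  by rewrite divr_ge0 ?(ltW al0)// (le_trans _ qb)// invr_ge0 ltW.
have lowb x : `|rdiff al h (fourier_part F 1 (2 ^ k0)) x| <=
    pi^-1 * (w k0 * ((2 * q + 2) * (fdc al * `|h| `^ al) * regBm s v * (4 * pi * k0.+1%:R) `^ q^-1)).
  apply: (@rdiff_low_bound _ p q F (regdiff s v F) (w k0) (s * v / 2) (s * pi / 2) (regA s) (regB s v)) => //.
  - exact: perL1_regdiff.
  - exact: Dw.
  - by move=> n /andP[n0 nk]; apply: regdiff_freq => //; apply: nv; exact: ltnW.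
  - move=> n nk; have [->|n0] := posnP n; first by rewrite mul0r; lra.
    have kpos : (0 < k0)%N by rewrite lt0n; apply/eqP => k00; move: nk; rewrite k00 expn0 ltnNge n0.
    apply: (@le_lt_trans _ _ (n%:R * t)); first by rewrite ler_wpM2l.
    apply: (@lt_le_trans _ _ (n%:R * (4 * v))); first by rewrite ltr_pM2l ?ltr0n// tk0.
    by rewrite mulrCA; have := nv n (ltnW nk); move: (n%:R * v) => z; lra.
  - by move=> n n0 nk; apply: regB_inc => //; apply: nv; exact: ltnW.
  - by move=> n; exact: regB_ge0.
  - by move=> n /andP[n0 nk]; apply: regB_le => //; apply: nv; exact: ltnW.
have := rdiff_ae al0 pF dec lowb.
apply: filterS => x /[apply] /le_trans; apply.
have f0 := ltW (fdc_gt0 s0); have f1 := ltW (fdc_gt0 al0).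
have b0 := bcn_ge0 al0.
rewrite (_ : besov_cst * I = Ch * (I / kap) * bcn al + Cl * C3 * (I / kap)); last by rewrite /besov_cst; ring.
rewrite lerD2l.
have q2 : 0 <= 2 * q + 2 by rewrite addr_ge0// mulr_ge0// ltW.
have hal : `|h| `^ al <= t `^ al by apply: ge0_ler_powR; rewrite ?nnegrE// ltW.
(* The factor v^(-s) is shared out: v^(-al) goes with [log_bound], and v^(-1/p) forms the term of
   index [k0] of the dyadic sum bounded by [I]. *)
apply: (@le_trans _ _ (Cl * (t `^ al * (k0.+1%:R) `^ q^-1 * v `^ (- al)) * (v `^ (- p^-1) * w k0))); last first.
  apply: ler_pM.
  - by rewrite mulr_ge0// !mulr_ge0 ?powR_ge0.
  - by rewrite mulr_ge0 ?powR_ge0.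
  - by rewrite ler_wpM2l// log_bound.
  - by rewrite ler_pdivlMr// mulrC; exact: wk0.
have vs : v `^ (- s) = v `^ (- al) * v `^ (- p^-1).
  by rewrite -powRD ?(lt0r_neq0 v0) ?implybT//; congr (_ `^ _); rewrite /s; ring.
have -> : (4 * pi * k0.+1%:R) `^ q^-1 = (4 * pi) `^ q^-1 * k0.+1%:R `^ q^-1 :> R by rewrite powRM ?mulr_ge0 ?pi_ge0.
rewrite /regBm vs /Cl.
rewrite [leRHS](_ : _ = pi^-1 * (w k0 * ((2 * q + 2) * (fdc al * t `^ al) * ((fdc s)^-1 * (v `^ (- al) * v `^ (- p^-1)) * (pi / 2) `^ s) *
  ((4 * pi) `^ q^-1 * k0.+1%:R `^ q^-1)))); last by ring.
rewrite ler_wpM2l ?invr_ge0 ?pi_ge0// ler_wpM2l//.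
rewrite ler_wpM2r ?mulr_ge0 ?powR_ge0// ler_wpM2r//; first by rewrite !mulr_ge0 ?powR_ge0// invr_ge0.
by rewrite ler_wpM2l// ler_wpM2l.
Qed.

End Part.

Lemma besov_modulus_le b : q^-1 <= b -> exists C : R, 0 < C /\ forall f t,
  LpT p%:E f -> 0 < t < 1 ->
  (modulus al +oo f t <= C%:E * \int[mu]_(u in `]0%R, (t * (1 - ln t) `^ (b / al))%R[)
     ((u `^ (- p^-1))%:E * modulus s p%:E f u * (u^-1)%:E))%E.
Proof.
move=> qb; pose C := 2 * besov_cst + 1.
have C0 : 0 < C by rewrite ltr_wpDl// mulr_ge0// besov_cst_ge0.
exists C; split => // f t Lf t01; have /andP[t0 t1'] := t01; have t1 := one_le_lnV t01.
set U := t * _; set J := (X in (_ <= _ * X)%E).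
have U0 : 0 < U by rewrite mulr_gt0// powR_gt0// (lt_le_trans ltr01).
have phi0 u : `]0%R, U[%classic u -> (0 <= (u `^ (- p^-1))%:E * modulus s p%:E f u * (u^-1)%:E)%E.
  rewrite /= in_itv/= => /andP[u0 _].
  rewrite mule_ge0 ?lee_fin ?invr_ge0 ?(ltW u0)// mule_ge0 ?lee_fin ?powR_ge0//.
  by rewrite modulus_ge0// ltW.
have J0 : (0 <= J)%E by exact: integral_ge0.
(* If the integral is infinite there is nothing to prove; otherwise its finiteness makes the moduli
   finite below. *)
have [Jf|] := ltP J +oo%E; last first.
  by rewrite leye_eq => /eqP ->; rewrite gt0_muley ?leey// lte_fin.
have EJ : J = (fine J)%:E by rewrite fineK// ge0_fin_numE.
have [k0 [kU kU']] := exists_dyadic_step U0.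
have ep : 0 <= p^-1 by rewrite invr_ge0 ltW.
have step K := @step_sum_le _ s p^-1 U p%:E f k0 ep kU K.
have m0 j : (0 <= modulus s p%:E f (dyad j))%E by rewrite modulus_ge0// ltW// dyad_gt0.
have cj0 j : 0 < kap * dyad j `^ (- p^-1) by rewrite mulr_gt0// powR_gt0// dyad_gt0.
(* One infinite modulus would make the dyadic sum infinite, and hence the integral. *)
have fin j : (k0 <= j)%N -> (modulus s p%:E f (dyad j) < +oo)%E.
  move=> kj; rewrite ltey; apply/eqP => E; have := step j.+1.
  rewrite big_nat_recr//= E gt0_muley ?lte_fin ?cj0// addeC addye; last first.
    rewrite gt_eqF// (lt_le_trans (ltNyr 0))// sume_ge0// => i _.
    by rewrite mule_ge0// lee_fin ltW ?cj0.
  by rewrite leye_eq -/J EJ.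
pose w j := fine (modulus s p%:E f (dyad j)).
have Ew j : (k0 <= j)%N -> modulus s p%:E f (dyad j) = (w j)%:E.
  by move=> kj; rewrite fineK// ge0_fin_numE ?fin.
have wI K : \sum_(k0 <= j < K) kap * dyad j `^ (- p^-1) * w j <= fine J.
  rewrite -lee_fin -EJ; apply: le_trans (step K); rewrite -sumEFin.
  rewrite big_nat [leRHS]big_nat; apply: lee_sum => j /andP[kj _].
  by rewrite Ew// -EFinM.
have [fr fi] := LpT_perL1 (ltW p1) Lf.
have Dr j : (k0 <= j)%N -> (NT p (regdiff s (dyad j) (Re \o f)) <= (w j)%:E)%E.
  move=> kj; rewrite -Ew//; apply: le_trans (@modulus_ge _ s p%:E f (dyad j) (dyad j) _); last first.
    by rewrite ger0_norm// ltW// dyad_gt0.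
  apply: le_trans (NT_Re_le (fracdiff s (dyad j) f) p0); apply: NT_mono => // x _.
  exact: norm_regdiff.
have Di j : (k0 <= j)%N -> (NT p (regdiff s (dyad j) (Im \o f)) <= (w j)%:E)%E.
  move=> kj; rewrite -Ew//; apply: le_trans (@modulus_ge _ s p%:E f (dyad j) (dyad j) _); last first.
    by rewrite ger0_norm// ltW// dyad_gt0.
  apply: le_trans (NT_Im_le (fracdiff s (dyad j) f) p0); apply: NT_mono => // x _.
  exact: norm_regdiff.
rewrite EJ -EFinM; apply: (@le_trans _ _ (2 * (besov_cst * fine J))%:E); last first.
  by rewrite lee_fin mulrA ler_wpM2r ?fine_ge0// /C lerDl.
apply: modulus_infty_le => [|h ht|h ht].
- by rewrite mulr_ge0 ?besov_cst_ge0 ?fine_ge0.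
- exact: (besov_rdiff_le fr Dr wI t01 qb kU').
- exact: (besov_rdiff_le fi Di wI t01 qb kU').
Qed.

End BesovModulus.

(** * Test functions *)

Section TestFunction.
Context {R : realType}.
Local Notation mu := (@lebesgue_measure R).
Local Notation torus := (@torus R).
Local Notation Re := (@complex.Re R).
Local Notation Im := (@complex.Im R).
Implicit Types (n m j : nat) (t x h phi al : R) (c : nat -> R).

(** All frequencies are positive, so fractional derivatives stay in this family with a common change
    of the phase [phi], and the imaginary part is a real part with phase [phi - pi / 2]. *)
Definition trig c phi m x : R[i] :=
  Complex (\sum_(1 <= n < 2 ^ m) c n * cos (n%:R * x + phi))
          (\sum_(1 <= n < 2 ^ m) c n * sin (n%:R * x + phi)).

Definition trig_re c phi m x : R := \sum_(1 <= n < 2 ^ m) c n * cos (n%:R * x + phi).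

Lemma Re_trig c phi m : Re \o trig c phi m = trig_re c phi m.
Proof. by []. Qed.

Lemma Im_trig c phi m : Im \o trig c phi m = trig_re c (phi - pi / 2) m.
Proof.
by apply/funext => x; apply: eq_bigr => n _; rewrite addrA cosBpihalf.
Qed.

Lemma perL1_trig_re c phi m : perL1 (trig_re c phi m).
Proof. by apply: perL1_sum => n; apply: perL1Z; exact: perL1_cos. Qed.

Lemma trig_re_le c phi m x : `|trig_re c phi m x| <= \sum_(1 <= n < 2 ^ m) `|c n|.
Proof.
apply: le_trans (ler_norm_sum _ _ _) _; apply: ler_sum => n _.
by rewrite normrM -[leRHS]mulr1 ler_wpM2l// cos_max.
Qed.

Lemma tint_trig_re c phi m n t : tint (fun x => trig_re c phi m x * cos (n%:R * x + t)) =
  if (1 <= n < 2 ^ m)%N then c n * (pi * cos (phi - t)) else 0.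
Proof.
pose u j x := c j * (cos (j%:R * x + phi) * cos (n%:R * x + t)).
have pc j : perL1 (fun x => cos (j%:R * x + phi) * cos (n%:R * x + t)) by apply: perL1Mcos; exact: perL1_cos.
rewrite -(eq_tint (F := fun x => \sum_(1 <= j < 2 ^ m) u j x)); last first.
  by move=> x; rewrite mulr_suml; apply: eq_bigr => j _; rewrite /u mulrA.
rewrite tint_sum => [|j]; last by apply: perL1Z.
rewrite (eq_big_nat _ _ (F2 := fun j => if j == n then c n * (pi * cos (phi - t)) else 0)); last first.
  move=> j /andP[j0 _]; rewrite tintZ// tint_coscos//; case: eqP => [->//|_]; by rewrite mulr0.
rewrite -big_mkcond/= big_const_seq.
have := count_uniq_mem n (iota_uniq 1 (2 ^ m - 1)); rewrite -/(index_iota 1 (2 ^ m)) mem_index_iota.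
by case: ifP => _ -> /=; rewrite ?addr0.
Qed.

Lemma cos_coef_trig_re c phi m n : cos_coef (trig_re c phi m) n = if (1 <= n < 2 ^ m)%N then c n * (pi * cos phi) else 0.
Proof. by have := tint_trig_re c phi m n 0; rewrite (tint_cosE _ _ (perL1_trig_re _ _ _)) cos0 sin0 mulr1 mulr0 !subr0. Qed.

Lemma sin_coef_trig_re c phi m n : sin_coef (trig_re c phi m) n = if (1 <= n < 2 ^ m)%N then - (c n * (pi * sin phi)) else 0.
Proof.
have := tint_trig_re c phi m n (- (pi / 2)); rewrite (tint_cosE _ _ (perL1_trig_re _ _ _)) cosN sinN cos_pihalf sin_pihalf.
rewrite mulr0 sub0r mulrN1 !opprK cosDpihalf => ->; case: ifP => // _; by rewrite !mulrN.
Qed.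

Lemma fourier_trig c phi m (n : int) : fourier (trig c phi m) n =
  if n is Posz n then if (1 <= n < 2 ^ m)%N then Complex (c n * cos phi) (c n * sin phi) else 0 else 0.
Proof.
have pr : perL1 (Re \o trig c phi m) by rewrite Re_trig; exact: perL1_trig_re.
have pim : perL1 (Im \o trig c phi m) by rewrite Im_trig; exact: perL1_trig_re.
have P0 : (pi : R) != 0 by rewrite gt_eqF// pi_gt0.
case: n => n.
  rewrite (fourierE _ pr pim) Re_trig Im_trig !cos_coef_trig_re !sin_coef_trig_re.
  case: ifP => _; last by rewrite addr0 subr0 mulr0.
  rewrite cosBpihalf sinBpihalf; move: (pi : R) P0 => P P0.
  by congr Complex; field; rewrite P0.
rewrite NegzE (fourierNE _ pr pim) Re_trig Im_trig !cos_coef_trig_re !sin_coef_trig_re.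
case: ifP => _; last by rewrite addr0 subr0 mulr0.
rewrite cosBpihalf sinBpihalf; move: (pi : R) P0 => P P0.
by apply/eqP; rewrite eq_complex /=; apply/andP; split; apply/eqP; ring.
Qed.

Lemma trig_per c phi m : Defs.periodic (trig c phi m).
Proof.
move=> x; have [_ p1 _] := perL1_trig_re c phi m; have [_ p2 _] := perL1_trig_re c (phi - pi / 2) m.
apply/eqP; rewrite eq_complex; apply/andP; split; apply/eqP.
  exact: p1.
by have := p2 x; rewrite -Im_trig.
Qed.

Lemma trig_meas c phi m : cmeasurable (trig c phi m).
Proof. by split; rewrite ?Re_trig ?Im_trig; [case: (perL1_trig_re c phi m)|case: (perL1_trig_re c (phi - pi / 2) m)]. Qed.

Lemma NT_bounded (p M : R) (G : R -> R) : 0 < p -> 0 <= M -> (forall x, `|G x| <= M) ->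
  (NT p G <= ((2 * pi) `^ p^-1 * M)%:E)%E.
Proof.
move=> p0 M0 GM; have -> : (2 * pi) `^ p^-1 * M = (2 * pi * M `^ p) `^ p^-1.
  by rewrite (@powRM _ (2 * pi) (M `^ p)) ?mulr_ge0 ?pi_ge0 ?powR_ge0// -powRrM mulfV ?lt0r_neq0// powRr1.
apply: (@NT_le _ p G (cst (M `^ p))) => //; first exact: perL1_cst.
  by move=> y _; apply: ge0_ler_powR; rewrite ?nnegrE// ltW.
by rewrite tint_cst.
Qed.

Lemma normc_trig_le c phi m x : Normc.normc (trig c phi m x) <= 2 * \sum_(1 <= n < 2 ^ m) `|c n|.
Proof.
apply: le_trans (normc_le _) _; rewrite mulr2n mulrDl mul1r; apply: lerD; first exact: trig_re_le.
have := trig_re_le c (phi - pi / 2) m x; by rewrite -Im_trig.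
Qed.

Lemma normc_ge0 (z : R[i]) : 0 <= Normc.normc z.
Proof. by apply: le_trans (Re_le_normc z). Qed.

Lemma trig_LpT (p : R) c phi m : 0 < p -> LpT p%:E (trig c phi m).
Proof.
move=> p0; split; [exact: trig_per|exact: trig_meas|].
rewrite normTE.
have M0 : 0 <= 2 * \sum_(1 <= n < 2 ^ m) `|c n| by apply: mulr_ge0 => //; exact: sumr_ge0.
apply: le_lt_trans (NT_bounded p0 M0 _) (ltry _).
by move=> x; rewrite (ger0_norm (normc_ge0 _)); exact: normc_trig_le.
Qed.

Lemma trig_fracderiv s c m zeta : `|zeta| = 1 ->
  is_fracderiv s zeta (trig c 0 m) (trig (fun n => n%:R `^ s * c n) (zeta * (s * pi / 2)) m).
Proof.
move=> z1; split; first exact: trig_LpT.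
move=> n; rewrite !fourier_trig; case: n => n; last by rewrite mulr0.
case: ifP => [/andP[n1 _]|_]; last by rewrite mulr0.
have [->|->] : zeta = 1 \/ zeta = -1.
  by move: z1; case: (ger0P zeta) => h; [left|right; lra].
- rewrite ipow_pos// mul1r cos0 sin0.
  by apply/eqP; rewrite eq_complex /=; apply/andP; split; apply/eqP; ring.
rewrite (_ : n%:~R * -1 = (- n%:Z)%:~R * 1); last by rewrite mulr1 mulrN1 mulrNz.
rewrite ipow_neg// mulN1r cosN sinN cos0 sin0.
by apply/eqP; rewrite eq_complex /=; apply/andP; split; apply/eqP; ring.
Qed.


Lemma rdiff_trig_re s h c phi m x : 0 < s -> (forall n, (n < 2 ^ m)%N -> n%:R * `|h| < 2 * pi) ->
  rdiff s h (trig_re c phi m) x = \sum_(1 <= n < 2 ^ m)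
    c n * (fdc s * (2 * sin (n%:R * `|h| / 2)) `^ s * cos (n%:R * (x + s * h / 2) + phi + fphase s h)).
Proof.
move=> s0 nh.
have sG n : summ (fdt s h (fun y => c n * cos (n%:R * y + phi)) x) by apply: summ_fdtZ; exact: summ_fdt_cos.
have [_ ->] := rdiff_sum (index_iota 1 (2 ^ m)) sG.
apply: eq_big_nat => n /andP[_ nm]; rewrite rdiffZ ?rdiff_cos ?nh//; exact: summ_fdt_cos.
Qed.

Lemma continuous_sum (l : seq nat) (u : nat -> R -> R) : (forall n, continuous (u n)) ->
  continuous (fun x => \sum_(n <- l) u n x).
Proof.
move=> cu; elim: l => [|i l IH] x.
  by under eq_fun do rewrite big_nil; exact: cst_continuous.
by under eq_fun do rewrite big_cons; apply: cvgD; [exact: cu|exact: IH].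
Qed.

(** Every dyadic block contributes at least 1/2. *)
Lemma harmonic_ge m : m%:R / 2 <= \sum_(1 <= n < 2 ^ m) (n%:R : R)^-1.
Proof.
elim: m => [|m IH]; first by rewrite mul0r big_geq.
rewrite (@big_cat_nat _ _ _ (2 ^ m))/= ?expn_gt0 ?leq_exp2l//.
rewrite -natr1 mulrDl; apply: lerD => //.
have -> : 1 / 2 = \sum_(2 ^ m <= n < 2 ^ m.+1) ((2 ^ m.+1)%:R : R)^-1.
  rewrite big_const_nat iter_addr_0 expnS mul2n -addnn addnK -[RHS]mulr_natl addnn -mul2n natrM.
  by rewrite invfM mulrCA mulfV ?mulr1 ?mul1r// pnatr_eq0 expn_eq0.
apply: ler_sum_nat => n /andP[n1 n2].
have n0 : (0 < n)%N by apply: leq_trans n1; rewrite expn_gt0.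
by rewrite lef_pV2 ?posrE ?ltr0n ?expn_gt0// ler_nat ltnW.
Qed.

(** Multiplied by n^al it gives the harmonic series; multiplied by n^(al + 1/p) it gives n^(1/p -
    1), whose kernel |z|^(-1/p) just fails to be in L_p. *)
Definition test_coef al n : R := n%:R `^ (-1 - al).

(* At [x = - al t / 2] modulo [2 pi] all the terms of the difference have the
   same phase. *)
Lemma modulus_trig_ge al t m : 0 < al -> 0 < t -> t * 2 ^+ m <= 1 -> al * t < 4 * pi ->
  ((fdc al * (2 / pi) `^ al * t `^ al * (m%:R / 2))%:E <= modulus al +oo (trig (test_coef al) 0 m) t)%E.
Proof.
move=> al0 t0 tm alt; have p0 := pi_gt0 R; have p2 := pi_ge2 R.
have eh : `|t| = t by rewrite ger0_norm// ltW.
apply: le_trans (@modulus_ge _ al +oo%E (trig (test_coef al) 0 m) t t _); last by rewrite eh.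
have ntm n : (n < 2 ^ m)%N -> n%:R * t <= 1.
  by move=> nm; apply: le_trans tm; rewrite mulrC ler_pM2l// -natrX ler_nat ltnW.
have nh n : (n < 2 ^ m)%N -> n%:R * `|t| < 2 * pi.
  by move=> /ntm; rewrite eh; move: (n%:R * t) => z; lra.
have f0 := fdc_gt0 al0.
pose K n : R := fdc al * (2 * sin (n%:R * t / 2)) `^ al.
pose G x : R := \sum_(1 <= n < 2 ^ m) test_coef al n * (K n * cos (n%:R * (x + al * t / 2))).
have cG : continuous G.
  apply: continuous_sum => n x; apply: cvgMl_tmp; apply: cvgMl_tmp.
  apply: continuous_comp; last exact: continuous_cos.
  by apply: cvgMl_tmp; apply: cvgD; [exact: cvg_id|exact: cvg_cst].
pose z x := fracdiff al t (trig (test_coef al) 0 m) x.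
have Gz y : G y <= `|Normc.normc (z y)|.
  rewrite (ger0_norm (normc_ge0 _)) /z fracdiffE Re_trig Im_trig sub0r.
  rewrite (rdiff_trig_re _ _ _ al0 nh) (rdiff_trig_re _ _ _ al0 nh) eh.
  set A := \sum_(_ <= _ < _) _; set B := \sum_(_ <= _ < _) _.
  pose th := fphase al t.
  (* [G y] is the component of [z y] in the direction of the common phase [th], hence at most the
     modulus of [z y]. *)
  have -> : G y = cos th * A + sin th * B.
    rewrite !mulr_sumr -big_split; apply: eq_bigr => n _.
    rewrite /= -/(K n) addr0; move: (n%:R * _) => u.
    rewrite [u - pi / 2 + _]addrAC cosBpihalf cosD sinD -/th.
    have := cos2Dsin2 th; move: (cos th) (sin th) (cos u) (sin u) => C S cu su CS.
    transitivity (test_coef al n * (K n * (cu * (C ^+ 2 + S ^+ 2)))); first by rewrite CS mulr1.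
    by ring.
  apply: le_trans (ler_norm _) _; rewrite /= -sqrtr_sqr; apply: ler_wsqrtr.
  have := cos2Dsin2 th; move: (cos th) (sin th) => C S CS.
  rewrite -[leRHS]mul1r -CS -subr_ge0 (_ : _ - _ = (C * B - S * A) ^+ 2); first exact: sqr_ge0.
  by ring.
(* The point of common phase, moved by one period into the interior of the torus, as
   [cont_le_ess_sup] requires. *)
have x02 : 0 < 2 * pi - al * t / 2 < 2 * pi.
  have : 0 < al * t by exact: mulr_gt0.
  by move: (al * t) alt => z' h1 h2; lra.
apply: le_trans (cont_le_ess_sup cG Gz x02); rewrite lee_fin.
rewrite /G subrK.
have -> : \sum_(1 <= n < 2 ^ m) test_coef al n * (K n * cos (n%:R * (2 * pi))) = \sum_(1 <= n < 2 ^ m) test_coef al n * K n.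
  by apply: eq_bigr => n _; rewrite -[n%:R * _]add0r cosD2pin cos0 mulr1.
apply: (@le_trans _ _ (fdc al * (2 / pi) `^ al * t `^ al * \sum_(1 <= n < 2 ^ m) (n%:R : R)^-1)).
  apply: ler_wpM2l (harmonic_ge m).
  exact: mulr_ge0 (mulr_ge0 (ltW f0) (powR_ge0 _ _)) (powR_ge0 _ _).
rewrite mulr_sumr; apply: ler_sum_nat => n /andP[n0 nm].
have n1 : (0 : R) < n%:R by rewrite ltr0n.
have -> : (n%:R : R)^-1 = test_coef al n * n%:R `^ al.
  by rewrite /test_coef -powRD ?subrK ?powR_inv1 ?(ltW n1)// (gt_eqF n1) implybT.
rewrite [leLHS](_ : _ = test_coef al n * (fdc al * ((2 / pi) `^ al * t `^ al * n%:R `^ al))); last by ring.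
rewrite ler_wpM2l ?powR_ge0// /K; apply: (ler_wpM2l (ltW f0)).
rewrite -powRM ?divr_ge0 ?(ltW p0) ?(ltW t0)// -powRM ?mulr_ge0 ?invr_ge0 ?(ltW p0) ?(ltW t0) ?(ltW n1)//.
have nt0 : 0 < n%:R * t by exact: mulr_gt0.
have hs := @sin_half_ge _ (n%:R * t); rewrite (ltW nt0) (le_trans (ntm n nm)) in hs; last by lra.
have {}hs := hs isT.
have E : 2 / pi * t * n%:R = 2 * (n%:R * t / pi) by ring.
have e0 : 0 <= n%:R * t / pi by rewrite divr_ge0 ?ltW.
rewrite E; apply: ge0_ler_powR; rewrite ?nnegrE; [exact: ltW|exact: mulr_ge0|exact: mulr_ge0 (le_trans e0 hs)|by rewrite ler_pM2l].
Qed.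

Lemma NT_kmin (p c : R) m v (G : R -> R) : 1 < p -> 0 <= c ->
  (forall x, `|G x| <= c * kmin (2 ^+ m) (x - v) `^ p^-1) ->
  (NT p G <= (c * (4 * pi * m.+1%:R) `^ p^-1)%:E)%E.
Proof.
move=> p1 c0 Gc; have p0 : 0 < p := lt_trans ltr01 p1.
have -> : c * (4 * pi * m.+1%:R) `^ p^-1 = (c `^ p * (4 * pi * m.+1%:R)) `^ p^-1.
  by rewrite (@powRM _ (c `^ p)) ?mulr_ge0 ?pi_ge0 ?powR_ge0// -powRrM mulfV ?lt0r_neq0// powRr1.
apply: (@NT_le _ p G (fun y => c `^ p * kmaj m 1 v y)) => //.
- by apply: perL1Z; exact: perL1_kmaj.
- move=> y _; apply: le_trans (_ : (c * kmin (2 ^+ m) (y - v) `^ p^-1) `^ p <= _).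
    by apply: ge0_ler_powR; rewrite ?nnegrE ?mulr_ge0 ?powR_ge0// ltW.
  rewrite powRM ?powR_ge0// -powRrM mulVf ?lt0r_neq0// ler_wpM2l ?powR_ge0//.
  exact: kmin_dyadic.
- rewrite tintZ; last exact: perL1_kmaj.
  by rewrite ler_wpM2l ?powR_ge0// -kint1 tint_kmaj.
Qed.

(** The coefficients are n^(1/p - 1), so [low_kernel_bound] gives the size of kmin^(1/p), whose p-th
    power is the logarithmic case of [kint]. *)
Lemma normT_trig_frac (p al phi : R) m : 1 < p ->
  (normT p%:E (trig (fun n => n%:R `^ (al + p^-1) * test_coef al n)%R phi m) <=
    (2 * (2 * p + 2) * (4 * pi * m.+1%:R) `^ p^-1)%:E)%E.
Proof.
move=> p1; have p0 : 0 < p := lt_trans ltr01 p1.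
have pi1 : p^-1 < 1 by rewrite invf_lt1.
have pp : 0 < p^-1 by rewrite invr_gt0.
have q2 : 0 <= 2 * p + 2 by rewrite addr_ge0// mulr_ge0// ltW.
have b psi x : `|trig_re (fun n => n%:R `^ (al + p^-1) * test_coef al n) psi m x| <= (2 * p + 2) * kmin (2 ^+ m) x `^ p^-1.
  rewrite /trig_re (eq_big_nat _ _ (F2 := fun n => n%:R `^ (p^-1 - 1) * 1 * 1 * cos (n%:R * x + psi))); last first.
    move=> n /andP[n0 _]; have n1 : (0 : R) < n%:R by rewrite ltr0n.
    rewrite /test_coef -powRD ?(gt_eqF n1) ?implybT// !mulr1; congr (_ `^ _ * _); ring.
  have -> : 2 * p + 2 = (2 / p^-1 + 2) * 1 * 1 by rewrite invrK !mulr1.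
  rewrite -natrX; apply: (low_kernel_bound (A := cst 1) (B := cst 1)) => //.
  by rewrite expn_gt0.
rewrite normTE -mulrA mulrA; apply: (@NT_kmin p _ m 0) => //; first by rewrite mulr_ge0.
move=> x; rewrite (ger0_norm (normc_ge0 _)) subr0; apply: le_trans (normc_le _) _.
rewrite -mulrA mulr2n mulrDl mul1r; apply: lerD; first exact: b.
by have := b (phi - pi / 2) x; rewrite -Im_trig.
Qed.

Lemma sobolev_trig (p al : R) m : 1 < p ->
  (sobolev_norm (al + p^-1) p%:E (trig (test_coef al) 0 m) <=
    (2 * (2 * p + 2) * (4 * pi * m.+1%:R) `^ p^-1)%:E)%E.
Proof.
move=> p1; apply: ge_ereal_sup => _ [zeta /= z1 <-].
apply: le_trans (normT_trig_frac al (zeta * ((al + p^-1) * pi / 2)) m p1).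
apply: ereal_inf_lbound; exists (trig (fun n => n%:R `^ (al + p^-1) * test_coef al n)%R (zeta * ((al + p^-1) * pi / 2)) m) => //=.
exact: trig_fracderiv.
Qed.

Lemma growth_exponent (c C e : R) m0 : 0 < c ->
  (forall m, (m0 <= m)%N -> c * m%:R <= C * m.+1%:R `^ e) -> 1 <= e.
Proof.
move=> c0 H; rewrite leNgt; apply/negP => e1; have d0 : 0 < 1 - e by rewrite subr_gt0.
(* Chosen so that [C <= c / 2 * K]; the 2 makes up for replacing [m] by [m.+1], since m + 1 <= 2
   m. *)
pose K := 2 * `|C| / c + 1.
have K0 : 0 < K by rewrite ltr_wpDl// divr_ge0 ?mulr_ge0// ltW.
pose m := (maxn m0 (maxn 1 (Num.truncn (K `^ (1 - e)^-1)).+1)).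
have m1 : (0 < m)%N by rewrite /m !leq_max orbT.
have := H m (leq_maxl _ _); apply/negP; rewrite -ltNge.
have M0 : (0 : R) < m.+1%:R by rewrite ltr0n.
have hm : K < m.+1%:R `^ (1 - e).
  have -> : K = (K `^ (1 - e)^-1) `^ (1 - e) by rewrite -powRrM mulVf ?gt_eqF// powRr1// ltW.
  apply: gt0_ltr_powR; rewrite ?nnegrE ?powR_ge0//.
  apply: lt_le_trans (truncnS_gt _) _; rewrite ler_nat.
  by apply: leq_trans (leqnSn m); rewrite /m !leq_max leqnn !orbT.
have ME : m.+1%:R = m.+1%:R `^ e * m.+1%:R `^ (1 - e) :> R.
  by rewrite -powRD ?(gt_eqF M0) ?implybT// addrC subrK powRr1// ltW.
have P0 : 0 < m.+1%:R `^ e :> R by exact: powR_gt0.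
have hK : C <= c / 2 * K.
  rewrite /K mulrDr mulr1 (_ : c / 2 * (2 * `|C| / c) = `|C|); last by field; rewrite gt_eqF.
  by rewrite (le_trans (ler_norm C))// lerDl divr_ge0// ltW.
have h2 : c / 2 * m.+1%:R <= c * m%:R.
  by rewrite -mulrA ler_pM2l// mulrC ler_pdivrMr// -natrM ler_nat muln2 -addnn -addn1 leq_add2l.
apply: lt_le_trans h2; rewrite [X in _ < _ * X]ME mulrCA [C * _]mulrC ltr_pM2l//.
apply: le_lt_trans hK _; rewrite ltr_pM2l//; exact: divr_gt0.
Qed.

End TestFunction.

(** * From (iii) to (iv) *)

Section EmbeddingNecessary.
Context {R : realType}.
Variables (al p b : R).
Hypotheses (al0 : 0 < al) (p1 : 1 < p) (b0 : 0 <= b).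

Lemma invn_lt_near (x : R) : 0 < x -> exists m0, forall m, (m0 <= m)%N -> (m%:R : R)^-1 < x.
Proof.
move=> x0; exists (Num.truncn x^-1).+1 => m hm.
have x1 : 0 < x^-1 by rewrite invr_gt0.
rewrite -[x]invrK ltf_pV2 ?posrE ?ltr0n ?(leq_trans _ hm)//.
by apply: lt_le_trans (truncnS_gt _) _; rewrite ler_nat.
Qed.

(** At [m = 0] the inverse is 0 by convention, hence the alternative. *)
Lemma dyad_le_inv m : 2^-1 ^+ m <= (m%:R : R)^-1 \/ m = 0%N.
Proof.
case: m => [|m]; [by right|left].
by rewrite exprVn lef_pV2 ?posrE ?exprn_gt0// -natrX ler_nat ltnW// ltn_expl.
Qed.

Lemma rate_necessary (abar C : R) : 0 < abar < al -> 0 < C ->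
  (forall (alpha0 : R) (f : R -> R[i]), abar < alpha0 < al -> sobolev (al + p^-1) p%:E f ->
    (ereal_sup [set (t `^ (- alpha0))%:E * modulus al +oo f t | t in `]0%R, 1%R[%classic]
     <= (C * (al - alpha0) `^ (- b))%:E * sobolev_norm (al + p^-1) p%:E f)%E) ->
  1 <= b + p^-1.
Proof.
move=> /andP[ab0 abal] C0 H; have p0 : 0 < p := lt_trans ltr01 p1.
have pi0 := pi_gt0 R.
(* Beyond [m1] the exponent [al - m%:R^-1] exceeds [abar]; beyond [m2] one has [al * t < 4 * pi], as
   [modulus_trig_ge] requires. *)
have [m1 hm1] : exists m0, forall m, (m0 <= m)%N -> (m%:R : R)^-1 < al - abar.
  by apply: invn_lt_near; rewrite subr_gt0.
have [m2 hm2] : exists m0, forall m, (m0 <= m)%N -> (m%:R : R)^-1 < 4 * pi / al.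
  by apply: invn_lt_near; rewrite divr_gt0// mulr_gt0.
pose K := C * (2 * (2 * p + 2) * (4 * pi) `^ p^-1).
have K0 : 0 <= K.
  by rewrite mulr_ge0 ?(ltW C0)// mulr_ge0 ?powR_ge0// mulr_ge0// addr_ge0// mulr_ge0// ltW.
apply: (@growth_exponent R (fdc al * (2 / pi) `^ al / 4) K _ (maxn 1 (maxn m1 m2))).
  by rewrite divr_gt0// mulr_gt0 ?fdc_gt0// powR_gt0// divr_gt0.
move=> m; rewrite !geq_max => /and3P[m0 mm1 mm2].
have M0 : (0 : R) < m%:R by rewrite ltr0n.
pose t : R := 2^-1 ^+ m.
have t0 : 0 < t by rewrite exprn_gt0.
have tm : t <= m%:R^-1 by case: (dyad_le_inv m) => // m00; rewrite m00 in m0.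
have t1 : t < 1.
  rewrite /t exprVn invf_lt1 ?exprn_gt0// -natrX ltr1n -{1}(expn0 2) ltn_exp2l//.
have tm1 : t * 2 ^+ m <= 1 by rewrite /t exprVn mulVf// expf_neq0.
have alt : al * t < 4 * pi.
  by rewrite mulrC -ltr_pdivlMr//; exact: le_lt_trans tm (hm2 m mm2).
have low := modulus_trig_ge al0 t0 tm1 alt.
pose a0 := al - m%:R^-1.
have a0b : abar < a0 < al.
  by rewrite /a0 ltrBrDr addrC -ltrBrDr hm1//= ltrBlDr ltrDl invr_gt0.
have sob := @sobolev_trig R p al m p1.
have fs : sobolev (al + p^-1) p%:E (trig (test_coef al) 0 m).
  split; first exact: trig_LpT.
  exact: le_lt_trans sob (ltry _).
have := H a0 _ a0b fs => up.
have cst0 : 0 <= C * (al - a0) `^ (- b) by rewrite mulr_ge0 ?powR_ge0// ltW.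
have {}up := le_trans up (lee_wpmul2l (x := (C * (al - a0) `^ (- b))%:E) _ sob).
have {}up : ((t `^ (- a0))%:E * modulus al +oo (trig (test_coef al) 0 m) t <=
  (C * (al - a0) `^ (- b))%:E * (2 * (2 * p + 2) * (4 * pi * m.+1%:R) `^ p^-1)%:E)%E.
  apply: le_trans (up _); last by rewrite lee_fin.
  by apply: ereal_sup_ubound; exists t => //=; rewrite in_itv/= t0.
have tw : 0 <= t `^ (- a0) by exact: powR_ge0.
have := le_trans (lee_wpmul2l (x := (t `^ (- a0))%:E) _ low) up.
rewrite lee_fin => /(_ tw); rewrite -!EFinM lee_fin.
have -> : al - a0 = m%:R^-1 by rewrite /a0; ring.
have -> : (m%:R^-1 : R) `^ (- b) = m%:R `^ b by rewrite invr_powR ?(ltW M0)// opprK.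
(* The match of t = 2^(-m) with al - a0 = 1/m: replacing the order [al] by [a0] costs only the
   constant t^(1/m) = 1/2. *)
have ta : t `^ (- a0) * t `^ al = 2^-1.
  rewrite -powRD ?(gt_eqF t0) ?implybT//.
  rewrite (_ : - a0 + al = m%:R^-1); last by rewrite /a0; ring.
  by rewrite /t -powR_mulrn// -powRrM mulfV ?gt_eqF// powRr1.
rewrite powRM ?mulr_ge0 ?(ltW pi0)// => up'.
have mb : m%:R `^ b <= m.+1%:R `^ b :> R by apply: ge0_ler_powR; rewrite ?nnegrE// ler_nat.
rewrite powRD; last by rewrite pnatr_eq0 implybT.
rewrite [leLHS](_ : _ = t `^ (- a0) * (fdc al * (2 / pi) `^ al * t `^ al * (m%:R / 2))); last first.
  rewrite (_ : _ * (_ * (_ / 2)) = t `^ (- a0) * t `^ al * (fdc al * (2 / pi) `^ al * m%:R / 2)); last by ring.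
  by rewrite ta; field.
apply: le_trans up' _; rewrite /K -!mulrA ler_pM2l// [leRHS](_ : _ =
  m.+1%:R `^ b * (2 * ((2 * p + 2) * ((4 * pi) `^ p^-1 * m.+1%:R `^ p^-1)))); last by ring.
have q2 : 0 <= 2 * p + 2 by rewrite addr_ge0// mulr_ge0// ltW.
by apply: ler_wpM2r mb; rewrite !mulr_ge0 ?powR_ge0.
Qed.

End EmbeddingNecessary.

(** * Necessity *)

Section PowerIntegrals.
Context {R : realType}.
Local Notation mu := (@lebesgue_measure R).
Implicit Types (u e U : R) (v c : nat -> R) (j n : nat).

(** Measurable majorants of powers, through which integrals of functions not known to be measurable
    are bounded by geometric sums. *)
Definition dstep v c u : \bar R := (\sum_(0 <= j <oo) (c j * \1_(`[v j, 2 * v j[%classic : set R) u)%:E)%E.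

Section Step.
Variables (v c : nat -> R).
Hypotheses (v0 : forall j, 0 < v j) (c0 : forall j, 0 <= c j).

Let t0 j u : 0 <= c j * \1_(`[v j, 2 * v j[%classic : set R) u.
Proof. by rewrite mulr_ge0. Qed.

Lemma dstep_ge0 u : (0 <= dstep v c u)%E.
Proof. by apply: nneseries_ge0 => j _ _; rewrite lee_fin. Qed.

Lemma dstep_ge j u : v j <= u -> u < 2 * v j -> ((c j)%:E <= dstep v c u)%E.
Proof.
move=> h1 h2; apply: le_trans (@nneseries_lim_ge _ _ predT 0 j.+1 _); last first.
  by move=> i _; rewrite lee_fin.
rewrite big_nat_recr//= indicE mem_set ?mulr1; last by rewrite /= in_itv/= h1 h2.
by rewrite leeDr// sume_ge0// => i _; rewrite lee_fin.
Qed.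

Let mstep j : measurable_fun setT (fun u => (c j * \1_(`[v j, 2 * v j[%classic : set R) u)%:E).
Proof.
apply/measurable_EFinP; apply: measurable_funM => //; exact: measurable_indic.
Qed.

Lemma measurable_dstep : measurable_fun setT (dstep v c).
Proof.
rewrite /dstep; apply: ge0_emeasurable_sum; [by move=> j u _ _; rewrite lee_fin|by move=> j _; exact: mstep].
Qed.

Lemma integral_dstep (D : set R) (S : R) : measurable D ->
  (forall n, \sum_(0 <= j < n) c j * v j <= S) -> (\int[mu]_(u in D) dstep v c u <= S%:E)%E.
Proof.
move=> mD hS; rewrite /dstep integral_nneseries//; last 2 first.
- by move=> j; apply: measurable_funTS; exact: mstep.
- by move=> j u _; rewrite lee_fin.
apply: lime_le.
  by apply: is_cvg_nneseries => n _ _; apply: integral_ge0 => u _; rewrite lee_fin.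
apply: nearW => n; apply: (@le_trans _ _ (\sum_(0 <= j < n) c j * v j)%:E); last by rewrite lee_fin.
rewrite -sumEFin; apply: lee_sum => j _.
have mA : measurable (`[v j, 2 * v j[%classic : set R) by exact: measurable_itv.
under eq_integral do rewrite EFinM.
have m1 : measurable_fun D (fun u : R => (\1_(`[v j, 2 * v j[%classic : set R) u : R)%:E).
  by apply/measurable_funTS/measurable_EFinP; exact: measurable_indic.
have cj : (0 <= (c j)%:E)%E by rewrite lee_fin.
rewrite (@ge0_integralZl _ _ _ mu _ mD _ m1 (c j)%:E _ cj)//; last first.
rewrite (@integral_indic _ _ _ mu _ mD _ mA) EFinM; apply: lee_wpmul2l; first by rewrite lee_fin.
apply: (@le_trans _ _ (mu `[v j, (2 * v j)%R[%classic)).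
  by apply: le_measure; rewrite ?inE//; exact: measurableI.
by rewrite lebesgue_measure_itv/= lte_fin ltr_pMl// ltr1n -EFinB lee_fin; lra.
Qed.

End Step.

Definition geo e : R := (1 - 2 `^ (- e))^-1.

Lemma geo_gt0 e : 0 < e -> 0 < geo e.
Proof. by move=> e0; rewrite invr_gt0 subr_gt0 powRN invf_lt1 ?powR_gt0// powR_gt1// ltr1n. Qed.

Lemma sum_geo e n : 0 < e -> \sum_(0 <= j < n) (2 `^ (- e)) ^+ j <= geo e.
Proof.
move=> e0; have := @geometric_tail_le R (2 `^ (- e)) 0 n.
rewrite powR_ge0 expr0 div1r; apply.
by rewrite powRN invf_lt1 ?powR_gt0// powR_gt1// ltr1n.
Qed.

Definition smallv U j : R := U * dyad j.+1.
(** On [v, 2 v) the power u^(e - 1) is at most (2 v)^e / v whenever e >= 0, whatever the sign of e -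
    1. *)
Definition smallc e U j : R := (2 * smallv U j) `^ e / smallv U j.

Lemma smallv_gt0 U j : 0 < U -> 0 < smallv U j.
Proof. by move=> U0; rewrite mulr_gt0// dyad_gt0. Qed.

Lemma smallc_ge0 e U j : 0 < U -> 0 <= smallc e U j.
Proof. by move=> U0; rewrite divr_ge0 ?powR_ge0// ltW// smallv_gt0. Qed.

Lemma small_step e U u : 0 <= e -> 0 < u -> u < U -> ((u `^ (e - 1))%:E <= dstep (smallv U) (smallc e U) u)%E.
Proof.
move=> e0 u0 uU; have U0 : 0 < U := lt_trans u0 uU.
have ex : exists j : nat, U * dyad j.+1 <= u.
  have [k [hk _]] := exists_dyadic_step (divr_gt0 u0 U0).
  exists k; rewrite mulrC -ler_pdivlMr//; apply: le_trans hk.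
  by rewrite -(dyadS k) mulrA ler_peMl ?ltW ?dyad_gt0//; lra.
case: (ex_minnP ex) => j hj jmin.
have hj2 : u < 2 * smallv U j.
  rewrite /smallv mulrCA dyadS; case: j hj jmin => [|j] _ jmin; first by rewrite /dyad expr0 mulr1.
  by rewrite ltNge; apply/negP => /jmin; rewrite ltnn.
have v0 := smallv_gt0 j U0.
apply: le_trans (@dstep_ge _ _ (fun j => smallc_ge0 e j U0) j u hj hj2).
rewrite lee_fin /smallc powRD ?(gt_eqF u0) ?implybT// powR_inv1 ?(ltW u0)//.
rewrite ler_pM ?powR_ge0 ?invr_ge0 ?(ltW u0)//.
  by apply: ge0_ler_powR; rewrite ?nnegrE; [exact: e0|exact: ltW|by rewrite mulr_ge0// ltW|exact: ltW].
by rewrite lef_pV2.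
Qed.

Lemma small_sum e U n : 0 < e -> 0 < U ->
  \sum_(0 <= j < n) smallc e U j * smallv U j <= U `^ e * geo e.
Proof.
move=> e0 U0.
rewrite (eq_bigr (fun j => U `^ e * (2 `^ (- e)) ^+ j)); last first.
  move=> j _; have v0 := smallv_gt0 j U0.
  rewrite /smallc divfK ?gt_eqF// /smallv mulrCA dyadS powRM ?(ltW U0) ?(ltW (dyad_gt0 _))//.
  by congr (_ * _); rewrite /dyad -powRX exprVn invr_powR ?exprn_ge0.
by rewrite -mulr_sumr ler_wpM2l ?powR_ge0// sum_geo.
Qed.

Lemma integral_power_le (phi : R -> \bar R) (M e U : R) : 0 < e -> 0 < U -> 0 <= M ->
  (forall u, 0 < u -> u < U -> (0 <= phi u)%E /\ (phi u <= (M * u `^ (e - 1))%:E)%E) ->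
  (\int[mu]_(u in `]0%R, U[) phi u <= (M * (U `^ e * geo e))%:E)%E.
Proof.
move=> e0 U0 M0 H.
apply: (@le_trans _ _ (\int[mu]_(u in `]0%R, U[) (M%:E * dstep (smallv U) (smallc e U) u))%E).
  apply: ge0_le_integral_nomeas => u /=; rewrite in_itv/= => /andP[u0 uU].
    by have [] := H u u0 uU.
  have [_ h] := H u u0 uU; apply: (le_trans h); rewrite EFinM lee_wpmul2l ?lee_fin//.
  exact: small_step (ltW e0) u0 uU.
have mD : measurable (`]0%R, U[%classic : set R) by exact: measurable_itv.
have sc j := smallc_ge0 e j U0; have sv j := smallv_gt0 j U0.
rewrite (@ge0_integralZl _ _ _ mu _ mD _ _ M%:E)//; last 2 first.
- by apply: measurable_funTS; exact: measurable_dstep.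
- by move=> u _; exact: dstep_ge0.
rewrite EFinM lee_wpmul2l ?lee_fin//; apply: integral_dstep => // n.
exact: small_sum.
Qed.

Definition largev U j : R := U * 2 ^+ j.
Definition largec e U j : R := largev U j `^ (- e - 1).

Lemma largev_gt0 U j : 0 < U -> 0 < largev U j.
Proof. by move=> U0; rewrite mulr_gt0// exprn_gt0. Qed.

Lemma large_step e U u : 0 <= e -> 0 < U -> U <= u ->
  ((u `^ (- e - 1))%:E <= dstep (largev U) (largec e U) u)%E.
Proof.
move=> e0 U0 Uu; have u0 : 0 < u := lt_le_trans U0 Uu.
have ex : exists j : nat, u < U * 2 ^+ j.+1.
  have [k [hk _]] := exists_dyadic_step (divr_gt0 U0 u0).
  exists k; rewrite -ltr_pdivrMl// mulrC -[_ / _]invf_div.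
  rewrite invf_plt ?posrE ?divr_gt0 ?exprn_gt0//; apply: lt_le_trans hk.
  by rewrite -exprVn exprS -/(dyad k) ltr_pM2r ?dyad_gt0//; lra.
case: (ex_minnP ex) => j hj jmin.
have hj1 : largev U j <= u.
  rewrite /largev; case: j hj jmin => [|j] _ jmin; first by rewrite expr0 mulr1.
  by rewrite leNgt; apply/negP => /jmin; rewrite ltnn.
have v0 := largev_gt0 j U0.
apply: le_trans (@dstep_ge (largev U) (largec e U) _ j u hj1 _).
- rewrite lee_fin /largec -opprD !powRN lef_pV2 ?posrE ?powR_gt0//.
  by apply: ge0_ler_powR; rewrite ?nnegrE ?(ltW v0) ?(ltW u0)// addr_ge0.
- by move=> i; exact: powR_ge0.
- by rewrite /largev mulrCA -exprS.
Qed.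

Lemma large_sum e U n : 0 < e -> 0 < U ->
  \sum_(0 <= j < n) largec e U j * largev U j <= U `^ (- e) * geo e.
Proof.
move=> e0 U0.
rewrite (eq_bigr (fun j => U `^ (- e) * (2 `^ (- e)) ^+ j)); last first.
  move=> j _; have v0 := largev_gt0 j U0.
  rewrite /largec -[X in _ * X](powRr1 (ltW v0)) -powRD ?(gt_eqF v0) ?implybT// subrK.
  by rewrite /largev powRM ?(ltW U0) ?exprn_ge0// powRX.
by rewrite -mulr_sumr ler_wpM2l ?powR_ge0// sum_geo.
Qed.

Lemma integral_two_powers_lty (phi : R -> \bar R) (M e1 e2 U : R) : 0 < e1 -> 0 < e2 -> 0 < U -> 0 <= M ->
  (forall u, 0 < u -> (0 <= phi u)%E) ->
  (forall u, 0 < u -> u < U -> (phi u <= (M * u `^ (e1 - 1))%:E)%E) ->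
  (forall u, U <= u -> (phi u <= (M * u `^ (- e2 - 1))%:E)%E) ->
  (\int[mu]_(u in `]0%R, +oo[) phi u < +oo)%E.
Proof.
move=> e10 e20 U0 M0 H0 H1 H2.
pose s1 := dstep (smallv U) (smallc e1 U); pose s2 := dstep (largev U) (largec e2 U).
have sc j := smallc_ge0 e1 j U0; have sv j := smallv_gt0 j U0.
have lc j : 0 <= largec e2 U j by exact: powR_ge0.
have lv j := largev_gt0 j U0.
have s10 u : (0 <= s1 u)%E by exact: dstep_ge0.
have s20 u : (0 <= s2 u)%E by exact: dstep_ge0.
have mD : measurable (`]0%R, +oo[%classic : set R) by exact: measurable_itv.
have m1 : measurable_fun (`]0%R, +oo[%classic : set R) s1 by apply: measurable_funTS; exact: measurable_dstep.
have m2 : measurable_fun (`]0%R, +oo[%classic : set R) s2 by apply: measurable_funTS; exact: measurable_dstep.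
apply: (@le_lt_trans _ _ (\int[mu]_(u in `]0%R, +oo[) (M%:E * (s1 u + s2 u)))%E).
  apply: ge0_le_integral_nomeas => u /=; rewrite in_itv/= andbT => u0; first exact: H0.
  have [uU|Uu] := ltP u U.
    apply: le_trans (H1 u u0 uU) _; rewrite EFinM lee_wpmul2l ?lee_fin//.
    by apply: le_trans (small_step (ltW e10) u0 uU) _; rewrite leeDl.
  apply: le_trans (H2 u Uu) _; rewrite EFinM lee_wpmul2l ?lee_fin//.
  by apply: le_trans (large_step (ltW e20) U0 Uu) _; rewrite leeDr.
rewrite (@ge0_integralZl _ _ _ mu _ mD _ _ M%:E)//; last 2 first.
- exact: emeasurable_funD.
- by move=> u _; rewrite adde_ge0.
rewrite (@ge0_integralD _ _ _ mu _ mD)//.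
rewrite lte_mul_pinfty ?lee_fin//.
apply: lte_add_pinfty.
  by apply: le_lt_trans (integral_dstep sv sc mD (fun n => small_sum n e10 U0)) (ltry _).
by apply: le_lt_trans (integral_dstep lv lc mD (fun n => large_sum n e20 U0)) (ltry _).
Qed.

End PowerIntegrals.

(** * Moduli of the test functions in L_p *)

Section TestModuli.
Context {R : realType}.
Local Notation mu := (@lebesgue_measure R).
Implicit Types (n m : nat) (h u t : R).
Variables (al p : R).
Hypotheses (al0 : 0 < al) (p1 : 1 < p).
Let s := al + p^-1.
Let f m := trig (test_coef al) 0 m.
Let p0 : 0 < p := lt_trans ltr01 p1.
Let q2 : 0 <= 2 * p + 2. Proof. by rewrite addr_ge0// mulr_ge0// ltW. Qed.

Let nh m h : `|h| * 2 ^+ m <= 1 -> forall n, (n < 2 ^ m)%N -> n%:R * `|h| < 2 * pi.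
Proof.
move=> hm n nm; have p2 := pi_ge2 R; apply: (@le_lt_trans _ _ 1); last by lra.
by apply: le_trans hm; rewrite mulrC ler_wpM2l// -natrX ler_nat ltnW.
Qed.

Lemma rdiff_test_le m h phi x : `|h| * 2 ^+ m <= 1 ->
  `|rdiff s h (trig_re (test_coef al) phi m) x| <=
  (2 * p + 2) * (fdc s * `|h| `^ s) * kmin (2 ^+ m) (x - - (s * h / 2)) `^ p^-1.
Proof.
move=> hm; have s0 : 0 < s by rewrite addr_gt0// invr_gt0.
have pi1 : p^-1 < 1 by rewrite invf_lt1.
have pp : 0 < p^-1 by rewrite invr_gt0.
rewrite (rdiff_trig_re _ _ _ s0 (nh hm)) opprK.
rewrite (eq_big_nat _ _ (F2 := fun n => n%:R `^ (p^-1 - 1) *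
   (fdc s * (2 * sin (n%:R * `|h| / 2) / n%:R) `^ s) * 1 * cos (n%:R * (x + s * h / 2) + (phi + fphase s h)))); last first.
  move=> n /andP[n0 nm]; rewrite addrA mulrA [test_coef al n * _]mulrC; congr (_ * _).
  rewrite mulr1 (_ : p^-1 - 1 = - (1 - p^-1)); last by ring.
  rewrite -(sinc_factor _ _ n0 (sinc_ge0 (nh hm) nm)); congr (_ * _ `^ _).
  by rewrite /s; ring.
have -> : (2 * p + 2) * (fdc s * `|h| `^ s) = (2 / p^-1 + 2) * (fdc s * `|h| `^ s) * 1 by rewrite invrK mulr1.
exact: (sinc_kernel_bound (B := cst 1) _ _ s0 pp pi1 (nh hm)).
Qed.

Lemma modulus_test_le m u : 0 <= u -> u * 2 ^+ m <= 1 ->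
  (modulus s p%:E (f m) u <= (2 * (2 * p + 2) * (fdc s * u `^ s) * (4 * pi * m.+1%:R) `^ p^-1)%:E)%E.
Proof.
move=> u0 um; apply: ge_ereal_sup => _ [h /= hu <-].
have s0 : 0 < s by rewrite addr_gt0// invr_gt0.
have f0 := ltW (fdc_gt0 s0).
have hm : `|h| * 2 ^+ m <= 1 by apply: le_trans um; rewrite ler_pM2r// exprn_gt0.
rewrite normTE.
apply: (@le_trans _ _ (2 * (2 * p + 2) * (fdc s * `|h| `^ s) * (4 * pi * m.+1%:R) `^ p^-1)%:E).
  apply: (@NT_kmin R p _ m (- (s * h / 2))) => //.
    exact: mulr_ge0 (mulr_ge0 _ q2) (mulr_ge0 f0 (powR_ge0 _ _)).
  move=> x; rewrite (ger0_norm (normc_ge0 _)) fracdiffE; apply: le_trans (normc_le _) _.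
  pose b := (2 * p + 2) * (fdc s * `|h| `^ s) * kmin (2 ^+ m) (x - - (s * h / 2)) `^ p^-1.
  rewrite [leRHS](_ : _ = b + b); last by rewrite /b; ring.
  apply: lerD; rewrite /=.
    by rewrite /f Re_trig; exact: rdiff_test_le.
  by rewrite /f Im_trig; exact: rdiff_test_le.
rewrite lee_fin; apply: ler_wpM2r (powR_ge0 _ _) _ _ _; apply: (ler_wpM2l (mulr_ge0 _ q2)) => //.
by apply: (ler_wpM2l f0); apply: ge0_ler_powR; rewrite ?nnegrE// ltW.
Qed.

(** A qualitative bound, with [M] depending on [m], that places the test functions in the Besov
    space for an arbitrary admissible order [k]. *)
Lemma modulus_test_crude (k : R) m : 0 < k -> exists M : R, [/\ 0 <= M,
  forall u, (modulus k p%:E (f m) u <= M%:E)%E &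
  forall u, 0 <= u -> u * 2 ^+ m <= 1 -> (modulus k p%:E (f m) u <= (M * u `^ k)%:E)%E].
Proof.
move=> k0; have f0 := ltW (fdc_gt0 k0); have b0 := bcn_ge0 k0.
pose S := \sum_(1 <= n < 2 ^ m) `|test_coef al n|.
have S0 : 0 <= S by exact: sumr_ge0.
pose M1 := S * bcn k; pose M2 := S * (fdc k * (2 ^+ m) `^ k).
have M10 : 0 <= M1 by exact: mulr_ge0.
have M20 : 0 <= M2 by exact: mulr_ge0 S0 (mulr_ge0 f0 (powR_ge0 _ _)).
have c0 : 0 <= (2 * pi) `^ p^-1 :> R by exact: powR_ge0.
have two (z : R) : z + z = 2 * z by ring.
exists ((2 * pi) `^ p^-1 * (2 * (M1 + M2))); split.
- by rewrite mulr_ge0// mulr_ge0// addr_ge0.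
- move=> u; apply: ge_ereal_sup => _ [h /= hu <-]; rewrite normTE.
  apply: NT_bounded => //; first by rewrite mulr_ge0// addr_ge0.
  have bb phi x : `|rdiff k h (trig_re (test_coef al) phi m) x| <= M1.
    by apply: rdiff_bounded => // j; exact: trig_re_le.
  move=> x; rewrite (ger0_norm (normc_ge0 _)) fracdiffE; apply: le_trans (normc_le _) _.
  rewrite -two; apply: lerD; rewrite /= /f ?Re_trig ?Im_trig.
    by apply: le_trans (bb _ _) _; rewrite lerDl.
  by apply: le_trans (bb _ _) _; rewrite lerDl.
move=> u u0 um; apply: ge_ereal_sup => _ [h /= hu <-]; rewrite normTE.
have hm : `|h| * 2 ^+ m <= 1 by apply: le_trans um; rewrite ler_pM2r// exprn_gt0.
have uk : 0 <= u `^ k by exact: powR_ge0.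
rewrite -mulrA; apply: NT_bounded => //; first by rewrite mulr_ge0// mulr_ge0// addr_ge0.
have bb phi x : `|rdiff k h (trig_re (test_coef al) phi m) x| <= M2 * u `^ k.
  rewrite (rdiff_trig_re _ _ _ k0 (nh hm)); apply: le_trans (ler_norm_sum _ _ _) _.
  rewrite /M2 -[leRHS]mulrA /S [leRHS]mulr_suml; apply: ler_sum_nat => n /andP[n0 nm].
  rewrite normrM; apply: (ler_wpM2l (normr_ge0 _)); rewrite normrM.
  have sn := sinc_ge0 (nh hm) nm.
  rewrite (ger0_norm (mulr_ge0 f0 (powR_ge0 _ _))) -[leRHS]mulr1; apply: ler_pM => //; last exact: cos_max.
    exact: mulr_ge0 f0 (powR_ge0 _ _).
  rewrite -[leRHS]mulrA; apply: (ler_wpM2l f0); rewrite -powRM ?exprn_ge0//.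
  apply: ge0_ler_powR; rewrite ?nnegrE; [exact: ltW|exact: mulr_ge0|by rewrite mulr_ge0 ?exprn_ge0|].
  apply: (@le_trans _ _ (n%:R * `|h|)); last first.
    by apply: ler_pM => //; rewrite -natrX ler_nat ltnW.
  have := @sin_lip R 0 (n%:R * `|h| / 2).
  rewrite sin0 !subr0 (ger0_norm sn) [X in _ <= X -> _]ger0_norm ?divr_ge0 ?mulr_ge0//; lra.
move=> x; rewrite (ger0_norm (normc_ge0 _)) fracdiffE; apply: le_trans (normc_le _) _.
have MM : M2 * u `^ k <= (M1 + M2) * u `^ k by rewrite ler_wpM2r// lerDr.
rewrite -mulrA -two; apply: lerD; rewrite /= /f ?Re_trig ?Im_trig.
  exact: le_trans (bb _ _) MM.
exact: le_trans (bb _ _) MM.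
Qed.

(** The integrand is at most of order u^(k - 1/p - 1) near 0, integrable because [p^-1 < k], and of
    order u^(-1/p - 1) at infinity. *)
Lemma besov_test (k : R) m : p^-1 < k -> besov k p^-1 p%:E 1%E (f m).
Proof.
move=> pk; have pp : 0 < p^-1 by rewrite invr_gt0.
have k0 : 0 < k := lt_trans pp pk.
have [M [M0 h1 h2]] := modulus_test_crude m k0.
split; first exact: trig_LpT.
rewrite /besov_norm invr1 poweRe1; last first.
  apply: integral_ge0 => u /=; rewrite in_itv/= andbT => u0.
  by rewrite mule_ge0 ?poweR_ge0// lee_fin invr_ge0 ltW.
have mon (u : R) : 0 < u -> (0 <= (u `^ (- p^-1))%:E * modulus k p%:E (f m) u)%E.
  by move=> u0; rewrite mule_ge0 ?lee_fin ?powR_ge0// modulus_ge0// ltW.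
apply: (@integral_two_powers_lty R _ M (k - p^-1) p^-1 (dyad m)) => //.
- by rewrite subr_gt0.
- exact: dyad_gt0.
- by move=> u u0; rewrite mule_ge0 ?poweR_ge0// lee_fin invr_ge0 ltW.
- move=> u u0 um; rewrite poweRe1 ?mon//.
  have um1 : u * 2 ^+ m <= 1.
    by rewrite -ler_pdivlMr ?exprn_gt0// div1r -exprVn ltW.
  apply: le_trans (lee_wpmul2r _ (lee_wpmul2l _ (h2 u (ltW u0) um1))) _.
  - by rewrite lee_fin invr_ge0 ltW.
  - by rewrite lee_fin powR_ge0.
  rewrite -!EFinM lee_fin -(powR_inv1 (ltW u0)) mulrCA -!powRD ?(gt_eqF u0) ?implybT// -mulrA.
  by rewrite -powRD ?(gt_eqF u0) ?implybT// (_ : - p^-1 + k + -1 = k - p^-1 - 1)//; ring.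
- move=> u um; have u0 : 0 < u := lt_le_trans (dyad_gt0 m) um.
  rewrite poweRe1 ?mon//.
  apply: le_trans (lee_wpmul2r _ (lee_wpmul2l _ (h1 u))) _.
  - by rewrite lee_fin invr_ge0 ltW.
  - by rewrite lee_fin powR_ge0.
  rewrite -!EFinM lee_fin -(powR_inv1 (ltW u0)) [_ * M]mulrC -mulrA -powRD ?(gt_eqF u0) ?implybT//.
Qed.

End TestModuli.

Section Rates.
Context {R : realType}.
Local Notation mu := (@lebesgue_measure R).
Implicit Types (n m : nat) (t u x y c e : R).

(** The inequality 1 + x <= e^x at x = e y / (c + 1), raised to the power c; dividing by c + 1
    rather than c covers c = 0. *)
Lemma powR_le_exp y c e : 0 <= y -> 0 <= c -> 0 < e ->
  y `^ c <= ((c + 1) / e) `^ c * expR (e * y).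
Proof.
move=> y0 c0 e0; have c1 : 0 < c + 1 by rewrite ltr_wpDl.
have h : y <= (c + 1) / e * expR (e * y / (c + 1)).
  rewrite -ler_pdivrMl ?divr_gt0// invf_div mulrC mulrA.
  apply: le_trans (expR_ge1Dx _); rewrite [y * e]mulrC; lra.
apply: (@le_trans _ _ (((c + 1) / e * expR (e * y / (c + 1))) `^ c)).
  by apply: ge0_ler_powR; rewrite ?nnegrE ?mulr_ge0 ?invr_ge0 ?expR_ge0 ?(ltW c1) ?(ltW e0).
rewrite powRM ?divr_ge0 ?expR_ge0 ?(ltW c1) ?(ltW e0)// ler_wpM2l ?powR_ge0//.
rewrite -expRM ler_expR -mulrA ler_piMr ?mulr_ge0 ?(ltW e0)//.
by rewrite ler_pdivrMl// mulr1 lerDl.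
Qed.

Lemma powR_expE t e : 0 < t -> t `^ e = expR (e * ln t).
Proof. by move=> t0; rewrite /powR gt_eqF. Qed.

(** With y = 1 - ln t, the factor [expR (e * y)] of [powR_le_exp] times t^e is the constant
    [expR e]. *)
Lemma rate_bound t e b : 0 < t < 1 -> 0 < e -> 0 <= b ->
  t `^ e * (1 - ln t) `^ b <= expR e * (b + 1) `^ b * e `^ (- b).
Proof.
move=> t01 e0 b0; have /andP[t0 _] := t01; have t1 := one_le_lnV t01.
have y0 : 0 <= 1 - ln t by rewrite (le_trans ler01).
have := powR_le_exp y0 b0 e0 => h.
rewrite (powR_expE _ t0); apply: (le_trans (ler_wpM2l (expR_ge0 _) h)).
rewrite mulrCA -expRD (_ : e * ln t + e * (1 - ln t) = e); last by ring.
rewrite powRM ?invr_ge0 ?(ltW e0)//; last by rewrite addr_ge0.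
by rewrite (invr_powR _ (ltW e0)) mulrC mulrA.
Qed.

(** [powR_le_exp] with exponent [c + 1] and rate [ln 2 / 2]: the spare factor [2 * m.+1] absorbs the
    constant [K]. *)
Lemma power_le_pow2 c : 0 <= c -> exists m0, forall m, (m0 <= m)%N ->
  (2 * m.+1%:R) `^ c <= 2 ^+ m.
Proof.
move=> c0; have l2 := @ln2_gt0 R.
pose K := ((c + 1 + 1) / (ln 2 / 2)) `^ (c + 1).
exists (Num.truncn K).+1 => m hm.
have y0 : (0 : R) < 2 * m.+1%:R by rewrite mulr_gt0// ltr0n.
have hK : K <= m.+1%:R.
  apply: (@le_trans _ _ m%:R); last by rewrite ler_nat.
  by apply/ltW; apply: lt_le_trans (truncnS_gt _) _; rewrite ler_nat.
have := @powR_le_exp (2 * m.+1%:R) (c + 1) (ln 2 / 2) (ltW y0) _ _.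
rewrite addr_ge0// divr_gt0// => /(_ isT isT); rewrite -/K.
have -> : ln 2 / 2 * (2 * m.+1%:R) = m.+1%:R * ln 2 :> R by field.
rewrite expRM_natl lnK ?posrE// powRD ?(gt_eqF y0) ?implybT// powRr1 ?(ltW y0)// => h.
rewrite -(ler_pM2r y0); apply: (le_trans h).
rewrite exprS mulrCA [leRHS]mulrC -[leRHS]mulrA ler_pM2l// ler_wpM2r// exprn_ge0//.
Qed.

Lemma ln2_le1 : ln (2 : R) <= 1.
Proof. by have := @le_ln1Dx R 1; rewrite -[1 + 1]/(2%:R : R); apply; lra. Qed.

Section BesovNecessary.
Variables (al p b k : R).
Hypotheses (al0 : 0 < al) (p1 : 1 < p) (b0 : 0 <= b) (pk : p^-1 < k).
Let s := al + p^-1.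
Let p0 : 0 < p := lt_trans ltr01 p1.

(** The bound [modulus_test_le] holds for u <= 2^(-m) only. Taking t = 2^(-2m) leaves room for the
    power of the logarithm, so that the whole domain of integration stays in this range, while ln t
    remains of order m. *)
Lemma besov_necessary (C : R) : 0 < C ->
  (forall (f : R -> R[i]) (t : R), besov k p^-1 p%:E 1%E f -> 0 < t < 1 ->
    (modulus al +oo f t <= C%:E * \int[mu]_(u in `]0%R, (t * (1 - ln t) `^ (b / al))%R[)
       ((u `^ (- p^-1))%:E * modulus s p%:E f u * (u^-1)%:E))%E) ->
  1 <= b + p^-1.
Proof.
move=> C0 H; have pi0 := pi_gt0 R.
have s0 : 0 < s by rewrite addr_gt0// invr_gt0.
have fs := fdc_gt0 s0; have fal := fdc_gt0 al0; have g0 := geo_gt0 al0.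
have q2 : 0 <= 2 * p + 2 by rewrite addr_ge0// mulr_ge0// ltW.
have [m1 hm1] := power_le_pow2 (divr_ge0 b0 (ltW al0)).
have [m2 hm2] : exists m0, forall m, (m0 <= m)%N -> (m%:R : R)^-1 < 4 * pi / al.
  by apply: invn_lt_near; rewrite divr_gt0// mulr_gt0.
pose M m := 2 * (2 * p + 2) * fdc s * (4 * pi * m.+1%:R) `^ p^-1.
pose K := C * (2 * (2 * p + 2) * fdc s * (4 * pi) `^ p^-1) * geo al * 2 `^ b.
apply: (@growth_exponent R (fdc al * (2 / pi) `^ al / 2) K _ (maxn 1 (maxn m1 m2))).
  by rewrite divr_gt0// mulr_gt0// powR_gt0// divr_gt0.
move=> m; rewrite !geq_max => /and3P[m0 mm1 mm2].
pose t : R := dyad (m + m).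
have t0 : 0 < t by exact: dyad_gt0.
have tdy : t = dyad m * dyad m by rewrite /t /dyad exprD.
have dm1 : dyad m <= 1 :> R by rewrite /dyad exprn_ile1// invf_le1// ler1n.
have tm : t <= m%:R^-1.
  have d1 : dyad m <= (m%:R : R)^-1 by have [//|m00] := @dyad_le_inv R m; move: m0; rewrite m00.
  by apply: le_trans d1; rewrite tdy ler_piMl// ltW// dyad_gt0.
have t1 : t < 1.
  by rewrite /t /dyad exprVn invf_lt1 ?exprn_gt0// -natrX ltr1n -{1}(expn0 2) ltn_exp2l// addn_gt0 m0.
have t01 : 0 < t < 1 by rewrite t0.
have dm2 : dyad m * 2 ^+ m = 1 :> R by rewrite /dyad exprVn mulVf// expf_neq0.
have tm1 : t * 2 ^+ m <= 1 by rewrite tdy -mulrA dm2 mulr1.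
have alt : al * t < 4 * pi by rewrite mulrC -ltr_pdivlMr//; exact: le_lt_trans tm (hm2 m mm2).
have y1 := one_le_lnV t01.
have y2 : 1 - ln t <= 2 * m.+1%:R.
  rewrite /t /dyad lnXn// lnV ?posrE// mulNrn opprK -[m.+1%:R]natr1 -[ln 2 *+ _]mulr_natl natrD.
  by have := ln2_le1; have : (0 : R) <= m%:R by []; move: (ln 2) (m%:R) => l z; nra.
have y0 : 0 < 1 - ln t := lt_le_trans ltr01 y1.
set U := t * (1 - ln t) `^ (b / al).
have U0 : 0 < U by rewrite mulr_gt0// powR_gt0.
have Udm : U <= dyad m.
  rewrite /U {1}tdy -mulrA; apply: ler_piMr; first exact/ltW/dyad_gt0.
  rewrite -[leRHS]dm2; apply: ler_wpM2l; first exact/ltW/dyad_gt0.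
  apply: le_trans (hm1 m mm1); apply: ge0_ler_powR; rewrite ?nnegrE ?mulr_ge0 ?(ltW y0)//.
  by rewrite invr_ge0 ltW.
have low := modulus_trig_ge al0 t0 tm1 alt.
have up := H (trig (test_coef al) 0 m) t (besov_test al p1 m pk) t01.
have M0 : 0 <= M m by rewrite mulr_ge0 ?powR_ge0// mulr_ge0 ?(ltW fs)// mulr_ge0.
have int : (\int[mu]_(u in `]0%R, U[) ((u `^ (- p^-1))%:E * modulus s p%:E (trig (test_coef al) 0 m) u * (u^-1)%:E)
    <= (M m * (U `^ al * geo al))%:E)%E.
  apply: integral_power_le => // u u0 uU; split.
    by rewrite mule_ge0 ?lee_fin ?invr_ge0 ?(ltW u0)// mule_ge0 ?lee_fin ?powR_ge0// modulus_ge0// ltW.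
  have um : u * 2 ^+ m <= 1.
    by rewrite -[leRHS]dm2 ler_pM2r ?exprn_gt0//; exact: le_trans (ltW uU) Udm.
  apply: le_trans (lee_wpmul2r _ (lee_wpmul2l _ (modulus_test_le al0 p1 (ltW u0) um))) _.
  - by rewrite lee_fin invr_ge0 ltW.
  - by rewrite lee_fin powR_ge0.
  rewrite -!EFinM lee_fin -(powR_inv1 (ltW u0)).
  have -> : u `^ (al - 1) = u `^ (- p^-1) * u `^ s * u `^ (-1).
    by rewrite -!powRD ?(gt_eqF u0) ?implybT//; congr (_ `^ _); rewrite /s; ring.
  by rewrite le_eqVlt; apply/orP; left; apply/eqP; rewrite /M /s; ring.
have := le_trans low (le_trans up (lee_wpmul2l (x := C%:E) _ int)).
rewrite lee_fin (ltW C0) => /(_ isT); rewrite -EFinM lee_fin.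
have -> : U `^ al = t `^ al * (1 - ln t) `^ b.
  by rewrite /U powRM ?(ltW t0) ?powR_ge0// -powRrM divfK// lt0r_neq0.
have ta : 0 < t `^ al by exact: powR_gt0.
have yb : (1 - ln t) `^ b <= 2 `^ b * m.+1%:R `^ b.
  by rewrite -powRM//; apply: ge0_ler_powR; rewrite ?nnegrE ?mulr_ge0// ltW.
move=> h.
have {}h : fdc al * (2 / pi) `^ al / 2 * m%:R <= C * (M m * ((1 - ln t) `^ b * geo al)).
  by rewrite -(ler_pM2l ta); apply: le_trans (le_trans _ h) _; rewrite le_eqVlt; apply/orP; left; apply/eqP; ring.
apply: (le_trans h); rewrite powRD; last by rewrite pnatr_eq0 implybT.
apply: (@le_trans _ _ (C * (M m * (2 `^ b * m.+1%:R `^ b * geo al)))).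
  by apply: (ler_wpM2l (ltW C0)); apply: (ler_wpM2l M0); apply: (ler_wpM2r (ltW g0)).
rewrite /M /K (@powRM _ (4 * pi)) ?mulr_ge0 ?(ltW pi0)//.
by rewrite le_eqVlt; apply/orP; left; apply/eqP; ring.
Qed.

End BesovNecessary.

Section EmbeddingRate.
Variables (al p b : R).
Hypotheses (al0 : 0 < al) (b0 : 0 <= b).
Let s := al + p^-1.

Lemma sobolev_norm_ge0 f : (0 <= sobolev_norm s p%:E f)%E.
Proof.
apply: (@le_trans _ _ (fracderiv_norm s p%:E 1 f)); last first.
  by apply: ereal_sup_ubound; exists 1 => //=; exact: normr1.
by apply: le_ereal_inf_tmp => _ [g _ <-]; exact: normT_ge0.
Qed.

Lemma embedded_rate :
  embedded (sobolev s p%:E) (lip al b) (sobolev_norm s p%:E) (lip_norm al b) ->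
  exists abar C : R, [/\ 0 < abar < al, 0 < C &
    forall (alpha0 : R) (f : R -> R[i]), abar < alpha0 < al -> sobolev s p%:E f ->
      (ereal_sup [set (t `^ (- alpha0))%:E * modulus al +oo f t | t in `]0%R, 1%R[%classic]
       <= (C * (al - alpha0) `^ (- b))%:E * sobolev_norm s p%:E f)%E].
Proof.
(* Any lower end in (0, al) would do: it guarantees [al - a0 <= al], so that [expR al] dominates the
   factor [expR e] of [rate_bound]. *)
move=> [_ [C [C0 HC]]]; exists (al / 2), (expR al * (b + 1) `^ b * C); split.
- by rewrite divr_gt0//= ltr_pdivrMr// ltr_pMr// ltr1n.
- by rewrite mulr_gt0// mulr_gt0 ?expR_gt0// powR_gt0// ltr_wpDl.
move=> a0 f /andP[a01 a02] sf; apply: ge_ereal_sup => _ [t /= t01 <-].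
rewrite in_itv/= in t01; have /andP[t0 _] := t01; have t1 := one_le_lnV t01.
have y0 : 0 < 1 - ln t := lt_le_trans ltr01 t1.
pose e := al - a0; have e0 : 0 < e by rewrite subr_gt0.
have N0 := sobolev_norm_ge0 f.
have h1 : ((t `^ (- al) * (1 - ln t) `^ (- b))%:E * modulus al +oo f t <= C%:E * sobolev_norm s p%:E f)%E.
  by apply: le_trans (HC f sf); apply: ereal_sup_ubound; exists t => //=; rewrite in_itv.
have w0 : 0 <= t `^ e * (1 - ln t) `^ b by rewrite mulr_ge0 ?powR_ge0.
have -> : t `^ (- a0) = t `^ e * (1 - ln t) `^ b * (t `^ (- al) * (1 - ln t) `^ (- b)).
  rewrite (_ : _ * _ = t `^ e * t `^ (- al) * ((1 - ln t) `^ b * (1 - ln t) `^ (- b))); last by ring.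
  rewrite -!powRD ?(gt_eqF t0) ?(gt_eqF y0) ?implybT// subrr powRr0 mulr1 /e; congr (_ `^ _); ring.
rewrite EFinM -muleA; apply: le_trans (lee_wpmul2l _ h1) _; first by rewrite lee_fin.
rewrite muleA -EFinM lee_wpmul2r// lee_fin [leRHS]mulrAC; apply: ler_wpM2r; first exact: ltW.
apply: le_trans (rate_bound t01 e0 b0) _; rewrite ler_wpM2r ?powR_ge0//.
by rewrite ler_wpM2r ?powR_ge0// ler_expR /e; lra.
Qed.

End EmbeddingRate.
End Rates.

Unset Implicit Arguments.

Theorem theorem6p1 (R : realType) (p p' alpha b k : R)
  (hp : 1 < p) (hp' : p^-1 + p'^-1 = 1) (halpha : 0 < alpha) (hb : 0 <= b)
  (hk : p^-1 < k) :
  [<->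
    (* (i) *)
    embedded (sobolev (alpha + p^-1) p%:E) (lip alpha b)
             (sobolev_norm (alpha + p^-1) p%:E) (lip_norm alpha b);
    (* (ii) *)
    exists C : R, 0 < C /\
      forall (f : R -> R[i]) (t : R),
        besov k p^-1 p%:E 1%E f -> 0 < t < 1 ->
        (modulus alpha +oo f t <=
         C%:E * \int[lebesgue_measure]_(u in
                       `]0%R, (t * (1 - ln t) `^ (b / alpha))%R[)
                  ((u `^ (- p^-1))%:E * modulus (alpha + p^-1) p%:E f u
                   * (u^-1)%:E))%E;
    (* (iii) *)
    exists abar C : R, [/\ 0 < abar < alpha, 0 < C &
      forall (alpha0 : R) (f : R -> R[i]),
        abar < alpha0 < alpha -> sobolev (alpha + p^-1) p%:E f ->
        (ereal_sup [set (t `^ (- alpha0))%:E * modulus alpha +oo f t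
                   | t in `]0%R, 1%R[%classic]
         <= (C * (alpha - alpha0) `^ (- b))%:E
            * sobolev_norm (alpha + p^-1) p%:E f)%E];
    (* (iv) *)
    p'^-1 <= b ].
Proof.
have p'1 : 1 < p'.
  have h : p^-1 < 1 by rewrite invf_lt1// (lt_trans ltr01).
  have h0 : 0 < p^-1 by rewrite invr_gt0 (lt_trans ltr01).
  have e : p'^-1 = 1 - p^-1 by rewrite -hp' addrAC subrr add0r.
  by rewrite -[p']invrK invf_gt1 ?e ?subr_gt0// gtrBl.
have iv_iff : (1 <= b + p^-1) -> p'^-1 <= b by rewrite -hp' [b + _]addrC lerD2l.
have iv_i := @sobolev_embedded R alpha p p' halpha hp p'1 hp' b.
have iv_ii (qb : p'^-1 <= b) : exists C : R, 0 < C /\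
      forall (f : R -> R[i]) (t : R),
        besov k p^-1 p%:E 1%E f -> 0 < t < 1 ->
        (modulus alpha +oo f t <=
         C%:E * \int[lebesgue_measure]_(u in
                       `]0%R, (t * (1 - ln t) `^ (b / alpha))%R[)
                  ((u `^ (- p^-1))%:E * modulus (alpha + p^-1) p%:E f u
                   * (u^-1)%:E))%E.
  have [C [C0 h]] := @besov_modulus_le R alpha p p' halpha hp p'1 hp' b qb.
  by exists C; split => // f t [Lf _]; exact: h.
have iii_iv (abar C : R) := @rate_necessary R alpha p b halpha hp hb abar C.
have i_iii := @embedded_rate R alpha p b halpha hb.
have ii_iv (C : R) := @besov_necessary R alpha p b k halpha hp hb hk C.
(* The implications from (i) to (ii) and from (ii) to (iii) pass through the numerical condition
   (iv). *)
tfae.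
- by move=> /i_iii[abar [C [ab C0 h]]]; apply/iv_ii/iv_iff; exact: (iii_iv abar C ab C0 h).
- by move=> [C [C0 h]]; apply/i_iii/iv_i/iv_iff; exact: (ii_iv C C0 h).
- by move=> [abar [C [ab C0 h]]]; apply: iv_iff; exact: (iii_iv abar C ab C0 h).
- exact: iv_i.
Qed.
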